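(* Let $\sigma$ be a structure that is stably metrizable and Polish with preserved roots, and let $I=[0,t_\infty]$ with $t_\infty\in[0,\infty]$, where $I$ means $[0,\infty)$ if $t_\infty=\infty$. Let $\tau_D(I,\sigma)$ be the structure assigning to each bcm space $X$ the space $D(I,\sigma(X))$ of cadlag functions $I\to\sigma(X)$ with the $J_1$-Skorohod topology, and to each isometric embedding $f\colon X\to Y$ the map $F\mapsto\sigma_f\circ F$. Then $\tau_D(I,\sigma)$ is stably metrizable and Polish with preserved roots.
   Context: A bcm (boundedly-compact metric) space is a non-empty metric space in which every closed ball of finite radius is compact; a rooted bcm space $(X,\rho_X)$ is a bcm space $X$ with a distinguished point $\rho_X$. The metric of $X$ is denoted $d_X$. An isometric embedding is a distance-preserving map (not necessarily onto); a map is root-preserving if it sends root to root. A topological embedding is a homeomorphism onto its image. $J_1$-Skorohod topology: for a metric space $S$ and $t\in(0,\infty)$, on $D([0,t],S)$ it is induced by $$d^{J_1,t}_S(F,G)=\inf_{\lambda}\Bigl\{\sup_{0\le s_1<s_2\le t}\Bigl|\log\tfrac{\lambda(s_2)-\lambda(s_1)}{s_2-s_1}\Bigr|\vee\sup_{s\in[0,t]}d_S(F(s),G(\lambda(s)))\Bigr\},$$ the infimum over increasing continuous bijections $\lambda$ of $[0,t]$; on $D([0,\infty),S)$ by $d^{J_1}_S(F,G)=\int_0^\infty e^{-t}(1\wedge d^{J_1,t}_S(F|_{[0,t]},G|_{[0,t]}))dt$. It depends only on the topology of $S$. (For $t=0$, $D(\{0\},S)=S$.) Structure: a functor $\tau$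 from the category of bcm spaces (morphisms: isometric embeddings) to the category of metrizable topological spaces (morphisms: topological embeddings). That is, to each bcm space $X$ it assigns a metrizable space $\tau(X)$ and to each isometric embedding $f\colon X\to Y$ a topological embedding $\tau_f\colon\tau(X)\to\tau(Y)$, with $\tau_{\mathrm{id}_X}=\mathrm{id}_{\tau(X)}$ and $\tau_{g\circ f}=\tau_g\circ\tau_f$. When $X$ is isometrically embedded into $Y$ by $f$, $\tau(X)$ is regarded as a subspace of $\tau(Y)$ via $\tau_f$. The structure is separable if each $\tau(X)$ is separable. $\tau$ is continuous if all of the following hold. Embedding-continuity: if $f_n\colon X\to Y$, $n\in\mathbb{N}\cup\{\infty\}$, are isometric embeddings between bcm spaces with $f_n\to f_\infty$ uniformly on compact sets, then $\tau_{f_n}(a)\to\tau_{f_\infty}(a)$ for all $a\in\tau(X)$. Upper and lower semicontinuity: whenever bcm spaces $X_n$, $n\in\mathbb{N}\cup\{\infty\}$, are isometrically embedded into a common bcm space $Y$ so that $X_n\to X_\infty$ in the Fell topology as subsets of $Y$, (upper) if $a_n\in\tau(X_n)$ converge to some $a\in\tau(Y)$ then $a\in\tau(X_\infty)$; (lower) for every $a\in\tau(X_\infty)$ there are a subsequence $(n_k)$ and $a_k\in\tau(X_{n_k})$ with $a_k\to a$ in $\tau(Y)$. The Fell topology on closed subsets of $Y$ is generated by the sets $\{A: A\cap K=\emptyset\}$ ($K$ compact) and $\{A: A\cap U\ne\emptyset\}$ ($U$ open). Element-rooted metrization $\tau^{\mathrm{erm}}$: a choice, for each bcm space $X$, of a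 metric $d^{\tau^{\mathrm{erm}}}_{X}$ on $\tau(X)\times X$ inducing the product topology such that $\tau_f\times f$ is distance-preserving for every isometric embedding $f\colon X\to Y$. It is stable if there is $\Theta\colon[0,\infty)\to[0,\infty)$ with $\lim_{\varepsilon\to0}\Theta(\varepsilon)=\Theta(0)=0$ such that: for all bcm spaces $X,Y,M_1,M_2$, isometric embeddings $f_i\colon X\to M_i$, $g_i\colon Y\to M_i$ ($i=1,2$) and $\varepsilon\ge 0$ with $d_{M_2}(f_2(x),g_2(y))\le d_{M_1}(f_1(x),g_1(y))+\varepsilon$ for all $x\in X,y\in Y$, one has $$d^{\tau^{\mathrm{erm}}}_{M_2}\bigl((\tau_{f_2}(a),f_2(x)),(\tau_{g_2}(b),g_2(y))\bigr)\le d^{\tau^{\mathrm{erm}}}_{M_1}\bigl((\tau_{f_1}(a),f_1(x)),(\tau_{g_1}(b),g_1(y))\bigr)+\Theta(\varepsilon)$$ for all $(a,x)\in\tau(X)\times X$, $(b,y)\in\tau(Y)\times Y$. $\tau$ is stably metrizable if it admits a stable element-rooted metrization. Space-rooted metrization: a choice, for each rooted bcm space $(X,\rho_X)$, of a metric on $\tau(X)$ inducing the given topology, such that $\tau_f$ is distance-preserving for every root-preserving isometric embedding $f\colon(X,\rho_X)\to(Y,\rho_Y)$ (with respect to the metrics assigned to $(X,\rho_X)$ and $(Y,\rho_Y)$). It is complete if all these metrics are complete. $\tau$ is Polish with preserved roots if there exist another structure $\tilde\tau$, a topological embedding $\eta\colon\tau\Rightarrow\tilde\tau$ (a family of topological embeddings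 $\eta_X\colon\tau(X)\to\tilde\tau(X)$ with $\eta_Y\circ\tau_f=\tilde\tau_f\circ\eta_X$ for every isometric embedding $f\colon X\to Y$), and families $(\tilde\tau_k)_{k\ge1}$, where each $\tilde\tau_k$ assigns to every rooted bcm space $(X,\rho_X)$ a subset $\tilde\tau_k(X,\rho_X)\subseteq\tilde\tau(X)$ with $\tilde\tau_f(\tilde\tau_k(X,\rho_X))\subseteq\tilde\tau_k(Y,\rho_Y)$ for every root-preserving isometric embedding $f$, such that: (P1) $\tilde\tau$ is continuous, separable, and admits a complete space-rooted metrization; (P2) each $\tilde\tau_k(X,\rho_X)$ is open in $\tilde\tau(X)$, and $\tilde\tau_k$ is pullback-stable: $\tilde\tau_f^{-1}(\tilde\tau_k(Y,\rho_Y))=\tilde\tau_k(X,\rho_X)$ for every root-preserving isometric embedding $f\colon(X,\rho_X)\to(Y,\rho_Y)$; (P3) $\eta_X(\tau(X))=\bigcap_{k\ge1}\tilde\tau_k(X,\rho_X)$ for every rooted bcm space $(X,\rho_X)$. *)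

(* Defs.v *)
From HB Require Import structures.
From mathcomp Require Import all_boot all_order all_algebra.
From mathcomp Require Import all_classical all_reals all_analysis.

Set Implicit Arguments.
Unset Strict Implicit.
Unset Printing Implicit Defensive.

Import Order.TTheory GRing.Theory Num.Theory.
Import numFieldNormedType.Exports.

Local Open Scope classical_set_scope.
Local Open Scope ring_scope.

Definition is_metric (R : realType) (T : Type) (d : T -> T -> R) : Prop :=
  [/\ forall x y, 0 <= d x y,
      forall x y, d x y = 0 <-> x = y,
      forall x y, d x y = d y x &
      forall x y z, d x z <= d x y + d y z].

Definition metrizes (R : realType) (T : topologicalType) (d : T -> T -> R)
    : Prop :=
  is_metric d /\
  forall (x : T) (A : set T),
    nbhs x A <-> exists2 e : R, 0 < e & [set y | d x y < e] `<=` A.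

Definition metrizable (R : realType) (T : topologicalType) : Prop :=
  exists d : T -> T -> R, metrizes d.

Definition separable (T : topologicalType) : Prop :=
  exists2 A : set T, countable A & dense A.

(* A homeomorphism onto its image: a continuous injection that is open as a
   map to its range, the latter carrying the subspace topology. *)
Definition topological_embedding (S T : topologicalType) (f : S -> T) : Prop :=
  [/\ injective f, continuous f &
      forall U : set S, open U ->
        exists2 V : set T, open V & f @` U = V `&` range f].

Definition complete_metric (R : realType) (T : topologicalType)
    (d : T -> T -> R) : Prop :=
  forall u : nat -> T,
    (forall e : R, 0 < e ->
       exists N : nat, forall m n, (N <= m)%N -> (N <= n)%N ->
         d (u m) (u n) < e) ->
    exists l : T, forall e : R, 0 < e -> \forall n \near \oo, d (u n) l < e.

Record bcm (R : realType) := Bcm {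
  bcm_sort :> metricType R;
  bcm_nonempty : inhabited bcm_sort;
  bcm_compact : forall (x : bcm_sort) (r : R),
    compact [set y : bcm_sort | mdist x y <= r] }.

Record isoemb (R : realType) (X Y : bcm R) := IsoEmb {
  isoemb_fun :> X -> Y;
  isoembP : forall x x' : X,
    mdist (isoemb_fun x) (isoemb_fun x') = mdist x x' }.

Definition iso_id (R : realType) (X : bcm R) : isoemb X X :=
  @IsoEmb R X X id (fun _ _ => erefl).

Lemma iso_comp_subproof (R : realType) (X Y Z : bcm R)
    (g : isoemb Y Z) (f : isoemb X Y) (x x' : X) :
  mdist (g (f x)) (g (f x')) = mdist x x'.
Proof. by rewrite !isoembP. Qed.

Definition iso_comp (R : realType) (X Y Z : bcm R)
    (g : isoemb Y Z) (f : isoemb X Y) : isoemb X Z :=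
  IsoEmb (iso_comp_subproof g f).

Record closed_subset (T : topologicalType) := ClosedSubset {
  closed_subset_val :> set T;
  closed_subsetP : closed closed_subset_val }.

HB.instance Definition _ (T : topologicalType) :=
  gen_eqMixin (closed_subset T).
HB.instance Definition _ (T : topologicalType) :=
  gen_choiceMixin (closed_subset T).

Definition fell_subbase (T : topologicalType) : set (set (closed_subset T)) :=
  [set O | (exists2 K : set T, compact K &
              O = [set A : closed_subset T | A `&` K = set0]) \/
           (exists2 U : set T, open U &
              O = [set A : closed_subset T | A `&` U !=set0])].

HB.instance Definition _ (T : topologicalType) :=
  isSubBaseTopological.Build (closed_subset T) (@fell_subbase T) id.

Lemma isoemb_continuous (R : realType) (X Y : bcm R) (f : isoemb X Y) :
  continuous f.
Proof.
move=> x; apply/metricType_numDomainType.cvgrPdist_lt => e e0.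
near=> y; rewrite isoembP; near: y.
exact: (metricType_numDomainType.cvgr_dist_lt (@cvg_id _ (nbhs x))).
Unshelve. all: by end_near. Qed.

Lemma isoemb_range_closed (R : realType) (X Y : bcm R) (f : isoemb X Y) :
  closed (range f).
Proof.
move=> p clp; have [x0] := bcm_nonempty X.
pose K := [set y : X | mdist x0 y <= mdist (f x0) p + 1].
have clK : closed (f @` K).
  apply: compact_closed; first exact: metric_hausdorff.
  apply: continuous_compact; last exact: bcm_compact.
  by apply: continuous_subspaceT; exact: isoemb_continuous.
suff : closure (f @` K) p by move=> /clK[y _ <-]; exists y.
move=> B Bp.
have Bp1 : nbhs p (B `&` ball p 1) by apply: filterI => //; exact: nbhsx_ballx.
have [_ [[y _ <-] [By]]] := clp _ Bp1.
rewrite ballEmdist /= => py; exists (f y); split=> //; exists y => //=.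
rewrite /K /= -(isoembP f); apply: le_trans (metric_triangle _ p _) _.
by rewrite lerD2l ltW.
Qed.

Definition iso_image (R : realType) (X Y : bcm R) (f : isoemb X Y)
    : closed_subset Y :=
  ClosedSubset (@isoemb_range_closed R X Y f).

Record prestructure (R : realType) := PreStructure {
  st_obj :> bcm R -> topologicalType;
  st_map : forall X Y : bcm R, isoemb X Y -> st_obj X -> st_obj Y }.
Arguments st_map {R} _ {X Y} _ _.

Record is_structure (R : realType) (tau : prestructure R) : Prop := {
  st_metrizable : forall X : bcm R, metrizable R (tau X);
  st_embedding : forall (X Y : bcm R) (f : isoemb X Y),
    topological_embedding (st_map tau f);
  st_map_id : forall X : bcm R, st_map tau (iso_id X) = id;
  st_map_comp : forall (X Y Z : bcm R) (g : isoemb Y Z) (f : isoemb X Y),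
    st_map tau (iso_comp g f) = st_map tau g \o st_map tau f }.

Record structure (R : realType) := Structure {
  st_pre :> prestructure R;
  st_laws : is_structure st_pre }.

Definition separable_structure (R : realType) (tau : prestructure R) : Prop :=
  forall X : bcm R, separable (tau X).

Definition embedding_continuous (R : realType) (tau : prestructure R) : Prop :=
  forall (X Y : bcm R) (f : nat -> isoemb X Y) (finf : isoemb X Y),
    {family compact,
       (fun n => f n : X -> Y) @ \oo --> (finf : X -> Y)} ->
    forall a : tau X, st_map tau (f n) a @[n --> \oo] --> st_map tau finf a.

Definition upper_semicontinuous (R : realType) (tau : prestructure R) : Prop :=
  forall (X : nat -> bcm R) (Xinf Y : bcm R)
    (iota : forall n, isoemb (X n) Y) (iotainf : isoemb Xinf Y),
    iso_image (iota n) @[n --> \oo] --> iso_image iotainf ->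
    forall (a : forall n, tau (X n)) (b : tau Y),
      st_map tau (iota n) (a n) @[n --> \oo] --> b ->
      range (st_map tau iotainf) b.

Definition lower_semicontinuous (R : realType) (tau : prestructure R) : Prop :=
  forall (X : nat -> bcm R) (Xinf Y : bcm R)
    (iota : forall n, isoemb (X n) Y) (iotainf : isoemb Xinf Y),
    iso_image (iota n) @[n --> \oo] --> iso_image iotainf ->
    forall a : tau Xinf,
      exists (phi : nat -> nat) (b : forall k, tau (X (phi k))),
        {homo phi : m n / (m < n)%N} /\
        st_map tau (iota (phi k)) (b k) @[k --> \oo] --> st_map tau iotainf a.

Definition continuous_structure (R : realType) (tau : prestructure R) : Prop :=
  [/\ embedding_continuous tau, upper_semicontinuous tau &
      lower_semicontinuous tau].

Definition is_element_rooted_metrization (R : realType) (tau : prestructure R)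
    (d : forall X : bcm R, (tau X * X)%type -> (tau X * X)%type -> R) : Prop :=
  (forall X : bcm R, metrizes (d X)) /\
  (forall (X Y : bcm R) (f : isoemb X Y) (a b : tau X) (x y : X),
     d Y (st_map tau f a, f x) (st_map tau f b, f y) = d X (a, x) (b, y)).

Definition stable_metrization (R : realType) (tau : prestructure R)
    (d : forall X : bcm R, (tau X * X)%type -> (tau X * X)%type -> R) : Prop :=
  exists Theta : R -> R,
    [/\ forall e, 0 <= e -> 0 <= Theta e,
        Theta e @[e --> 0^'+] --> 0,
        Theta 0 = 0 &
        forall (X Y M1 M2 : bcm R)
          (f1 : isoemb X M1) (f2 : isoemb X M2)
          (g1 : isoemb Y M1) (g2 : isoemb Y M2) (e : R),
          0 <= e ->
          (forall (x : X) (y : Y),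
             mdist (f2 x) (g2 y) <= mdist (f1 x) (g1 y) + e) ->
          forall (a : tau X) (x : X) (b : tau Y) (y : Y),
            d M2 (st_map tau f2 a, f2 x) (st_map tau g2 b, g2 y) <=
            d M1 (st_map tau f1 a, f1 x) (st_map tau g1 b, g1 y) + Theta e].

Definition stably_metrizable (R : realType) (tau : prestructure R) : Prop :=
  exists2 d : forall X : bcm R, (tau X * X)%type -> (tau X * X)%type -> R,
    is_element_rooted_metrization d & stable_metrization d.

Definition is_space_rooted_metrization (R : realType) (tau : prestructure R)
    (d : forall X : bcm R, X -> tau X -> tau X -> R) : Prop :=
  (forall (X : bcm R) (rho : X), metrizes (d X rho)) /\
  (forall (X Y : bcm R) (rhoX : X) (rhoY : Y) (f : isoemb X Y),
     f rhoX = rhoY ->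
     forall a b : tau X,
       d Y rhoY (st_map tau f a) (st_map tau f b) = d X rhoX a b).

Definition complete_metrization (R : realType) (tau : prestructure R)
    (d : forall X : bcm R, X -> tau X -> tau X -> R) : Prop :=
  forall (X : bcm R) (rho : X), complete_metric (d X rho).

Definition embedding_of_structures (R : realType) (tau tau' : prestructure R)
    (eta : forall X : bcm R, tau X -> tau' X) : Prop :=
  (forall X : bcm R, topological_embedding (eta X)) /\
  (forall (X Y : bcm R) (f : isoemb X Y),
     eta Y \o st_map tau f = st_map tau' f \o eta X).

Definition polish_preserved_roots (R : realType) (tau : prestructure R)
    : Prop :=
  exists (tau' : structure R) (eta : forall X : bcm R, tau X -> tau' X)
         (tauk : nat -> forall X : bcm R, X -> set (tau' X)),
    [/\ embedding_of_structures eta,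
        (forall k (X Y : bcm R) (rhoX : X) (rhoY : Y) (f : isoemb X Y),
           f rhoX = rhoY ->
           st_map tau' f @` tauk k X rhoX `<=` tauk k Y rhoY),
        [/\ continuous_structure tau', separable_structure tau' &
            exists2 d : forall X : bcm R, X -> tau' X -> tau' X -> R,
              is_space_rooted_metrization d & complete_metrization d],
        (forall k (X : bcm R) (rho : X), open (tauk k X rho)) /\
        (forall k (X Y : bcm R) (rhoX : X) (rhoY : Y) (f : isoemb X Y),
           f rhoX = rhoY ->
           st_map tau' f @^-1` tauk k Y rhoY = tauk k X rhoX) &
        forall (X : bcm R) (rho : X),
          range (eta X) = \bigcap_k tauk k X rho].

(* [0, T] if T is finite, [0, +oo) if T = +oo *)
Definition horizon (R : realType) (T : \bar R) : set R :=
  [set t : R | 0 <= t /\ (t%:E <= T)%E].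

(* At the left (resp. right) endpoint of the horizon the punctured one-sided
   filter below is improper, so no condition is imposed there. *)
Definition cadlag (R : realType) (T : \bar R) (S : topologicalType)
    (F : horizon T -> S) : Prop :=
  forall t : horizon T,
    F @ within [set s : horizon T | \val t < \val s] (nbhs t) --> F t /\
    exists l : S,
      F @ within [set s : horizon T | \val s < \val t] (nbhs t) --> l.

Record cadlag_fun (R : realType) (T : \bar R) (S : topologicalType) :=
  CadlagFun {
    cadlag_val :> horizon T -> S;
    cadlagP : cadlag cadlag_val }.

Section J1_distance.
Local Open Scope ereal_scope.

Definition time_change (R : realType) (t : R)
    (lambda : horizon t%:E -> horizon t%:E) : Prop :=
  [/\ forall s1 s2, (\val s1 < \val s2)%R ->
        (\val (lambda s1) < \val (lambda s2))%R,
      continuous lambda & bijective lambda].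

(* The supremum of the log-slopes is over the empty set if t = 0; it is then
   -oo, which is neutral for maxe. *)
Definition J1_dist_finite (R : realType) (S : Type) (d : S -> S -> R) (t : R)
    (F G : horizon t%:E -> S) : \bar R :=
  ereal_inf [set maxe
    (ereal_sup [set z : \bar R | exists s1 s2 : horizon t%:E,
       (\val s1 < \val s2)%R /\
       z = (`| ln ((\val (lambda s2) - \val (lambda s1)) /
                   (\val s2 - \val s1)) |%R)%:E])
    (ereal_sup [set (d (F s) (G (lambda s)))%:E | s in setT])
    | lambda in @time_change R t].

Lemma sub_horizon (R : realType) (t : R) :
  horizon t%:E `<=` @horizon R +oo.
Proof. by move=> s [s0 _]; split=> //; rewrite leey. Qed.

Definition restrict_horizon (R : realType) (S : Type) (t : R)
    (F : @horizon R +oo -> S) : horizon t%:E -> S :=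
  fun s => F (SigSub (mem_set (sub_horizon (set_valP s)))).

Definition J1_dist_infinite (R : realType) (S : Type) (d : S -> S -> R)
    (F G : @horizon R +oo -> S) : \bar R :=
  \int[lebesgue_measure]_(t in `[0%R, +oo[)
     ((expR (- t))%:E *
      mine 1 (J1_dist_finite d (restrict_horizon (t := t) F)
                               (restrict_horizon (t := t) G))).

Definition J1_dist (R : realType) (S : Type) (d : S -> S -> R) (T : \bar R)
    : (horizon T -> S) -> (horizon T -> S) -> \bar R :=
  match T with
  | t%:E => @J1_dist_finite R S d t
  | +oo => @J1_dist_infinite R S d
  | -oo => fun _ _ => 0
  end.

End J1_distance.

(* The J1 topology does not depend on the metric inducing the topology of S;
   quantifying over all these metrics avoids choosing one. *)
Definition J1_open (R : realType) (T : \bar R) (S : topologicalType)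
    : set (set (cadlag_fun T S)) :=
  [set U | forall d : S -> S -> R, metrizes d ->
     forall F : cadlag_fun T S, U F ->
       exists2 e : R, 0 < e &
         [set G : cadlag_fun T S | (J1_dist d F G < e%:E)%E] `<=` U].

HB.instance Definition _ (R : realType) (T : \bar R) (S : topologicalType) :=
  gen_eqMixin (cadlag_fun T S).
HB.instance Definition _ (R : realType) (T : \bar R) (S : topologicalType) :=
  gen_choiceMixin (cadlag_fun T S).

Section J1_topology.
Variables (R : realType) (T : \bar R) (S : topologicalType).

Lemma J1_openT : J1_open [set: cadlag_fun T S].
Proof. by move=> d dS F _; exists 1. Qed.

Lemma J1_openI (U V : set (cadlag_fun T S)) :
  J1_open U -> J1_open V -> J1_open (U `&` V).
Proof.
move=> oU oV d dS F [UF VF].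
have [e1 e10 h1] := oU d dS F UF; have [e2 e20 h2] := oV d dS F VF.
exists (Num.min e1 e2); first by rewrite lt_min e10.
move=> G /= FG; split; [apply: h1|apply: h2] => /=;
  by apply: lt_le_trans FG _; rewrite lee_fin ge_min lexx ?orbT.
Qed.

Lemma J1_open_bigU (I : Type) (U : I -> set (cadlag_fun T S)) :
  (forall i, J1_open (U i)) -> J1_open (\bigcup_i U i).
Proof.
move=> oU d dS F [i _ UF]; have [e e0 h] := oU i d dS F UF.
by exists e => // G /h UG; exists i.
Qed.

HB.instance Definition _ :=
  isOpenTopological.Build (cadlag_fun T S) J1_openT J1_openI J1_open_bigU.

End J1_topology.

Lemma cadlag_comp (R : realType) (T : \bar R) (S S' : topologicalType)
    (h : S -> S') (F : cadlag_fun T S) :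
  continuous h -> cadlag (h \o F).
Proof.
move=> hc t; have [Fr [l Fl]] := cadlagP F t; split.
  exact: (@cvg_comp _ _ _ F h _ _ _ Fr (hc (F t))).
by exists (h l); exact: (@cvg_comp _ _ _ F h _ _ _ Fl (hc l)).
Qed.

Lemma st_map_continuous (R : realType) (sigma : structure R) (X Y : bcm R)
    (f : isoemb X Y) : continuous (st_map sigma f).
Proof. by have [] := st_embedding (st_laws sigma) f. Qed.

Definition tau_D (R : realType) (T : \bar R) (sigma : structure R)
    : prestructure R :=
  @PreStructure R
    (fun X => cadlag_fun T (sigma X))
    (fun X Y f F =>
       CadlagFun (@cadlag_comp R T _ _ _ F (@st_map_continuous R sigma X Y f))).

(* Main.v *)
(** A cadlag function on the horizon is extended to the whole line by constants,
    and a time change by the identity. For a metric d inducing the topology of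
    S, two paths are at distance at most e if some time change with logarithmic
    slopes at most e moves one e-close to the other up to time 1 / e. This
    distance on D(I, S) depends isometrically on d, and induces the J1 topology
    for every choice of d, because a path has relatively compact image on bounded
    intervals. Hence invariance, stability and completeness of the metrics of
    sigma(X), or of sigma(X) x X, pass to D(I, sigma(X)), and if tau and tau_k
    witness that sigma is Polish, then D(I, tau) and the open sets of paths
    that stay in tau_k, with their left limits, up to a given time witness that
    D(I, sigma) is.

    The one property that does not pass directly is embedding-continuity: it
    requires tau_{f_n} a_n -> tau_f a when f_n -> f and a_n -> a, while tau is only
    assumed continuous for fixed a. For embeddings that send the root to a fixed
    root, this joint continuity is immediate from the equality of the distances
    d(tau_{f_n} a_n, tau_{f_n} a) and d(a_n, a). In general, the images r_n of the
    root of X converge to some r. In the space of functions on Y the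
    translation by r - r_n restores the root. After extraction the vectors
    r_n - r are summable, and the sums of their subfamilies form a compact set,
    parametrized by the Cantor space, along which Y is translated. Separate
    continuity in the parameter and Baire's theorem give joint continuity at a
    generic parameter, and flipping its n-th coordinate is the translation by
    r_n - r. *)

From HB Require Import structures.
Require Import Defs.
From mathcomp Require Import all_boot all_order all_algebra.
From mathcomp Require Import all_classical all_reals all_analysis.
From mathcomp Require Import measurable_realfun ring lra.

Set Implicit Arguments.
Unset Strict Implicit.
Unset Printing Implicit Defensive.

Import Order.TTheory GRing.Theory Num.Theory.
Import numFieldNormedType.Exports.

Local Open Scope classical_set_scope.
Local Open Scope ring_scope.

(** * Cadlag functions and time changes *)

(** The distance on paths is an infimum of admissible e, not an integral over time as in the
    definition of the J1 metric. Thus an inequality between metrics up to an additive error passes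
    to paths with the same error, so that Theta is kept, and no measurability is involved. The
    integral occurs only in the comparison of the topologies, through explicit measurable bounds.

    Joint continuity is the obstacle because a space-rooted metrization is invariant only under maps
    that respect the roots, and nothing compares the metrics of tau(Y) at different roots. A
    translation makes the roots agree, but its image leaves the Kuratowski copy of Y;
    embedding-continuity applies only if all translates lie in one bcm space. Adding a compact set P
    to Y keeps closed balls compact, and the summability of the displacements is what makes the set
    of their partial sums fit into such a P. *)

Section real_line.
Variable R : realType.

(** P is not assumed monotone: a point of A close to [sup A] carries P directly to z, or to a point
    of A beyond the supremum, which is absurd. *)
Lemma real_induction (P : R -> Prop) (a : R) :
  (forall x, x <= a -> P x) ->
  (forall x, exists2 d, 0 < d & forall y y',
     x - d < y -> y < y' -> y' < x + d -> P y -> P y') ->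
  forall x, P x.
Proof.
move=> Pa Ploc z; apply: contrapT => nPz.
have az : a < z by rewrite ltNge; apply/negP => /Pa.
pose A := [set x | x <= z /\ P x].
have Aa : A a by split; [exact: ltW|exact: Pa].
have supA : has_sup A by split; [exists a|exists z => x []].
have sz : sup A <= z by apply: ge_sup => [|x []//]; exists a.
have [d d0 Pd] := Ploc (sup A).
have [y [yz Py] sy] := sup_adherent d0 supA.
have ys : y <= sup A by apply: ub_le_sup; [exact: supA.2|].
have [yz'|zy] := ltP y z; last by apply: nPz; have -> : z = y by lra.
have [sz'|zs] := ltP (sup A) z; last first.
  by apply: nPz; apply: (Pd y z) => //; lra.
pose y' := Num.min z (sup A + d / 2).
have sy' : sup A < y' by rewrite /y' lt_min; apply/andP; split; lra.
have y'z : y' <= z by rewrite /y' ge_min lexx.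
have y'd : y' <= sup A + d / 2 by rewrite /y' ge_min lexx orbT.
have : y' <= sup A.
  apply: ub_le_sup; first exact: supA.2.
  split=> //; apply: (Pd y y') => //; lra.
lra.
Qed.

Lemma expR_le_1D2 (e : R) : 0 <= e -> e <= 2^-1 -> expR e <= 1 + 2 * e.
Proof.
move=> e0 e1; have h : 1 + (- e) <= expR (- e) by exact: expR_ge1Dx.
rewrite expRN in h; have := expR_gt0 e => p0.
have h2 : (1 - e) * expR e <= 1.
  by rewrite -(@ler_pdivlMr _ (expR e)) // div1r.
nra.
Qed.

End real_line.

Section cadlag_functions.
Variables (R : realType) (S : topologicalType).
Implicit Types (f : R -> S) (t : R) (l : S).

Definition left_limit f t l :=
  forall A, nbhs l A -> exists2 d, 0 < d & forall s, t - d < s -> s < t -> A (f s).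

Definition right_cts f t :=
  forall A, nbhs (f t) A -> exists2 d, 0 < d & forall s, t <= s -> s < t + d -> A (f s).

Definition cadlag_line f :=
  forall t, right_cts f t /\ exists l, left_limit f t l.

(* Replaces compactness of [0, x]: a property of the segments [0, x) extends
   to all x once it can be continued along segments on which f stays in a
   small neighbourhood of some point. *)
Lemma cadlag_induction f (P : R -> Prop) :
  cadlag_line f ->
  (forall x, x <= 0 -> P x) ->
  (forall x0 : S, exists2 A, nbhs x0 A & forall y y', 0 <= y -> y < y' ->
     (forall s, y <= s -> s < y' -> A (f s)) -> P y -> P y') ->
  forall x, P x.
Proof.
move=> cf P0 Pstep; apply: (real_induction P0) => x.
have [rx [l lx]] := cf x.
have [A lA PA] := Pstep l; have [B xB PB] := Pstep (f x).
have [dA dA0 fA] := lx A lA; have [dB dB0 fB] := rx B xB.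
have [d d0 [ddA ddB]] : exists2 d, 0 < d & d <= dA /\ d <= dB.
  exists (Num.min dA dB); first by rewrite lt_min dA0.
  by rewrite !ge_min !lexx orbT.
exists d => // y y' xy yy' y'x Py.
wlog y0 : y xy yy' Py / 0 <= y.
  move=> H; have [y0|y0] := leP 0 y; first exact: (H y).
  have [y'0|y'0] := leP y' 0; first exact: P0.
  by apply: (H 0) => //; [lra|exact: P0].
have left y1 y2 : 0 <= y1 -> x - d < y1 -> y1 < y2 -> y2 <= x -> P y1 -> P y2.
  by move=> *; apply: (PA y1 y2) => // s *; apply: fA; lra.
have right y1 y2 : 0 <= y1 -> x <= y1 -> y1 < y2 -> y2 < x + d -> P y1 -> P y2.
  by move=> *; apply: (PB y1 y2) => // s *; apply: fB; lra.
have [y'x'|xy'] := leP y' x; first exact: (left y y').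
have [xy''|yx] := leP x y; first exact: (right y y').
apply: (right x y') => //; first by lra.
exact: (left y x).
Qed.

End cadlag_functions.

Section time_changes.
Variables (R : realType) (T : \bar R).
Implicit Types (l m : R -> R) (e : R).

Definition outside (x : R) := x <= 0 \/ (T <= x%:E)%E.

(* A time change of the horizon is extended by the identity to the whole line;
   e bounds the absolute values of the logarithms of its slopes. *)
Definition tchange e l := [/\
  forall x y, x <= y -> l y - l x <= expR e * (y - x),
  forall x y, x <= y -> y - x <= expR e * (l y - l x) &
  forall x, outside x -> l x = x].

Lemma tchange_id e : 0 <= e -> tchange e id.
Proof.
move=> e0; have e1 : 1 <= expR e by rewrite -expR0 ler_expR.
by split=> // x y xy; nra.
Qed.

Lemma tchange_le e e' l : e <= e' -> tchange e l -> tchange e' l.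
Proof.
move=> ee' [h1 h2 h3].
have e1 : expR e <= expR e' by rewrite ler_expR.
have e0 := expR_gt0 e.
split=> // x y xy; have := h1 x y xy; have := h2 x y xy; nra.
Qed.

Lemma tchange_le_mono e l x y : tchange e l -> (l x <= l y) = (x <= y).
Proof.
move=> [h1 h2 _]; have e0 := expR_gt0 e.
apply/idP/idP => [lxy|xy]; last by have := h2 x y xy; nra.
rewrite leNgt; apply/negP => yx; have := h2 y x (ltW yx); nra.
Qed.

Lemma tchange_lt_mono e l x y : tchange e l -> (l x < l y) = (x < y).
Proof. by move=> tl; rewrite !ltNge (tchange_le_mono _ _ tl). Qed.

Lemma tchange_inj e l : tchange e l -> injective l.
Proof.
move=> tl x y lxy; apply/eqP.
by rewrite eq_le -(tchange_le_mono x y tl) -(tchange_le_mono y x tl) lxy lexx.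
Qed.

Lemma tchange0 e l : tchange e l -> l 0 = 0.
Proof. by case=> _ _; apply; left. Qed.

Lemma tchange_comp e e' l m :
  tchange e l -> tchange e' m -> tchange (e + e') (m \o l).
Proof.
move=> tl [m1 m2 m3]; have e0 := expR_gt0 e; have e'0 := expR_gt0 e'.
have [l1 l2 l3] := tl.
split=> /= [x y xy|x y xy|x ox]; last by rewrite l3 ?m3.
- have := l1 x y xy; have lxy : l x <= l y by rewrite (tchange_le_mono _ _ tl).
  by have := m1 _ _ lxy; rewrite expRD; nra.
- have := l2 x y xy; have lxy : l x <= l y by rewrite (tchange_le_mono _ _ tl).
  by have := m2 _ _ lxy; rewrite expRD; nra.
Qed.

Lemma tchange_continuous e l : tchange e l -> continuous l.
Proof.
move=> [l1 l2 l3] x; apply/cvgrPdist_le => eps eps0.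
have e0 := expR_gt0 e.
near=> y.
have yx : `|x - y| <= eps / expR e.
  near: y; have := @cvgr_dist_le _ _ _ _ _ id x (@cvg_id _ (nbhs x)).
  by apply; rewrite divr_gt0.
rewrite ler_pdivlMr // in yx.
have [xy|xy] := leP x y.
  have := l1 x y xy; have := l2 x y xy => h1 h2.
  rewrite distrC ger0_norm; last by nra.
  by rewrite distrC ger0_norm in yx; lra.
have := l1 y x (ltW xy); have := l2 y x (ltW xy) => h1 h2.
rewrite ger0_norm; last by nra.
by rewrite ger0_norm in yx; lra.
Unshelve. all: by end_near. Qed.

Lemma tchange_surj e l y : tchange e l -> exists x, l x = y.
Proof.
move=> tl; have [l1 l2 l3] := tl.
have [y0|y0] := leP y 0; first by exists y; apply: l3; left.
have e0 := expR_gt0 e.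
(* The slopes of l are at least [expR (- e)], so y is reached by the time [expR e * y]. *)
have ub : y <= l (expR e * y).
  have := l2 0 (expR e * y); rewrite (tchange0 tl) !subr0.
  rewrite ler_pM2l //; apply; nra.
have [c _ lc] : exists2 c, c \in `[0, expR e * y] & l c = y.
  apply: IVT; first by nra.
    by apply: continuous_subspaceT; exact: (tchange_continuous tl).
  have v0 : 0 <= l (expR e * y) by lra.
  by rewrite (tchange0 tl) (min_idPl v0) (max_idPr v0) (ltW y0).
by exists c.
Qed.

Lemma tchange_inv e l : tchange e l ->
  exists m, [/\ tchange e m, cancel l m & cancel m l].
Proof.
move=> tl; have /choice[m mK] : forall y, exists x, l x = y.
  by move=> y; exact: tchange_surj tl.
have lK : cancel l m by move=> x; apply: (tchange_inj tl); rewrite mK.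
have [l1 l2 l3] := tl.
have mono x y : x <= y -> m x <= m y.
  by move=> xy; rewrite -(tchange_le_mono _ _ tl) !mK.
exists m; split=> //; split=> [x y xy|x y xy|x ox].
- by have := l2 _ _ (mono _ _ xy); rewrite !mK.
- by have := l1 _ _ (mono _ _ xy); rewrite !mK.
- by apply: (tchange_inj tl); rewrite mK l3.
Qed.

(** The condition on k yields both slope bounds: 1 + k <= 1 + e <= expR e and 1 <= (1 + e) * (1 -
    k). *)
Lemma tchange_perturb e k (psi : R -> R) : 0 <= e -> k * (1 + e) <= e ->
  (forall x y, x <= y -> `|psi y - psi x| <= k * (y - x)) ->
  (forall x, outside x -> psi x = 0) ->
  tchange e (fun x => x + psi x).
Proof.
move=> e0 ke psik psi0; have ee : 1 + e <= expR e by exact: expR_ge1Dx.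
split=> [x y xy|x y xy|x /psi0 ->]; last by rewrite addr0.
- have := psik x y xy; rewrite ler_norml => /andP[h1 h2].
  have k1 : k <= e by nra.
  nra.
- have := psik x y xy; rewrite ler_norml => /andP[h1 h2].
  have k1 : 1 <= (1 + e) * (1 - k) by nra.
  have k2 : 0 <= 1 - k by nra.
  set D := y + psi y - (x + psi x).
  have D1 : (1 - k) * (y - x) <= D by rewrite /D; lra.
  have D0 : 0 <= D by apply: le_trans D1; rewrite mulr_ge0 // subr_ge0.
  apply: (@le_trans _ _ ((1 + e) * D)); last exact: ler_wpM2r.
  apply: (@le_trans _ _ ((1 + e) * ((1 - k) * (y - x)))); last first.
    by apply: ler_wpM2l => //; lra.
  by rewrite mulrA ler_peMl // subr_ge0.
Qed.

(** Added to the identity, psi moves the single point z by h and nothing at distance w or more. Time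
    changes are corrected in this way, to fix a given time or to send it to a rational. *)
Lemma tent (z w h k : R) : 0 < w -> `|h| <= k * w -> exists psi : R -> R,
  [/\ psi z = h, forall x, w <= `|x - z| -> psi x = 0,
   forall x y, x <= y -> `|psi y - psi x| <= k * (y - x) &
   forall x, `|psi x| <= `|h|].
Proof.
move=> w0 hk; exists (fun x => h / w * Num.max 0 (w - `|x - z|)).
have hw : `|h / w| * w = `|h| by rewrite normrM normfV (gtr0_norm w0) divfK // gt_eqF.
have hw0 := normr_ge0 (h / w).
split=> [|x wx|x y xy|x].
- by rewrite subrr normr0 subr0 (max_idPr (ltW w0)) divfK // gt_eqF.
- by rewrite (max_idPl _) ?mulr0 // subr_le0.
- rewrite -mulrBr normrM; apply: (@le_trans _ _ (`|h / w| * (y - x))); last first.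
    by rewrite ler_wpM2r ?subr_ge0 // -(ler_pM2r w0) hw.
  rewrite ler_wpM2l //.
  have : `| `|y - z| - `|x - z| | <= y - x.
    apply: le_trans (ler_dist_dist _ _) _.
    by rewrite opprB addrA subrK ger0_norm // subr_ge0.
  clear; rewrite !ler_norml => /andP[h1 h2].
  by case: (leP 0 (w - `|y - z|)); case: (leP 0 (w - `|x - z|)); lra.
- rewrite normrM -hw ler_wpM2l // ger0_norm ?le_max ?lexx // ge_max ltW //=.
  by rewrite gerBl.
Qed.

Lemma tchange_lim e (l : nat -> R -> R) (l0 : R -> R) :
  (\forall n \near \oo, tchange e (l n)) ->
  (forall x, l n x @[n --> \oo] --> l0 x) -> tchange e l0.
Proof.
move=> tl cl; split=> [x y xy|x y xy|x ox].
- have h : l n y - l n x @[n --> \oo] --> l0 y - l0 x by apply: cvgB.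
  rewrite -(cvg_lim _ h)//; apply: limr_le; first by apply/cvg_ex; eexists; exact: h.
  near=> n; have [h1 _ _] : tchange e (l n) by near: n; exact: tl.
  exact: h1.
- have h : expR e * (l n y - l n x) @[n --> \oo] --> expR e * (l0 y - l0 x).
    exact: (cvgM (cvg_cst _) (cvgB (cl y) (cl x))).
  rewrite -(cvg_lim _ h)//; apply: limr_ge; first by apply/cvg_ex; eexists; exact: h.
  near=> n; have [_ h1 _] : tchange e (l n) by near: n; exact: tl.
  exact: h1.
- apply/esym; have h : l n x @[n --> \oo] --> x.
    apply: (cvg_trans _ (@cvg_cst _ x _ (\oo : set_system nat) _)).
    apply: near_eq_cvg; near=> n.
    by have [_ _ ->] : tchange e (l n) by near: n; exact: tl.
  exact: (cvg_unique _ h (cl x)).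
Unshelve. all: by end_near. Qed.

Lemma tchange_pos e l x : tchange e l -> 0 <= x ->
  [/\ 0 <= l x, l x <= expR e * x & x <= expR e * l x].
Proof.
move=> tl x0; have [l1 l2 _] := tl.
have := l1 _ _ x0; have := l2 _ _ x0; rewrite (tchange0 tl) !subr0 => h1 h2.
by split=> //; rewrite -(tchange0 tl) (tchange_le_mono _ _ tl).
Qed.

Lemma tchange_dist e l x : tchange e l -> 0 <= e -> e <= 2^-1 -> 0 <= x ->
  `|l x - x| <= 2 * e * x.
Proof.
move=> tl e0 e2 x0; have [h0 h1 h2] := tchange_pos tl x0.
have := expR_le_1D2 e0 e2 => ee; rewrite ler_norml; apply/andP.
have : l x <= (1 + 2 * e) * x by nra.
have [lx|lx] := leP (l x) x; last by split; nra.
have : x <= (1 + 2 * e) * l x by nra.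
split; nra.
Qed.

End time_changes.

(** * The distance on functions of the real line *)

Section skorokhod_distance.
Variables (R : realType) (T : \bar R).

(* The values at s are compared only in the window where s or its image is at
   most 1 / e; for e small enough the window contains a bounded horizon. *)
Definition jnear (S : Type) (d : S -> S -> R) (e : R) (f g : R -> S) :=
  exists2 l, tchange T e l &
    forall s, s <= e^-1 \/ l s <= e^-1 -> d (f s) (g (l s)) <= e.

(* Capped at 1 / 2, below which the windows are compatible with the triangle
   inequality, see jnear_trans. *)
Definition jdist (S : Type) (d : S -> S -> R) (f g : R -> S) :=
  inf [set e | 0 < e /\ (2^-1 <= e \/ jnear d e f g)].

(** The same time change serves, because a larger constant has a smaller window. *)
Lemma jnear_shift (S S' : Type) (d : S -> S -> R) (d' : S' -> S' -> R) e c
    (f g : R -> S) (f' g' : R -> S') : 0 < e -> 0 <= c ->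
  (forall s t, d' (f' s) (g' t) <= d (f s) (g t) + c) ->
  jnear d e f g -> jnear d' (e + c) f' g'.
Proof.
move=> e0 c0 dd' [l tl fg]; exists l; first by apply: tchange_le tl; lra.
move=> s win; apply: le_trans (dd' _ _) _; rewrite lerD2r; apply: fg.
have ee : (e + c)^-1 <= e^-1 by rewrite lef_pV2 ?posrE; lra.
by case: win => h; [left|right]; apply: le_trans ee.
Qed.

Lemma jdist_has_inf (S : Type) (d : S -> S -> R) (f g : R -> S) :
  has_inf [set e | 0 < e /\ (2^-1 <= e \/ jnear d e f g)].
Proof.
split; first by exists 2^-1; split; [rewrite invr_gt0|left].
by exists 0 => e [/ltW].
Qed.

Lemma jdist_ge0 (S : Type) (d : S -> S -> R) (f g : R -> S) : 0 <= jdist d f g.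
Proof.
apply: lb_le_inf; first exact: (jdist_has_inf d f g).1.
by move=> e [/ltW].
Qed.

Lemma jdist_le_half (S : Type) (d : S -> S -> R) (f g : R -> S) :
  jdist d f g <= 2^-1.
Proof.
apply: ge_inf; last by split; [rewrite invr_gt0|left].
exact: (jdist_has_inf d f g).2.
Qed.

Lemma jdist_le (S : Type) (d : S -> S -> R) e (f g : R -> S) :
  0 < e -> jnear d e f g -> jdist d f g <= e.
Proof.
move=> e0 fg; apply: ge_inf; first exact: (jdist_has_inf d f g).2.
by split; [|right].
Qed.

(** With c = 0 this transfers invariance under embeddings from metrics to paths; with c = Theta e it
    transfers stability. *)
Lemma jdist_shift (S S' : Type) (d : S -> S -> R) (d' : S' -> S' -> R) c
    (f g : R -> S) (f' g' : R -> S') : 0 <= c ->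
  (forall s t, d' (f' s) (g' t) <= d (f s) (g t) + c) ->
  jdist d' f' g' <= jdist d f g + c.
Proof.
move=> c0 dd'; rewrite -lerBlDr.
apply: lb_le_inf; first exact: (jdist_has_inf d f g).1.
move=> e [e0 [e2|fg]]; rewrite lerBlDr.
  by apply: le_trans (jdist_le_half _ _ _) _; lra.
by apply: jdist_le; [lra|exact: jnear_shift fg].
Qed.

Lemma jnear_le (S : Type) (d : S -> S -> R) e e' (f g : R -> S) :
  0 < e -> e <= e' -> jnear d e f g -> jnear d e' f g.
Proof.
move=> e0 ee' fg; have -> : e' = e + (e' - e) by lra.
have c0 : 0 <= e' - e by lra.
by apply: (jnear_shift e0 c0 _ fg) => s t; lra.
Qed.

Lemma jdist_lt (S : Type) (d : S -> S -> R) e (f g : R -> S) :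
  jdist d f g < e -> e <= 2^-1 -> jnear d e f g.
Proof.
move=> fge e2; have h : 0 < e - jdist d f g by lra.
have [e' [e'0 fg] ee'] := inf_adherent h (jdist_has_inf d f g).
have {}ee' : e' < e by move: ee'; rewrite addrC subrK.
by case: fg => [|fg]; [lra|exact: (jnear_le e'0 (ltW ee'))].
Qed.

Section metric_axioms.
Variables (S : Type) (d : S -> S -> R).
Hypothesis dm : is_metric d.

Lemma jnear_refl e f : 0 <= e -> jnear d e f f.
Proof.
move=> e0; exists id; first exact: tchange_id.
by move=> s _; have [_ /(_ (f s) (f s))[_ ->]] := dm.
Qed.

Lemma jnear_sym e f g : jnear d e f g -> jnear d e g f.
Proof.
case=> l tl fg; have [m [tm lm ml]] := tchange_inv tl; exists m => // s win.
have [_ _ dC _] := dm.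
by rewrite dC -{2}(ml s); apply: fg; rewrite ml; case: win; [right|left].
Qed.

(** Since expR e <= 1 + 2 * e, it is enough that (1 + 2 * e) * e' <= e + e', that is e' <= 1 / 2.
    This is the origin of the cap in [jdist]. *)
Lemma window_trans e e' l s : 0 < e -> 0 < e' -> e + e' < 2^-1 ->
  tchange T e l -> s <= (e + e')^-1 -> l s <= e'^-1.
Proof.
move=> e0 e'0 ee tl se.
have ee0 : 0 < e + e' by lra.
have [s0|s0] := leP s 0.
  have [_ _ ->] := tl; last by left.
  by apply: (le_trans s0); rewrite invr_ge0 ltW.
have [_ ls _] := tchange_pos tl (ltW s0).
apply: (le_trans ls); have e1 : expR e <= 1 + 2 * e by apply: expR_le_1D2; lra.
rewrite -[e'^-1]mul1r ler_pdivlMr //.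
have se' : s * (e + e') <= 1 by rewrite -ler_pdivlMr ?div1r.
apply: (@le_trans _ _ ((1 + 2 * e) * s * e')).
  by apply: ler_wpM2r; [exact: ltW|apply: ler_wpM2r; [exact: ltW|]].
apply: le_trans se'; rewrite mulrAC mulrC; apply: ler_wpM2l; first exact: ltW.
nra.
Qed.

Lemma jnear_trans e e' f g h : 0 < e -> 0 < e' -> e + e' < 2^-1 ->
  jnear d e f g -> jnear d e' g h -> jnear d (e + e') f h.
Proof.
move=> e0 e'0 ee [l tl fg] [m tm gh]; exists (m \o l).
  exact: tchange_comp tl tm.
have [d0 _ _ dtri] := dm.
have i1 : (e + e')^-1 <= e^-1 by rewrite lef_pV2 ?posrE; lra.
have i2 : (e + e')^-1 <= e'^-1 by rewrite lef_pV2 ?posrE; lra.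
move=> s win; apply: le_trans (dtri _ (g (l s)) _) _; apply: lerD.
  apply: fg; case: win => [se|ms]; first by left; exact: le_trans i1.
  (* The window is now given by the final time, so the argument runs backwards along the inverse of
     m. *)
  right; have [m' [tm' mm' m'm]] := tchange_inv tm.
  rewrite -(mm' (l s)); apply: (@window_trans e' e) => //; first by lra.
  by rewrite addrC.
apply: gh; case: win => [se|ms]; last by right; exact: le_trans i2.
by left; exact: (@window_trans e e').
Qed.

Lemma jdistxx f : jdist d f f = 0.
Proof.
apply/eqP; rewrite eq_le jdist_ge0 andbT; apply/ler_addgt0Pl => e e0.
by rewrite addr0; apply: jdist_le => //; apply: jnear_refl; exact: ltW.
Qed.

Lemma jdist_sym f g : jdist d f g = jdist d g f.
Proof.
suff H f' g' : jdist d f' g' <= jdist d g' f' by apply/eqP; rewrite eq_le !H.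
apply: lb_le_inf; first exact: (jdist_has_inf d g' f').1.
move=> e [e0 [e2|fg]]; first by apply: le_trans (jdist_le_half _ _ _) _.
by apply: jdist_le => //; exact: jnear_sym.
Qed.

Lemma jdist_triangle f g h : jdist d f h <= jdist d f g + jdist d g h.
Proof.
apply/ler_addgt0Pl => e e0.
have [fgh|fgh] := leP 2^-1 (e + (jdist d f g + jdist d g h)).
  exact: le_trans (jdist_le_half _ _ _) _.
have fg0 := jdist_ge0 d f g; have gh0 := jdist_ge0 d g h.
have -> : e + (jdist d f g + jdist d g h) =
  (jdist d f g + e / 2) + (jdist d g h + e / 2) by lra.
apply: jdist_le; first by lra.
by apply: jnear_trans; rewrite ?jdist_lt //; try lra; apply: jdist_lt; lra.
Qed.

End metric_axioms.

(** A small time change may move s to its left, where right-continuity gives no control. The paths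
    are therefore compared at s' = s + r / 2, whose image stays to the right of s. *)
Lemma jdist_eq0 (S : topologicalType) (d : S -> S -> R) (f g : R -> S) :
  metrizes d -> (forall t, right_cts f t) ->
  (forall t, right_cts g t) -> jdist d f g = 0 -> f = g.
Proof.
move=> [[d0 dxx dC dtri] dn] cf cg fg; apply/funext => s; apply/dxx/eqP.
rewrite eq_le d0 andbT; apply/ler_addgt0Pl => e e0; rewrite addr0.
have e3 : 0 < e / 3 by lra.
have [df df0 hf] : exists2 r, 0 < r &
    forall x, s <= x -> x < s + r -> d (f s) (f x) < e / 3.
  by apply: (cf s [set y | d (f s) y < e / 3]); apply/dn; exists (e / 3).
have [dg dg0 hg] : exists2 r, 0 < r &
    forall x, s <= x -> x < s + r -> d (g s) (g x) < e / 3.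
  by apply: (cg s [set y | d (g s) y < e / 3]); apply/dn; exists (e / 3).
pose r := Num.min df dg.
have r0 : 0 < r by rewrite lt_min df0.
have [rf rg] : r <= df /\ r <= dg by rewrite !ge_min !lexx orbT.
pose s' := s + r / 2.
pose n := Num.max `|s'| 1.
have n1 : 1 <= n by rewrite le_max lexx orbT.
have s'n : `|s'| <= n by rewrite le_max lexx.
(* w <= 1 / 4 is below the cap; w * n <= r / 8 bounds the displacement 2 * w * s' by r / 4; w * n <=
   1 puts s' in the window. *)
pose w := Num.min (Num.min (e / 3) (r / 8)) (Num.min 4^-1 1) / n.
have [w0 we wr w2 wn] : [/\ 0 < w, w <= e / 3, w * n <= r / 8, w <= 4^-1 &
    w * n <= 1].
  have m0 : 0 < Num.min (Num.min (e / 3) (r / 8)) (Num.min 4^-1 (1 : R)).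
    rewrite !lt_min; apply/andP; split; apply/andP; split; lra.
  have h x : Num.min (Num.min (e / 3) (r / 8)) (Num.min 4^-1 (1 : R)) <= x ->
    0 <= x -> w <= x.
    by move=> h1 x0; rewrite ler_pdivrMr; [nra|lra].
  split; first by rewrite divr_gt0 //; lra.
  - by apply: h; [rewrite !ge_min lexx|lra].
  - by rewrite divfK ?ge_min ?lexx ?orbT //; lra.
  - by apply: h; [rewrite !ge_min lexx ?orbT|lra].
  - by rewrite divfK ?ge_min ?lexx ?orbT //; lra.
have [l tl fgl] : jnear d w f g by apply: jdist_lt; lra.
have ls : `|l s' - s'| <= r / 4.
  have [s'0|s'0] := leP s' 0.
    by have [_ _ ->] := tl; [rewrite subrr normr0; lra|left].
  apply: (le_trans (tchange_dist tl _ _ _)); try lra.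
  rewrite gtr0_norm in s'n => //.
  have : w * s' <= w * n by rewrite ler_wpM2l // ltW.
  lra.
move: ls; rewrite ler_norml => /andP[ls1 ls2].
have h1 : d (f s) (f s') < e / 3 by apply: hf; rewrite /s'; lra.
have h2 : d (g s) (g (l s')) < e / 3 by apply: hg; rewrite /s' in ls1 ls2 *; lra.
have h3 : d (f s') (g (l s')) <= w.
  apply: fgl; left; apply: le_trans (ler_norm _) _; apply: le_trans s'n _.
  by rewrite -div1r ler_pdivlMr // mulrC.
have h4 := dtri (f s) (f s') (g s); have h5 := dtri (f s') (g (l s')) (g s).
rewrite (dC (g (l s')) (g s)) in h5; lra.
Qed.

End skorokhod_distance.

(** * Extension of paths from the horizon to the real line *)

Section horizon_extension.
Variables (R : realType) (T : \bar R).
Hypothesis T_ge0 : (0 <= T)%E.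

(** For nonnegative T the branch [fine T] is reached only when T is finite, as no real exceeds
    +oo. *)
Definition clampr (x : R) : R :=
  if x <= 0 then 0 else if (x%:E <= T)%E then x else fine T.

Lemma clampr_horizon x : horizon T (clampr x).
Proof.
rewrite /clampr /horizon /=; case: ifP => // x0.
case: ifP => xT; first by split=> //; lra.
by case: T T_ge0 xT => [t||] //=; rewrite ?leey.
Qed.

Lemma clampr_id x : horizon T x -> clampr x = x.
Proof.
move=> [x0 xT]; rewrite /clampr; case: ifP => [x0'|_]; first by lra.
by rewrite xT.
Qed.

Lemma clampr_le x : clampr x <= Num.max 0 x.
Proof.
rewrite /clampr le_max; case: ifP => x0; first by rewrite lexx.
case: ifP => [_|/negbT xT]; first by rewrite lexx orbT.
rewrite -ltNge in xT; case: T T_ge0 xT => [t||] //=.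
by rewrite lte_fin => _ /ltW ->; rewrite orbT.
Qed.

Lemma clampr_eq x : outside T x \/ clampr x = x.
Proof.
have [x0|x0] := leP x 0; first by left; left.
have [xT|xT] := leP T x%:E; first by left; right.
by right; apply: clampr_id; split; apply: ltW.
Qed.

Lemma outside_clampr x : outside T x -> outside T (clampr x).
Proof.
have [x0 _|x0 [|Tx]] := leP x 0; [|by rewrite leNgt x0|].
  by rewrite /clampr x0; left.
right; rewrite /clampr (leNgt x) x0 /=; case: ifP => // xT.
by case: T T_ge0 Tx xT => [t||] //=; rewrite leye_eq.
Qed.

(** A time change fixes every point outside the horizon, hence preserves the horizon. Extended paths
    thus need to be compared at clamped times only. *)
Lemma clampr_tchange e l x : tchange T e l -> clampr (l x) = l (clampr x).
Proof.
move=> tl; have [_ _ l3] := tl; have [ox|xx] := clampr_eq x.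
  by rewrite (l3 x ox) (l3 (clampr x)) //; exact: outside_clampr.
have [olx|lx] := clampr_eq (l x); last by rewrite lx xx.
have lx : l x = x by apply: (tchange_inj tl); exact: l3.
by rewrite xx lx xx.
Qed.

Definition clamp (x : R) : horizon T := SigSub (mem_set (clampr_horizon x)).

Lemma val_clamp x : \val (clamp x) = clampr x. Proof. by []. Qed.

Lemma valP_horizon (t : horizon T) : horizon T (\val t).
Proof. by apply: set_mem; exact: valP. Qed.

Lemma clamp_val (t : horizon T) : clamp (\val t) = t.
Proof. by apply: val_inj; rewrite val_clamp clampr_id //; exact: valP_horizon. Qed.

Lemma clampK x : clamp (clampr x) = clamp x.
Proof. by apply: val_inj; rewrite !val_clamp clampr_id //; exact: clampr_horizon. Qed.

Lemma nbhs_horizonP (t : horizon T) (A : set (horizon T)) :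
  nbhs t A <-> exists2 d, 0 < d & forall s, `|\val s - \val t| < d -> A s.
Proof.
split.
  rewrite nbhsE => -[U [[V oV <-] /= Vt] UA].
  have : nbhs (\val t) V by exact: open_nbhs_nbhs.
  move/nbhs_ballP => [d d0 dV]; exists d => // s st; apply: UA => /=.
  by apply: dV; rewrite /ball /= distrC.
move=> [d d0 dA]; have : nbhs t (\val @^-1` ball (\val t) d).
  exact: (@initial_continuous _ _ (\val : horizon T -> R) t _ (nbhsx_ballx _ _ d0)).
by apply: filterS => s; rewrite /ball /= distrC; exact: dA.
Qed.

Section extension.
Variable S : Type.

Definition ext (F : horizon T -> S) (x : R) : S := F (clamp x).

Lemma ext_val F (t : horizon T) : ext F (\val t) = F t.
Proof. by rewrite /ext clamp_val. Qed.

Lemma ext_clampr F x : ext F (clampr x) = ext F x.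
Proof. by rewrite /ext clampK. Qed.

Lemma ext_inj : injective ext.
Proof. by move=> F G FG; apply/funext => t; rewrite -!ext_val FG. Qed.

Definition restr (f : R -> S) (t : horizon T) : S := f (\val t).

Lemma ext_restr f x : ext (restr f) x = f (clampr x).
Proof. by []. Qed.

End extension.

Variable S : topologicalType.

Lemma ext_left (F : horizon T -> S) (x : R) l : 0 < x -> (x%:E <= T)%E ->
  left_limit (ext F) x l <->
  F @ within [set s : horizon T | \val s < x] (nbhs (clamp x)) --> l.
Proof.
move=> x0 xT; have cx : clampr x = x by apply: clampr_id; split=> //; exact: ltW.
split=> [h A lA|h A lA].
  have [d d0 dA] := h A lA; apply/nbhs_horizonP; exists d => // s.
  rewrite val_clamp cx ltr_norml /= => /andP[h1 h2] sx.
  by rewrite -ext_val; apply: dA => //=; lra.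
have /nbhs_horizonP[d d0 dA] := h A lA.
exists (Num.min d x); first by rewrite lt_min d0.
have [dd dx] : Num.min d x <= d /\ Num.min d x <= x.
  by rewrite !ge_min !lexx orbT.
move=> s s1 s2; have hs : clampr s = s.
  apply: clampr_id; split; first by lra.
  by apply: le_trans xT; rewrite lee_fin ltW.
have := dA (clamp s); rewrite /= hs cx; apply; last by [].
by rewrite ltr0_norm; lra.
Qed.

Lemma cadlag_ext (F : horizon T -> S) : cadlag F -> cadlag_line (ext F).
Proof.
move=> cF x; split.
  move=> A FA; have [Fx _] := cF (clamp x).
  have /nbhs_horizonP[d d0 dA] := Fx A FA.
  have [x0|x0] := ltP x 0.
    exists (- x); first by lra.
    move=> s xs s0; have -> : ext F s = ext F x; last exact: nbhs_singleton.
    by rewrite /ext; congr F; apply: val_inj; rewrite !val_clamp /clampr !ifT; lra.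
  have [Tx|xT] := leP T x%:E.
    exists 1 => // s xs _; have -> : ext F s = ext F x; last exact: nbhs_singleton.
    rewrite /ext; congr F; apply: val_inj; rewrite !val_clamp.
    have fx y : x <= y -> clampr y = fine T.
      move=> xy; rewrite /clampr.
      case: T T_ge0 Tx => [t||] //=.
      rewrite !lee_fin => t0 tx; case: ifP => [y0|_]; first by lra.
      by case: ifP => // yt; lra.
    by rewrite !fx.
  have cx : clampr x = x by apply: clampr_id; split=> //; exact: ltW.
  exists d => // s xs sx; have [->|xs'] := eqVneq s x; first exact: nbhs_singleton.
  have {xs xs'}xs : x < s by rewrite lt_neqAle eq_sym xs' xs.
  have [sT|Ts] := leP s%:E T.
    have cs : clampr s = s by apply: clampr_id; split=> //; lra.
    have := dA (clamp s); rewrite /= cs cx; apply; last by [].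
    by rewrite gtr0_norm; lra.
  have cs : clampr s = fine T.
    by rewrite /clampr (leNgt s%:E) Ts /=; case: ifP => // s0; lra.
  have [h1 h2] : x < fine T /\ fine T < s.
    by case: T T_ge0 xT Ts => [t||] //=; rewrite !lte_fin.
  have := dA (clamp s); rewrite /= cs cx; apply; last by [].
  by rewrite gtr0_norm; lra.
have [x0|x0] := leP x 0.
  exists (ext F x) => A FA; exists 1 => // s _ sx.
  have -> : ext F s = ext F x; last exact: nbhs_singleton.
  by rewrite /ext; congr F; apply: val_inj; rewrite !val_clamp /clampr !ifT; lra.
have [xT|Tx] := leP x%:E T.
  by have [_ [l Fl]] := cF (clamp x); exists l; apply/ext_left => //;
    rewrite val_clamp clampr_id // in Fl; split=> //; exact: ltW.
exists (ext F x) => A FA.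
exists (x - fine T).
  by case: T T_ge0 Tx => [t||] //=; rewrite lte_fin subr_gt0.
have fx y : fine T < y -> clampr y = fine T.
  rewrite /clampr.
  case: T T_ge0 Tx => [t||] //=.
  rewrite lee_fin lte_fin => t0 tx ty; case: ifP => [y0|_]; first by lra.
  by rewrite lee_fin; case: ifP => // yt; lra.
move=> s s1 s2; have -> : ext F s = ext F x; last exact: nbhs_singleton.
by rewrite /ext; congr F; apply: val_inj; rewrite !val_clamp !fx //; lra.
Qed.

Lemma cadlag_restr (f : R -> S) : cadlag_line f -> cadlag (restr f).
Proof.
move=> cf t; have [ft [l fl]] := cf (\val t); split.
  move=> A /ft[d d0 dA]; apply/nbhs_horizonP; exists d => // s.
  rewrite ltr_norml /= => /andP[h1 h2] ts.
  by apply: dA => /=; [exact: ltW|lra].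
exists l => A /fl[d d0 dA]; apply/nbhs_horizonP; exists d => // s.
rewrite ltr_norml /= => /andP[h1 h2] ts.
by apply: dA => //=; lra.
Qed.

Definition cadlag_restrict (f : R -> S) (cf : cadlag_line f) : cadlag_fun T S :=
  CadlagFun (cadlag_restr cf).

Lemma cadlag_fun_eq (F G : cadlag_fun T S) : (F : horizon T -> S) = G -> F = G.
Proof.
by case: F G => [F cF] [G cG] /= FG; subst G; congr CadlagFun; exact: Prop_irrelevance.
Qed.

End horizon_extension.

(** * Independence of the metric inducing the topology *)

Section metrics.
Variables (R : realType) (S : topologicalType).

Lemma metrizes_nbhs (d : S -> S -> R) x e : metrizes d -> 0 < e ->
  nbhs x [set y | d x y < e].
Proof. by move=> [_ dn] e0; apply/dn; exists e. Qed.

(** Two metrics with the same topology are uniformly comparable near a relatively compact set, here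
    the image of [0, x). Around each x0 a d'-ball lies in a d-ball, and [cadlag_induction] passes
    from this local comparison to all of [0, x). *)
Lemma metrizes_uniform_nbhs (d d' : S -> S -> R) (f : R -> S) e x :
  metrizes d -> metrizes d' -> cadlag_line f -> 0 < e ->
  exists2 r, 0 < r & forall s, 0 <= s -> s < x ->
    forall y, d' (f s) y <= r -> d (f s) y <= e.
Proof.
move=> md md' cf e0; move: x; apply: (cadlag_induction cf) => [x x0|x0].
  by exists 1 => // s s0 sx; lra.
have [[_ _ dC dtri] _] := md; have [[_ _ dC' dtri'] _] := md'.
have e2 : 0 < e / 2 by lra.
have /(metrizes_nbhs x0 md) := e2.
have [_ dn'] := md' => /dn'[r r0 rd].
have r2 : 0 < r / 2 by lra.
exists ([set y | d x0 y < e / 2] `&` [set y | d' x0 y < r / 2]).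
  by apply: filterI; apply: metrizes_nbhs.
move=> y y' y0 yy' fA [q q0 qd].
exists (Num.min q (r / 4)); first by rewrite lt_min q0; lra.
move=> s s0 sy' z; rewrite le_min => /andP[zq zr].
have [sy|ys] := ltP s y; first exact: qd.
have [/= fs1 fs2] := fA s ys sy'.
have : d x0 z < e / 2.
  by apply: rd => /=; have := dtri' x0 (f s) z; lra.
by have := dtri (f s) x0 z; rewrite (dC (f s) x0); lra.
Qed.

Variable T : \bar R.

Lemma jnear_metric (d d' : S -> S -> R) (f : R -> S) e :
  metrizes d -> metrizes d' -> cadlag_line f -> (forall s, s <= 0 -> f s = f 0) ->
  0 < e -> exists2 r, 0 < r & forall g, jnear T d' r f g -> jnear T d e f g.
Proof.
move=> md md' cf f0 e0.
(* If s or l s is at most 1 / e, then s <= 2 / e, because expR r <= 2 for r <= 1 / 2. *)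
have [q q0 qd] := metrizes_uniform_nbhs (2 / e + 1) md md' cf e0.
exists (Num.min (Num.min q e) 2^-1); first by rewrite !lt_min q0 e0 /=; lra.
set r := Num.min _ _; have [rq re r2] : [/\ r <= q, r <= e & r <= 2^-1].
  by split; rewrite !ge_min lexx ?orbT.
have r0 : 0 < r by rewrite /r !lt_min q0 e0 /=; lra.
move=> g [l tl fg]; exists l; first exact: tchange_le tl.
move=> s win.
have e1 : 0 < e^-1 by rewrite invr_gt0.
have er : e^-1 <= r^-1 by rewrite lef_pV2.
have fgs : d' (f s) (g (l s)) <= q.
  by apply: le_trans rq; apply: fg; case: win => h; [left|right]; exact: le_trans er.
have [s0|s0] := leP 0 s; last first.
  by move: fgs; rewrite (f0 s (ltW s0)); apply: qd => //; lra.
apply: qd => //; case: win => [se|lse]; first by lra.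
have [_ _ h] := tchange_pos tl s0.
have := expR_le_1D2 (ltW r0) r2 => er1.
have ls0 : 0 <= l s by have [] := tchange_pos tl s0.
have : expR r * l s <= 2 * l s by apply: ler_wpM2r => //; lra.
lra.
Qed.

End metrics.

Section skorokhod_metric.
Variables (R : realType) (T : \bar R).
Hypothesis T_ge0 : (0 <= T)%E.
Variable S : topologicalType.
Local Notation ext := (ext T_ge0).

Lemma ext_neg (F : horizon T -> S) s : s <= 0 -> ext F s = ext F 0.
Proof.
move=> s0; rewrite -(ext_clampr _ F s) -(ext_clampr _ F 0).
by rewrite /clampr s0 lexx.
Qed.

Lemma cadlag_fun_ext (F : cadlag_fun T S) : cadlag_line (ext F).
Proof. exact/cadlag_ext/cadlagP. Qed.

Definition jd (d : S -> S -> R) (F G : cadlag_fun T S) :=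
  jdist T d (ext F) (ext G).

Lemma jd_is_metric d : metrizes d -> is_metric (jd d).
Proof.
move=> md; have dm := md.1; split=> [F G|F G|F G|F G H].
- exact: jdist_ge0.
- split=> [FG|->]; last exact: jdistxx.
  apply: cadlag_fun_eq; apply: (@ext_inj _ _ T_ge0).
  apply: (jdist_eq0 md _ _ FG) => t; first exact: (cadlag_fun_ext F t).1.
  exact: (cadlag_fun_ext G t).1.
- exact: jdist_sym.
- exact: jdist_triangle.
Qed.

Lemma jd_metric (d d' : S -> S -> R) (F : cadlag_fun T S) e :
  metrizes d -> metrizes d' -> 0 < e ->
  exists2 r, 0 < r & forall G, jd d' F G < r -> jd d F G < e.
Proof.
move=> md md' e0; have e2 : 0 < e / 2 by lra.
have [r r0 rd] := jnear_metric T md md' (cadlag_fun_ext F) (@ext_neg F) e2.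
exists (Num.min r 2^-1); first by rewrite lt_min r0 /=; lra.
move=> G; rewrite lt_min => /andP[FGr FG2].
apply: (@le_lt_trans _ _ (e / 2)); last by lra.
apply: jdist_le => //; apply: rd.
have [r2|r2] := leP r 2^-1; first exact: jdist_lt.
have h : 0 < 2^-1 :> R by lra.
by apply: (jnear_le h (ltW r2)); exact: jdist_lt.
Qed.

End skorokhod_metric.

(** * Comparison with the J1 topology *)

Section finite_horizon.
Variables (R : realType) (S : Type).

Lemma ln_le_expR (r e : R) : 0 < r -> `|ln r| <= e -> r <= expR e /\ 1 <= expR e * r.
Proof.
move=> r0; rewrite ler_norml => /andP[h1 h2].
rewrite -{1 2}(lnK r0) -expRD; split; first by rewrite ler_expR.
by rewrite -expR0 ler_expR; lra.
Qed.

Lemma expR_le_ln (r e : R) : 0 < r -> r <= expR e -> 1 <= expR e * r -> `|ln r| <= e.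
Proof.
move=> r0; rewrite -{1 2}(lnK r0) -expRD -expR0 !ler_expR => h1 h2.
by rewrite ler_norml; lra.
Qed.

Variables (t : R) (t_ge0 : 0 <= t).

Let tE : (0 <= t%:E)%E. Proof. by rewrite lee_fin. Qed.

Lemma clampr_mono (x y : R) : x <= y ->
  clampr t%:E x <= clampr t%:E y /\
  clampr t%:E y - clampr t%:E x <= y - x.
Proof.
move=> xy; have t0 := t_ge0; rewrite /clampr !lee_fin /=.
have [x0|x0] := leP x 0; have [xt|xt] := leP x t; have [y0|y0] := leP y 0;
  have [yt|yt] := leP y t => /=; lra.
Qed.

Lemma J1_finite_tchange (d : S -> S -> R) (f g : R -> S) e :
  (forall x y, 0 <= d x y) ->
  (J1_dist_finite d (restr (T := t%:E) f) (restr (T := t%:E) g) < e%:E)%E ->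
  exists2 l, tchange t%:E e l &
    forall s, 0 <= s -> s <= t -> d (f s) (g (l s)) <= e.
Proof.
move=> d0; have t0 := t_ge0; move=> /ereal_inf_lt[_ [lam [lam_mono lam_cts [lam' lamK lam'K]] <-]].
rewrite gt_max => /andP[slope vals].
have lam_le (a b : horizon t%:E) : \val a <= \val b -> \val (lam a) <= \val (lam b).
  rewrite le_eqVlt => /orP[/eqP/val_inj->//|ab].
  by apply/ltW; exact: lam_mono.
pose cl := clamp tE.
have hz (a : horizon t%:E) : 0 <= \val a /\ \val a <= t.
  by have [] := valP_horizon a; rewrite lee_fin.
have ccl x : \val (cl x) = clampr t%:E x by [].
have c0 : clampr t%:E 0 = 0 by rewrite /clampr lexx.
have ct : clampr t%:E t = t by rewrite clampr_id //; split.
(* An increasing bijection of [0, t] fixes both endpoints, which makes its extension by the identity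
   a time change. *)
have lam0 : \val (lam (cl 0)) = 0.
  apply/eqP; rewrite eq_le (hz _).1 andbT.
  have := lam_le (cl 0) (lam' (cl 0)).
  by rewrite lam'K !ccl c0; apply; exact: (hz _).1.
have lamt : \val (lam (cl t)) = t.
  apply/eqP; rewrite eq_le (hz _).2 /=.
  have := lam_le (lam' (cl t)) (cl t).
  by rewrite lam'K !ccl ct; apply; exact: (hz _).2.
have bilip (a b : horizon t%:E) : \val a <= \val b ->
    \val (lam b) - \val (lam a) <= expR e * (\val b - \val a) /\
    \val b - \val a <= expR e * (\val (lam b) - \val (lam a)).
  rewrite le_eqVlt => /orP[/eqP/val_inj->|ab]; first by rewrite !subrr mulr0.
  have lab := lam_mono _ _ ab.
  set r := (\val (lam b) - \val (lam a)) / (\val b - \val a).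
  have r0 : 0 < r by rewrite divr_gt0 // subr_gt0.
  have : `|ln r| <= e.
    rewrite -lee_fin; apply: ltW; apply: le_lt_trans slope.
    by apply: ereal_sup_ubound; exists a, b.
  move=> /(ln_le_expR r0)[h1 h2].
  have ba : 0 < \val b - \val a by rewrite subr_gt0.
  have rE : \val (lam b) - \val (lam a) = r * (\val b - \val a).
    by rewrite /r divfK // gt_eqF.
  by rewrite rE; split; [rewrite ler_pM2r|rewrite mulrA ler_peMl // ltW].
(* Each x is displaced as much as its clamped point, hence not at all outside the horizon. *)
exists (fun x => x + (\val (lam (cl x)) - clampr t%:E x)).
  have e1 : 1 <= expR e.
    rewrite -expR0 ler_expR -lee_fin; apply: ltW; apply: le_lt_trans vals.
    apply: (@le_trans _ _ (d (f (\val (cl 0))) (g (\val (lam (cl 0)))))%:E).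
      by rewrite lee_fin.
    by apply: ereal_sup_ubound; exists (cl 0).
  split=> [x y xy|x y xy|x [x0|]].
  - have [h1 h2] := clampr_mono xy.
    by have [b1 b2] := bilip (cl x) (cl y) h1; rewrite !ccl in b1; nra.
  - have [h1 h2] := clampr_mono xy.
    by have [b1 b2] := bilip (cl x) (cl y) h1; rewrite !ccl in b2; nra.
  - have -> : cl x = cl 0 by apply: val_inj; rewrite !ccl /clampr x0 lexx.
    by rewrite lam0 /clampr x0 subrr addr0.
  - rewrite lee_fin => tx.
    have cx : clampr t%:E x = t.
      by rewrite /clampr lee_fin; case: ifP => h; [|case: ifP => h' /=]; lra.
    have -> : cl x = cl t by apply: val_inj; rewrite !ccl cx ct.
    by rewrite lamt cx subrr addr0.
move=> s s0 st; have cs : clampr t%:E s = s by apply: clampr_id; split.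
rewrite cs addrC subrK -lee_fin; apply: ltW; apply: le_lt_trans vals.
by apply: ereal_sup_ubound; exists (cl s) => //; rewrite /restr ccl cs.
Qed.

(** A time change that fixes t restricts to [0, t]. Allowing it to be one of the half-line serves
    both a finite horizon and the truncations of an infinite one. *)
Lemma J1_finite_le (d : S -> S -> R) (f g : R -> S) l e :
  0 <= e -> tchange +oo%E e l -> l t = t ->
  (forall s, 0 <= s -> s <= t -> d (f s) (g (l s)) <= e) ->
  (J1_dist_finite d (restr (T := t%:E) f) (restr (T := t%:E) g) <= e%:E)%E.
Proof.
move=> e0 tl lt fg; have t0 := t_ge0.
pose cl := clamp tE.
have hz (a : horizon t%:E) : 0 <= \val a /\ \val a <= t.
  by have [] := valP_horizon a; rewrite lee_fin.
have stable m (a : horizon t%:E) : tchange +oo%E e m -> m t = t ->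
    \val (cl (m (\val a))) = m (\val a).
  move=> tm mt; have [a0 at'] := hz a; rewrite val_clamp clampr_id //; split.
    by have [] := tchange_pos tm a0.
  by have := tchange_le_mono (\val a) t tm; rewrite mt lee_fin => ->.
have [m [tm lm ml]] := tchange_inv tl.
have mt : m t = t by rewrite -{1}lt lm.
pose lam (a : horizon t%:E) := cl (l (\val a)).
have slope (a b : horizon t%:E) : \val a <= \val b ->
    `|\val (lam b) - \val (lam a)| <= expR e * `|\val b - \val a|.
  move=> ab; rewrite !stable //; have [l1 _ _] := tl.
  rewrite ger0_norm; first by rewrite ger0_norm ?subr_ge0 //; exact: l1.
  by rewrite subr_ge0 (tchange_le_mono _ _ tl).
apply: ge_ereal_inf; exists (maxe (ereal_sup [set z : \bar R |
    exists s1 s2 : horizon t%:E, (\val s1 < \val s2)%R /\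
    z = (`| ln ((\val (lam s2) - \val (lam s1)) / (\val s2 - \val s1)) |%R)%:E])
  (ereal_sup [set (d (restr f s) (restr g (lam s)))%:E | s in setT])).
  exists lam => //; split.
  - by move=> a b ab; rewrite !stable // (tchange_lt_mono _ _ tl).
  - move=> a A /nbhs_horizonP[r r0 rA]; apply/nbhs_horizonP.
    exists (r / expR e); first by rewrite divr_gt0 ?expR_gt0.
    move=> b; rewrite ltr_pdivlMr ?expR_gt0 // mulrC => ba; apply: rA.
    apply: le_lt_trans ba; have [ab|ab] := leP (\val a) (\val b).
      exact: slope.
    by rewrite distrC (distrC (\val b)); apply: slope; exact: ltW.
  - exists (fun a : horizon t%:E => cl (m (\val a))) => a; apply: val_inj.
      by rewrite stable // /lam stable // lm.
    by rewrite /lam stable // stable // ml.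
rewrite ge_max; apply/andP; split; apply: ge_ereal_sup => z.
  move=> [a [b [ab ->]]]; rewrite lee_fin !stable //.
  have ab0 : 0 < \val b - \val a by rewrite subr_gt0.
  have [l1 l2 _] := tl; have {}l1 := l1 _ _ (ltW ab); have {}l2 := l2 _ _ (ltW ab).
  apply: expR_le_ln.
  - by rewrite divr_gt0 // subr_gt0 (tchange_lt_mono _ _ tl).
  - by rewrite ler_pdivrMr.
  - by rewrite mulrA ler_pdivlMr // mul1r.
move=> [a _ <-]; rewrite lee_fin /restr stable //.
by have [a0 at'] := hz a; exact: fg.
Qed.

End finite_horizon.

(** * Bounds for integrals of possibly nonmeasurable functions *)

Section lower_integral.
Variable R : realType.
Local Notation mu := (@lebesgue_measure R).

(* The integral of a nonnegative function, measurable or not, is the supremum of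
   those of the simple functions below it. *)
Lemma ge0_le_integral_nonmeasurable (D : set R) (f h : R -> \bar R) :
  (forall x, D x -> (0 <= f x)%E) -> (forall x, (0 <= h x)%E) ->
  (forall x, D x -> (f x <= h x)%E) ->
  (\int[mu]_(x in D) f x <= \int[mu]_x h x)%E.
Proof.
move=> f0 h0 fh; rewrite integral_mkcond !ge0_integralTE //; last first.
  by move=> x; exact: erestrict_ge0.
apply: ereal_sup_le => _ [k kf <-]; exists k => // x.
apply: le_trans (kf x) _; rewrite patchE; case: ifPn => [|_]; last exact: h0.
by rewrite inE => /fh.
Qed.

(** k is a sum of indicators of the intervals of radius r around the breakpoints. It dominates the
    integrand at the times where the truncated distance is not controlled. *)
Lemma cover_breakpoints (B : seq R) (r : R) : 0 < r ->
  exists k : R -> R, [/\ measurable_fun setT k, forall t, 0 <= k t,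
    forall t b, b \in B -> `|t - b| < r -> 1 <= k t &
    (\int[mu]_x (k x)%:E <= (2 * r * (size B)%:R)%:E)%E].
Proof.
move=> r0; elim: B => [|b B [k [mk k0 k1 ik]]].
  exists (cst 0); split => //.
  by rewrite integral0_eq // mulr0.
pose I := `]b - r, b + r[%classic : set R.
have mI : measurable (I : set R) by exact: measurable_itv.
exists (fun t => \1_I t + k t); split => [|t|t b'|].
- by apply: measurable_funD => //; exact: measurable_indic.
- by rewrite addr_ge0 // indicE.
- rewrite inE => /predU1P[->|b'B] tb.
    have -> : \1_I t = 1 :> R.
      by rewrite indicE mem_set // /I /= in_itv /=; move: tb; rewrite ltr_norml; lra.
    by have := k0 t; lra.
  apply: (le_trans (k1 t b' b'B tb)); rewrite lerDr indicE.
  exact: ler0n.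
- under eq_integral do rewrite EFinD.
  rewrite ge0_integralD //=; first last.
  + by apply/measurable_EFinP.
  + by move=> x _; rewrite lee_fin.
  + by apply/measurable_EFinP; exact: measurable_indic.
  rewrite integral_indic // setIT.
  rewrite [X in (X + _ <= _)%E](_ : _ = (2 * r)%:E); last first.
    rewrite /I /= lebesgue_measure_itv /= lte_fin ifT; last by lra.
    by rewrite -EFinB; congr EFin; lra.
  have -> : 2 * r * (size B).+1%:R = 2 * r + 2 * r * (size B)%:R.
    by rewrite -(natr1 (size B)) mulrDr mulr1 addrC.
  by rewrite EFinD leeD2l.
Qed.

(** Half of the exponent gives the small factor, the other half remains as an integrable density. *)
Lemma exp_tail (t M : R) : 0 <= t -> M <= t ->
  expR (- t) <= 2 * expR (- M / 2) * exponential_pdf 2^-1 t.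
Proof.
move=> t0 Mt; rewrite exponential_pdfE //.
have -> : 2 * expR (- M / 2) * (2^-1 * expR (- 2^-1 * t)) =
  expR (- M / 2) * expR (- 2^-1 * t) by field.
by rewrite -expRD ler_expR; lra.
Qed.

End lower_integral.

Section infinite_horizon.
Variable R : realType.

(** The distance on [0, t] requires a time change that fixes t, which l need not do. A tent brings l
    t back to t. It alters the image of s only for s near t, replacing it by l s' with s' also near
    t, and the small oscillation of f there absorbs the difference. *)
Lemma J1_finite_fix (S : Type) (d : S -> S -> R) (f g : R -> S) e c r M t l :
  is_metric d -> 0 < e -> e <= 2^-1 -> 0 < c -> c <= t -> t <= M ->
  0 < r -> r <= e / 2 -> M <= r^-1 -> 32 * M * r <= e * c ->
  tchange +oo%E r l ->
  (forall s, s <= r^-1 \/ l s <= r^-1 -> d (f s) (g (l s)) <= r) ->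
  (forall s s', `|s - t| < c -> `|s' - t| < c -> d (f s) (f s') <= e) ->
  (J1_dist_finite d (restr (T := t%:E) f) (restr (T := t%:E) g) <= (e + e)%:E)%E.
Proof.
move=> [_ _ dC dtri] e0 e2 c0 ct tM r0 re Mr small tl fg osc.
have t0 : 0 <= t by lra.
have lt_t : `|l t - t| <= e * c / 16.
  apply: (le_trans (tchange_dist tl (ltW r0) _ t0)); first by lra.
  have : r * t <= r * M by rewrite ler_pM2l.
  lra.
have ec : e * c <= 2^-1 * c by rewrite ler_pM2r.
(* From |l t - t| <= 2 * r * M <= e * c / 16, a tent of half-width c / 4 and slope e / 4
   suffices. *)
pose w := c / 4; have w0 : 0 < w by rewrite /w; lra.
have k4 : `|t - l t| <= e / 4 * w.
  by rewrite distrC /w; apply: le_trans lt_t _; rewrite le_eqVlt; apply/orP; left;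
    apply/eqP; field.
have [psi [psi_t psi_out psik psi_le']] := tent (l t) w0 k4.
have psi_le x : `|psi x| <= e * c / 16.
  by apply: le_trans lt_t; rewrite distrC.
move: (lt_t); rewrite ler_norml => /andP[lt1 lt2].
have tpsi : tchange +oo%E (e / 2) (fun x => x + psi x).
  apply: (tchange_perturb _ _ psik); [by lra|by nra|].
  move=> x [x0|]; last by rewrite leye_eq.
  apply: psi_out; rewrite ler0_norm; rewrite /w; lra.
have tm := tchange_comp tl tpsi.
apply: (@J1_finite_le _ _ _ t0 d f g ((fun x => x + psi x) \o l)).
- lra.
- by apply: tchange_le tm; lra.
- by rewrite /= psi_t; lra.
move=> s s0 st /=.
have fgs : d (f s) (g (l s)) <= r by apply: fg; left; lra.
have [far|near] := leP w `|l s - l t|.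
  by rewrite psi_out // addr0; lra.
have er : expR r <= 2.
  by apply: (le_trans (expR_le_1D2 (ltW r0) _)); lra.
have back x y : `|x - y| <= 2 * `|l x - l y|.
  wlog xy : x y / x <= y.
    by move=> H; have [/H//|/ltW/H] := leP x y; rewrite distrC (distrC (l y)).
  have lxy : l x <= l y by rewrite (tchange_le_mono _ _ tl).
  rewrite distrC (distrC (l x)) !ger0_norm ?subr_ge0 //.
  have [_ l2 _] := tl; apply: le_trans (l2 _ _ xy) _.
  by rewrite ler_wpM2r // subr_ge0.
(* Writing the corrected time as l s' turns an oscillation of g, of which nothing is known, into one
   of f. *)
have [s' ls'] := tchange_surj (l s + psi (l s)) tl.
have s't : l s' <= t.
  have -> : l s' = ((fun x => x + psi x) \o l) s by rewrite ls'.
  have -> : t = ((fun x => x + psi x) \o l) t.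
    by rewrite /= psi_t; lra.
  by rewrite (tchange_le_mono _ _ tm).
have fgs' : d (f s') (g (l s')) <= r by apply: fg; right; lra.
have : d (f s) (f s') <= e.
  apply: osc.
    by apply: le_lt_trans (back s t) _; rewrite /w in near; lra.
  apply: le_lt_trans (back s' t) _; rewrite ls' addrAC.
  have := ler_normD (l s - l t) (psi (l s)); have := psi_le (l s).
  by rewrite /w in near; lra.
rewrite -ls'; have := dtri (f s) (f s') (g (l s')); lra.
Qed.

(** Each induction step adds the two ends of the new segment to B. A time at distance c from all
    breakpoints then has its c-neighbourhood inside one piece, where f stays near a single point. *)
Lemma cadlag_breakpoints (S : topologicalType) (d : S -> S -> R) (f : R -> S) e M :
  metrizes d -> cadlag_line f -> 0 < e -> exists B : seq R,
  forall c t : R, 0 < c -> 0 <= t -> t < M -> (forall b, b \in B -> c <= `|t - b|) ->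
  forall s s', `|s - t| < c -> `|s' - t| < c -> d (f s) (f s') <= e.
Proof.
move=> md cf e0; move: M; apply: (cadlag_induction cf) => [x x0|x0].
  by exists [::] => c t c0 t0 tx; lra.
have [[_ _ dC dtri] _] := md.
exists [set y | d x0 y < e / 2]; first by apply: metrizes_nbhs => //; lra.
move=> y y' y0 yy' fA [B osc]; exists [:: y, y' & B] => c t c0 t0 ty' far s s'.
have [ty|yt] := ltP t y.
  by apply: osc => // b bB; apply: far; rewrite !inE bB !orbT.
have h1 : c <= `|t - y| by apply: far; rewrite !inE eqxx.
have h2 : c <= `|t - y'| by apply: far; rewrite !inE eqxx orbT.
rewrite ger0_norm ?subr_ge0 // in h1; rewrite ltr0_norm ?subr_lt0 // in h2.
rewrite !ltr_norml => /andP[s1 s2] /andP[s'1 s'2].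
have /= fs : d x0 (f s) < e / 2 by apply: fA; lra.
have /= fs' : d x0 (f s') < e / 2 by apply: fA; lra.
by have := dtri (f s) x0 (f s'); rewrite (dC (f s) x0); lra.
Qed.

End infinite_horizon.

Section J1_balls.
Variable R : realType.

Lemma cadlag_fun_restr (T : \bar R) (T0 : (0 <= T)%E) (S : Type) (F : horizon T -> S) :
  F = restr (ext T0 F).
Proof. by apply/funext => s; rewrite /restr ext_val. Qed.

Lemma restrict_horizon_restr (T0 : (0 <= +oo)%E) (S : Type)
    (F : horizon (R := R) +oo -> S) t :
  restrict_horizon (t := t) F = restr (ext T0 F).
Proof.
apply/funext => s; rewrite /restr /restrict_horizon /ext; congr F; apply: val_inj.
by rewrite val_clamp clampr_id //; apply: sub_horizon; exact: valP_horizon.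
Qed.

Variable S : topologicalType.
Implicit Types (d : S -> S -> R) (e : R).

Lemma tchange_outside_oo (T : \bar R) e l : tchange T e l -> tchange +oo%E e l.
Proof.
move=> [l1 l2 l3]; split=> // x [x0|]; first by apply: l3; left.
by rewrite leye_eq.
Qed.

Lemma J1_small_finite t (T0 : (0 <= t%:E)%E) d (F G : cadlag_fun t%:E S) e :
  metrizes d -> (J1_dist d F G < e%:E)%E ->
  jnear t%:E d e (ext T0 F) (ext T0 G).
Proof.
move=> md; have -> : J1_dist d F G = @J1_dist_finite R S d t
    (restr (T := t%:E) (ext T0 F)) (restr (T := t%:E) (ext T0 G)).
  by rewrite -!cadlag_fun_restr.
have t0 : 0 <= t by rewrite -lee_fin.
have [d0 _ _ _] := md.1.
move=> /(J1_finite_tchange t0 d0)[l tl FG]; exists l => // s _.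
rewrite -(ext_clampr T0 F s) -(ext_clampr T0 G (l s)) (clampr_tchange T0 _ tl).
by have [h1 h2] := clampr_horizon T0 s; apply: FG.
Qed.

Lemma J1_dist_finite_ge0 d t (F G : horizon t%:E -> S) :
  0 <= t -> (forall x y, 0 <= d x y) -> (0 <= J1_dist_finite d F G)%E.
Proof.
move=> t0 d0; apply: le_ereal_inf_tmp => _ [lam _ <-].
rewrite le_max; apply/orP; right.
have T0 : (0 <= t%:E)%E by rewrite lee_fin.
apply: (@le_trans _ _ (d (F (clamp T0 0)) (G (lam (clamp T0 0))))%:E).
  by rewrite lee_fin.
by apply: ereal_sup_ubound; exists (clamp T0 0).
Qed.

Lemma J1_integrand_ge0 d t (F G : horizon +oo%E -> S) :
  0 <= t -> (forall x y, 0 <= d x y) ->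
  (0 <= (expR (- t))%:E * mine 1 (J1_dist_finite d (restrict_horizon (t := t) F)
                               (restrict_horizon (t := t) G)))%E.
Proof.
move=> t0 d0; apply: mule_ge0; first by rewrite lee_fin expR_ge0.
by rewrite le_min lee_fin ler01 J1_dist_finite_ge0.
Qed.

(** If nearness at e fails, the truncated distance is at least e at every t in [1 / e, 1 / e + 1],
    since a time change of [0, t] would cover the window. Integration over this interval of length 1
    gives the bound. *)
Lemma J1_small_infinite (T0 : (0 <= +oo)%E) d (F G : cadlag_fun +oo S) e :
  metrizes d -> 0 < e -> e <= 1 ->
  (J1_dist d F G < (e * expR (- (e^-1 + 1)))%:E)%E ->
  jnear +oo%E d e (ext T0 F) (ext T0 G).
Proof.
move=> md e0 e1; have [d0 _ _ _] := md.1.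
have i0 : 0 < e^-1 by rewrite invr_gt0.
suff H : (forall t, e^-1 <= t -> t <= e^-1 + 1 ->
    (e%:E <= J1_dist_finite d (restrict_horizon (t := t) F)
      (restrict_horizon (t := t) G))%E) ->
    ((e * expR (- (e^-1 + 1)))%:E <= J1_dist d F G)%E.
  rewrite ltNge => /negP nH; apply: contrapT => FG; apply/nH/H => t te _.
  rewrite leNgt; apply/negP; rewrite !(restrict_horizon_restr T0).
  have t0 : 0 <= t by lra.
  move=> /(J1_finite_tchange t0 d0)[l tl FGl]; apply: FG; exists l.
    exact: tchange_outside_oo tl.
  move=> s win; have [s0|s0] := leP 0 s; last first.
    have [_ _ ->] := tl; last by left; apply: ltW.
    rewrite (ext_neg T0 F (ltW s0)) (ext_neg T0 G (ltW s0)).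
    by have := FGl 0 (lexx _) t0; rewrite (tchange0 tl).
  apply: FGl => //; rewrite leNgt; apply/negP => ts.
  have ls : l s = s by have [_ _ ->] := tl => //; right; rewrite lee_fin ltW.
  by case: win; rewrite ?ls; lra.
move=> H.
set c := e * expR _; pose I : set R := `[e^-1, e^-1 + 1]%classic.
have -> : c%:E = (\int[lebesgue_measure]_(x in I) c%:E)%E.
  rewrite integral_cst; last exact: measurable_itv.
  rewrite [X in (_ * X)%E](_ : _ = 1%E) ?mule1 //.
  rewrite /I /= lebesgue_measure_itv /= lte_fin ifT; last by lra.
  by rewrite -EFinB; congr EFin; lra.
rewrite /= /J1_dist_infinite [leRHS]integral_mkcond.
apply: ge0_le_integral_nonmeasurable => [x _|x|x].
- by rewrite lee_fin /c mulr_ge0 ?expR_ge0 // ltW.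
- apply: erestrict_ge0 => t; rewrite /= in_itv /= andbT => t0.
  exact: J1_integrand_ge0.
rewrite /I /= in_itv /= => /andP[x1 x2].
rewrite patchE ifT; last by rewrite inE /= in_itv /= andbT; lra.
rewrite /c mulrC EFinM lee_pmul //; try by rewrite lee_fin ?expR_ge0 // ltW.
  by rewrite lee_fin ler_expR; lra.
by rewrite le_min lee_fin e1 /=; apply: H.
Qed.

(** At most times [J1_finite_fix] bounds the truncated distance by 2 * e'. Near a breakpoint of F,
    near 0 and beyond M only the trivial bound 1 is available, but these times have small total
    weight. *)
Lemma jd_small_infinite (T0 : (0 <= +oo)%E) d (F : cadlag_fun +oo S) e :
  metrizes d -> 0 < e -> exists2 r, 0 < r & forall G : cadlag_fun +oo S,
    jnear +oo%E d r (ext T0 F) (ext T0 G) -> (J1_dist d F G < e%:E)%E.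
Proof.
move=> md.
wlog e1 : e / e <= 1.
  move=> H e0; have [/H|/ltW ee] := leP e 1; first exact.
  have [//|//|r r0 rd] := H 1; exists r => // G /rd FG.
  by apply: lt_le_trans FG _; rewrite lee_fin.
move=> e0; pose e' := e / 16; have e'0 : 0 < e' by rewrite /e'; lra.
pose M := 32 / e; have M0 : 0 < M by rewrite divr_gt0.
have [B osc] := cadlag_breakpoints (M + 1) md (cadlag_fun_ext T0 F) e'0.
pose n : R := (size B).+1%:R.
have n1 : 1 <= n by rewrite ler1n.
pose c := e / (8 * n); have c0 : 0 < c by rewrite divr_gt0 //; lra.
have cn : c * n = e / 8 by rewrite /c invfM mulrA divfK // gt_eqF //; lra.
pose r := Num.min (e' / 2) (Num.min M^-1 (e' * c / (32 * M))).
have Mi : 0 < M^-1 by rewrite invr_gt0.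
have r0 : 0 < r.
  rewrite !lt_min; apply/and3P; split => //; first by lra.
  by apply: divr_gt0; apply: mulr_gt0 => //; lra.
have [r1 r2 r3] : [/\ r <= e' / 2, r <= M^-1 & r <= e' * c / (32 * M)].
  by split; rewrite !ge_min lexx ?orbT.
exists r => // G [l tl FG].
(* The additional breakpoint 0 guarantees c <= t at the remaining times. *)
have [k [mk k0 k1 ik]] := cover_breakpoints (0 :: B) c0.
(* One summand for each kind of time, with integrals at most 2 * e' = e / 8, 2 * c * n = e / 4 and 2
   * expR (- M / 2) <= e / 8. *)
pose h t := (2 * e') * exponential_pdf 1 t + (k t +
  2 * expR (- M / 2) * exponential_pdf 2^-1 t).
have pdf_ge0 q t : 0 <= q -> 0 <= exponential_pdf q t :> R.
  by move=> q0; exact: exponential_pdf_ge0.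
have mpdf q : measurable_fun setT (exponential_pdf q : R -> R).
  exact: measurable_exponential_pdf.
have ipdf q : 0 < q ->
    (\int[lebesgue_measure]_x (exponential_pdf q x)%:E = 1 :> \bar R)%E.
  exact: integral_exponential_pdf.
have mtail a q : measurable_fun setT (fun t => a * exponential_pdf q t : R).
  exact: (measurable_funM (measurable_cst _) (mpdf q)).
have h0 t : 0 <= h t.
  rewrite /h !addr_ge0 // ?mulr_ge0 ?pdf_ge0 ?expR_ge0 //; lra.
have itail a q : 0 <= a -> 0 < q ->
    (\int[lebesgue_measure]_x (a * exponential_pdf q x)%:E = a%:E :> \bar R)%E.
  move=> a0 q0; rewrite -[RHS]mule1 -(ipdf q q0).
  apply: (@ge0_integralZl_EFin _ _ R lebesgue_measure setT measurableT (fun x => (exponential_pdf q x)%:E) _ _ a a0);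
    last by apply/measurable_EFinP; exact: mpdf.
  by move=> x _; rewrite lee_fin pdf_ge0 // ltW.
have ih : (\int[lebesgue_measure]_x (h x)%:E <=
    (2 * e' + (2 * c * n + 2 * expR (- M / 2)))%:E)%E.
  under eq_integral do rewrite /h EFinD EFinD.
  rewrite ge0_integralD //=; first last.
  - apply/measurable_EFinP; exact: (measurable_funD mk (mtail _ _)).
  - move=> x _; rewrite -EFinD lee_fin addr_ge0 //.
    by rewrite mulr_ge0 ?pdf_ge0 ?mulr_ge0 ?expR_ge0 //; lra.
  - apply/measurable_EFinP; exact: mtail.
  - by move=> x _; rewrite lee_fin mulr_ge0 ?pdf_ge0 //; lra.
  rewrite ge0_integralD //=; first last.
  - apply/measurable_EFinP; exact: mtail.
  - move=> x _; rewrite lee_fin.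
    by rewrite mulr_ge0 ?pdf_ge0 ?mulr_ge0 ?expR_ge0 //; lra.
  - exact/measurable_EFinP.
  - by move=> x _; rewrite lee_fin.
  rewrite !EFinD; apply: leeD; last apply: leeD.
  - by rewrite le_eqVlt; apply/orP; left; apply/eqP; apply: itail => //; lra.
  - exact: ik.
  - by rewrite le_eqVlt; apply/orP; left; apply/eqP; apply: itail; [rewrite mulr_ge0 ?expR_ge0|lra].
apply: (@le_lt_trans _ _ (\int[lebesgue_measure]_x (h x)%:E)%E); last first.
  apply: le_lt_trans ih _; rewrite lte_fin -mulrA cn /e'.
  have : expR (- M / 2) <= e / 16.
    rewrite mulNr expRN; have := expR_ge1Dx (M / 2) => eM.
    have : 16 / e <= expR (M / 2).
      by apply: le_trans eM; rewrite /M; lra.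
    have e16 : 0 < 16 / e by rewrite divr_gt0.
    by rewrite -[e / 16]invf_div lef_pV2 // posrE ?expR_gt0.
  lra.
have [d0 _ _ _] := md.1.
rewrite /= /J1_dist_infinite; apply: ge0_le_integral_nonmeasurable => [t|t|t].
- by rewrite /= in_itv /= andbT => t0; exact: J1_integrand_ge0.
- by rewrite lee_fin.
rewrite /= in_itv /= andbT => t0.
set J := J1_dist_finite _ _ _.
have J0 : (0 <= J)%E by exact: J1_dist_finite_ge0.
have p1 : 0 <= (2 * e') * exponential_pdf 1 t.
  by rewrite mulr_ge0 ?pdf_ge0 //; lra.
have p2 : 0 <= 2 * expR (- M / 2) * exponential_pdf 2^-1 t.
  by rewrite mulr_ge0 ?pdf_ge0 ?mulr_ge0 ?expR_ge0 //; lra.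
have kt := k0 t.
have e0t : (0 <= (expR (- t))%:E)%E by rewrite lee_fin expR_ge0.
have mJ0 : (0 <= mine 1 J)%E by rewrite le_min lee_fin ler01.
have J1 : ((expR (- t))%:E * mine 1 J <= (expR (- t))%:E)%E.
  by rewrite -[leRHS]mule1; apply: lee_pmul => //; rewrite ge_min lexx.
have [Mt|tM] := leP M t.
  by apply: le_trans J1 _; rewrite lee_fin /h; have := exp_tail t0 Mt; lra.
have [[b bB tb]|far] := pselect (exists2 b, b \in 0 :: B & `|t - b| < c).
  apply: le_trans J1 _; rewrite lee_fin /h; have := k1 t b bB tb.
  have : expR (- t) <= 1 by rewrite -expR0 ler_expR; lra.
  lra.
have {}far b : b \in 0 :: B -> c <= `|t - b|.
  by move=> bB; rewrite leNgt; apply/negP => tb; apply: far; exists b.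
have ct : c <= t by have := far 0 (mem_head _ _); rewrite subr0 ger0_norm.
have Jle : (J <= (e' + e')%:E)%E.
  rewrite /J !(restrict_horizon_restr T0).
  apply: (@J1_finite_fix _ _ d _ _ e' c r M t l) => //.
  - exact: md.1.
  - by rewrite /e'; lra.
  - exact: ltW.
  - by rewrite -[M]invrK lef_pV2.
  - by rewrite mulrC -ler_pdivlMr //; lra.
  - apply: (osc c t) => //; first by lra.
    by move=> b bB; apply: far; rewrite inE bB orbT.
apply: (@le_trans _ _ ((expR (- t))%:E * (e' + e')%:E)%E).
  by apply: lee_pmul => //; apply: le_trans Jle; rewrite ge_min lexx orbT.
rewrite -EFinM lee_fin /h exponential_pdfE // mulN1r mul1r; lra.
Qed.

End J1_balls.

Section J1_topology_metric.
Variables (R : realType) (T : \bar R).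
Hypothesis T_ge0 : (0 <= T)%E.
Variable S : topologicalType.

Lemma J1_small d (F : cadlag_fun T S) (e : R) : metrizes d -> 0 < e ->
  exists2 r, 0 < r & forall G : cadlag_fun T S, (J1_dist d F G < r%:E)%E -> jd T_ge0 d F G < e.
Proof.
move=> md e0; case: T T_ge0 F => [t||] // T0 F.
  exists (e / 2); first by lra.
  move=> G /(J1_small_finite T0 md) FG.
  by apply: le_lt_trans (jdist_le _ FG) _; lra.
pose e' := Num.min (e / 2) 1.
have e'0 : 0 < e' by rewrite lt_min ltr01 andbT; lra.
have [e'e e'1] : e' <= e / 2 /\ e' <= 1 by rewrite !ge_min !lexx orbT.
exists (e' * expR (- (e'^-1 + 1))); first by rewrite mulr_gt0 ?expR_gt0.
move=> G /(J1_small_infinite T0 md e'0 e'1) FG.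
by apply: le_lt_trans (jdist_le e'0 FG) _; lra.
Qed.

Lemma jd_small d (F : cadlag_fun T S) (e : R) : metrizes d -> 0 < e ->
  exists2 r, 0 < r & forall G : cadlag_fun T S, jd T_ge0 d F G < r -> (J1_dist d F G < e%:E)%E.
Proof.
move=> md e0; case: T T_ge0 F => [t||] // T0 F.
  have t0 : 0 <= t by rewrite -lee_fin.
  (* The bound (t + 1)^-1 makes the window contain all of [0, t]. *)
  pose r := Num.min (Num.min (e / 2) 2^-1) (t + 1)^-1.
  have r0 : 0 < r.
    by rewrite !lt_min; apply/andP; split; [apply/andP; split|rewrite invr_gt0]; lra.
  have [re r2 rt] : [/\ r <= e / 2, r <= 2^-1 & r <= (t + 1)^-1].
    by rewrite !ge_min !lexx !orbT.
  exists r => // G FG; have [l tl FGl] := jdist_lt FG r2.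
  have -> : J1_dist d F G = @J1_dist_finite R S d t
      (restr (T := t%:E) (ext T0 F)) (restr (T := t%:E) (ext T0 G)).
    by rewrite -!cadlag_fun_restr.
  apply: (@le_lt_trans _ _ r%:E); last by rewrite lte_fin; lra.
  apply: (J1_finite_le t0 (ltW r0) (tchange_outside_oo tl)).
    by have [_ _ ->] := tl => //; right.
  move=> s s0 st; apply: FGl; left; apply: (le_trans st).
  have : (t + 1)^-1^-1 <= r^-1 by rewrite lef_pV2 // posrE invr_gt0; lra.
  by rewrite invrK; lra.
have [r r0 rd] := jd_small_infinite T0 F md e0.
exists (Num.min r 2^-1); first by rewrite lt_min r0 /=; lra.
move=> G; rewrite lt_min => /andP[FGr FG2]; apply: rd.
have [r2|r2] := leP r 2^-1; first exact: jdist_lt.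
have h : 0 < 2^-1 :> R by lra.
by apply: (jnear_le h (ltW r2)); exact: jdist_lt.
Qed.

(** Openness for J1 is tested with every metric d' of S. The interior of A for [jd] passes each of
    these tests because [jd_metric] compares d' with d around each path. *)
Lemma metrizes_jd d : metrizes d -> metrizes (T := cadlag_fun T S) (jd T_ge0 d).
Proof.
move=> md; have jm := jd_is_metric T_ge0 md; have [_ jxx _ jtri] := jm.
split=> // F A; split.
  move=> [B [oB BF BA]]; have [e e0 eB] := oB d md F BF.
  have [r r0 rJ] := jd_small F md e0; exists r => // G /rJ /eB; exact: BA.
move=> [e e0 eA].
exists [set G | exists2 r, 0 < r & [set H | jd T_ge0 d G H < r] `<=` A].
split; [|by exists e|].
  move=> d' md' G [r r0 rA]; have r2 : 0 < r / 2 by lra.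
  have [q q0 qd] := jd_metric T_ge0 G md md' r2.
  have [p p0 pd] := J1_small G md' q0.
  exists p => // H /pd /qd GH; exists (r / 2) => // K /= HK.
  by apply: rA => /=; have := jtri G H K; lra.
move=> G [r r0]; apply; rewrite /=.
by have [_ ->] := jxx G G.
Qed.

End J1_topology_metric.

(** * Topological embeddings between metrizable spaces *)

Section metrizable_spaces.
Variable R : realType.

Lemma metrizes_cvg (S : topologicalType) (d : S -> S -> R) (I : Type)
    (F : set_system I) (u : I -> S) x : Filter F -> metrizes d ->
  u @ F --> x <-> forall e, 0 < e -> \forall i \near F, d x (u i) < e.
Proof.
move=> FF md; split=> [ux e e0|ux A].
  exact: (ux _ (metrizes_nbhs x md e0)).
by have [_ dn] := md => /dn[e e0 eA]; apply: filterS (ux e e0) => i /eA.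
Qed.

Lemma embedding_metrizes (S S' : topologicalType) (h : S -> S')
    (d : S' -> S' -> R) : topological_embedding h -> metrizes d ->
  metrizes (fun x y => d (h x) (h y)).
Proof.
move=> [hi hc ho] md; have [[d0 dxx dC dtri] dn] := md.
split; first split => // x y; first by split=> [/dxx/hi//|->]; apply/dxx.
move=> x A; split.
  rewrite nbhsE => -[U [oU Ux] UA].
  have [V oV UV] := ho U oU.
  have [Vx _] : (V `&` range h) (h x) by rewrite -UV; exists x.
  have /dn[e e0 eV] : nbhs (h x) V by exact: open_nbhs_nbhs.
  exists e => // y /eV Vy; apply: UA.
  have : (h @` U) (h y) by rewrite UV; split=> //; exists y.
  by case=> z Uz /hi <-.
move=> [e e0 eA]; apply: filterS eA _.
exact: (hc x _ (metrizes_nbhs (h x) md e0)).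
Qed.

Lemma isometric_embedding (S S' : topologicalType) (h : S -> S')
    (d : S -> S -> R) (d' : S' -> S' -> R) : metrizes d -> metrizes d' ->
  (forall x y, d' (h x) (h y) = d x y) -> topological_embedding h.
Proof.
move=> md md' dd'; have [[d0 dxx dC dtri] dn] := md.
have [[d'0 d'xx d'C d'tri] dn'] := md'; split.
- by move=> x y xy; apply/dxx; rewrite -dd'; apply/d'xx.
- move=> x A /dn'[e e0 eA]; apply/dn; exists e => // y xy.
  by apply: eA => /=; rewrite dd'.
move=> U oU.
exists [set z | exists2 e, 0 < e & forall x, d' z (h x) < e -> U x].
  rewrite openE => z [e e0 eU]; apply/dn'; exists (e / 2); first by lra.
  move=> w /= zw; exists (e / 2); first by lra.
  by move=> x wx; apply: eU; have := d'tri z w (h x); lra.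
apply/seteqP; split=> [z [x Ux <-]|z [/= [e e0 eU] [x _ xz]]]; last first.
  exists x => //; apply: eU; rewrite -xz.
  by have [_ ->] := d'xx (h x) (h x).
split; last by exists x.
have /dn[e e0 eU] : nbhs x U by exact: open_nbhs_nbhs.
by exists e => // y; rewrite dd' => /eU.
Qed.

Lemma embedding_lift (S S' : topologicalType) (h : S -> S') x (A : set S) :
  topological_embedding h -> nbhs x A ->
  exists2 B, nbhs (h x) B & forall y, B (h y) -> A y.
Proof.
move=> [hi hc ho]; rewrite nbhsE => -[U [oU Ux] UA].
have [V oV UV] := ho U oU; exists V.
  apply: open_nbhs_nbhs; split => //.
  by have [] : (V `&` range h) (h x) by rewrite -UV; exists x.
move=> y Vy; apply: UA.
have : (h @` U) (h y) by rewrite UV; split=> //; exists y.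
by case=> z Uz /hi <-.
Qed.

End metrizable_spaces.

Section structure_of_cadlag_functions.
Variables (R : realType) (T : \bar R).
Hypothesis T_ge0 : (0 <= T)%E.

(** For the metric of S pulled back along h, H is an isometry of the distances [jd]. *)
Lemma cadlag_embedding (S S' : topologicalType) (h : S -> S')
    (H : cadlag_fun T S -> cadlag_fun T S') :
  metrizable R S' -> topological_embedding h ->
  (forall F t, H F t = h (F t)) -> topological_embedding H.
Proof.
move=> [d md] eh HE.
apply: (isometric_embedding (metrizes_jd T_ge0 (embedding_metrizes eh md))
  (metrizes_jd T_ge0 md)) => F G.
have extH K : ext T_ge0 (H K) = h \o ext T_ge0 K by apply/funext => x; exact: HE.
by rewrite /jd !extH.
Qed.

Lemma tau_D_is_structure (sigma : structure R) : is_structure (tau_D T sigma).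
Proof.
split=> [X|X Y f|X|X Y Z g f].
- have [d md] := st_metrizable (st_laws sigma) X.
  by exists (jd T_ge0 d); exact: metrizes_jd.
- apply: (cadlag_embedding (st_metrizable (st_laws sigma) Y)
    (st_embedding (st_laws sigma) f)) => //.
- apply/funext => F; apply: cadlag_fun_eq.
  by apply/funext => t /=; rewrite (st_map_id (st_laws sigma)).
- apply/funext => F; apply: cadlag_fun_eq.
  by apply/funext => t /=; rewrite (st_map_comp (st_laws sigma)).
Qed.

End structure_of_cadlag_functions.

(** * Translates of a bcm space in its Kuratowski embedding *)

Section translated_copies.
Variables (R : realType) (Y : bcm R) (y0 : Y).

Definition kuratowski (y x : Y) : R := mdist y x - mdist y0 x.

Definition supdist (z w : Y -> R) : R := sup (range (fun x => `|z x - w x|)).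

Definition at_bounded_distance (z w : Y -> R) := exists c, forall x, `|z x - w x| <= c.

Lemma supdist_has_sup z w : at_bounded_distance z w ->
  has_sup (range (fun x => `|z x - w x|)).
Proof.
move=> [c zw]; split; first by exists `|z y0 - w y0|; exists y0.
by exists c => _ [x _ <-].
Qed.

Lemma le_supdist z w x : at_bounded_distance z w -> `|z x - w x| <= supdist z w.
Proof.
by move=> zw; apply: ub_le_sup; [exact: (supdist_has_sup zw).2|exists x].
Qed.

Lemma supdist_le z w c : (forall x, `|z x - w x| <= c) -> supdist z w <= c.
Proof.
move=> zw; apply: ge_sup; first by exists `|z y0 - w y0|; exists y0.
by move=> _ [x _ <-].
Qed.

Lemma kuratowski_le y y' x : `|kuratowski y x - kuratowski y' x| <= mdist y y'.
Proof.
rewrite /kuratowski opprB addrA subrK ler_norml; apply/andP.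
have := metric_triangle y y' x; have := metric_triangle y' y x.
by rewrite (metric_sym y' y); lra.
Qed.

Lemma supdist_kuratowski (k : Y -> R) y y' :
  supdist (kuratowski y \+ k) (kuratowski y' \+ k) = mdist y y'.
Proof.
have E x : (kuratowski y \+ k) x - (kuratowski y' \+ k) x =
    kuratowski y x - kuratowski y' x by rewrite /=; lra.
apply/eqP; rewrite eq_le; apply/andP; split.
  by apply: supdist_le => x; rewrite E; exact: kuratowski_le.
have b : at_bounded_distance (kuratowski y \+ k) (kuratowski y' \+ k).
  by exists (mdist y y') => x; rewrite E; exact: kuratowski_le.
apply: le_trans (le_supdist y' b).
by rewrite E /kuratowski mdistxx opprB addrA subrK subr0 ler_norm.
Qed.

Variables (I : topologicalType) (phi : I -> Y -> R) (B : R).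
Hypothesis phiB : forall i x, `|phi i x| <= B.
Hypothesis I_compact : compact [set: I].
Hypothesis I_inhabited : inhabited I.
Hypothesis phi_continuous : forall i e, 0 < e ->
  \forall j \near i, forall x, `|phi i x - phi j x| <= e.

(** Points are functions and not pairs in Y * I, because a function may arise from several pairs;
    only functions carry a genuine metric, and translations act on them. *)
Definition copies := {z : Y -> R | exists y i, z = kuratowski y \+ phi i}.

HB.instance Definition _ := gen_eqMixin copies.
HB.instance Definition _ := gen_choiceMixin copies.

Definition copies_dist (z w : copies) : R := supdist (sval z) (sval w).

Lemma copies_bounded (z w : copies) : at_bounded_distance (sval z) (sval w).
Proof.
have [y [i ->]] := svalP z; have [y' [j ->]] := svalP w.
exists (mdist y y' + (B + B)) => x /=.
have := kuratowski_le y y' x; have := phiB i x; have := phiB j x.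
by rewrite !ler_norml => /andP[? ?] /andP[? ?] /andP[? ?]; apply/andP; split; lra.
Qed.

Lemma copies_distxx z : copies_dist z z = 0.
Proof.
apply/eqP; rewrite eq_le; apply/andP; split.
  by apply: supdist_le => x; rewrite subrr normr0.
exact: le_trans (le_supdist y0 (copies_bounded z z)).
Qed.

Lemma copies_dist_pos z w : copies_dist z w = 0 -> z = w.
Proof.
move=> zw; apply: eq_sig_hprop => /= [*|]; first exact: Prop_irrelevance.
apply/funext => x; apply/eqP; rewrite -subr_eq0 -normr_le0.
by rewrite -zw; exact: (le_supdist x (copies_bounded z w)).
Qed.

Lemma copies_dist_sym z w : copies_dist z w = copies_dist w z.
Proof.
suff H a b : copies_dist a b <= copies_dist b a by apply/eqP; rewrite eq_le !H.
apply: supdist_le => x; rewrite distrC.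
exact: (le_supdist x (copies_bounded b a)).
Qed.

Lemma copies_dist_triangle v z w : copies_dist z w <= copies_dist z v + copies_dist v w.
Proof.
apply: supdist_le => x.
have := le_supdist x (copies_bounded z v); have := le_supdist x (copies_bounded v w).
have := ler_distD (sval v x) (sval z x) (sval w x).
rewrite /copies_dist; lra.
Qed.

HB.instance Definition _ := @isMetric.Build R copies copies_dist
  copies_distxx copies_dist_pos copies_dist_sym copies_dist_triangle.

Definition copy_point (yi : Y * I) : copies :=
  exist _ (kuratowski yi.1 \+ phi yi.2) (ex_intro _ yi.1 (ex_intro _ yi.2 erefl)).

Lemma copies_mdistE (z w : copies) : mdist z w = supdist (sval z) (sval w).
Proof. by []. Qed.

Lemma copy_point_continuous : continuous copy_point.
Proof.
move=> [y i]; apply/metricType_numDomainType.cvgrPdist_le => e e0.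
have e2 : 0 < e / 2 by lra.
have hy : \forall z \near y, mdist y z <= e / 2.
  exact: (metricType_numDomainType.cvgr_dist_le (@cvg_id _ (nbhs y))).
have hi := phi_continuous i e2.
exists ([set z | mdist y z <= e / 2], [set j | forall x, `|phi i x - phi j x| <= e / 2]).
  by split.
move=> [z j] /= [yz ij]; rewrite copies_mdistE; apply: supdist_le => x /=.
have := ij x; have := kuratowski_le y z x.
by rewrite !ler_norml => /andP[? ?] /andP[? ?]; apply/andP; split; lra.
Qed.

(** A translation moves points by at most B, so the ball lies in the continuous image of a closed
    ball of Y, of radius r + 2 * B, times the compact I. *)
Lemma copies_compact (z : copies) (r : R) : compact [set w : copies | mdist z w <= r].
Proof.
have [y [i zE]] := svalP z.
have B0 : 0 <= B by exact: le_trans (phiB i y0).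
pose K := [set yi : Y * I | mdist y yi.1 <= r + (B + B)].
have cK : compact K.
  have -> : K = [set y' : Y | mdist y y' <= r + (B + B)] `*` [set: I].
    by apply/seteqP; split=> [[y' j]|[y' j] []].
  by apply: compact_setX => //; exact: bcm_compact.
apply: (@subclosed_compact _ _ (copy_point @` K)).
- move=> w clw; rewrite /= leNgt; apply/negP => rw.
  have d0 : 0 < mdist z w - r by lra.
  have wn : nbhs w (ball w (mdist z w - r)) by exact: nbhsx_ballx.
  have [v [/= zv]] := clw _ wn; rewrite ballEmdist /= => wv.
  by have := metric_triangle z v w; rewrite (metric_sym v w); lra.
- apply: continuous_compact => //.
  by apply: continuous_subspaceT; exact: copy_point_continuous.
- move=> w /= zw; have [y' [j wE]] := svalP w.
  exists (y', j); last first.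
    by apply: eq_sig_hprop => //= *; exact: Prop_irrelevance.
  rewrite /K /= -(supdist_kuratowski (phi i)).
  apply: supdist_le => x.
  have := le_supdist x (copies_bounded z w); rewrite -copies_mdistE zE wE /=.
  have := phiB i x; have := phiB j x.
  by rewrite !ler_norml => /andP[? ?] /andP[? ?] /andP[? ?]; apply/andP; split; lra.
Qed.

Lemma copies_inhabited : inhabited copies.
Proof. by case: I_inhabited => i; constructor; exact: copy_point (y0, i). Qed.

Definition copies_bcm : bcm R := @Bcm R copies copies_inhabited copies_compact.

Lemma copy_isometric i (y y' : Y) :
  mdist (copy_point (y, i) : copies_bcm) (copy_point (y', i)) = mdist y y'.
Proof. by rewrite copies_mdistE /= supdist_kuratowski. Qed.

Definition copy_emb i : isoemb Y copies_bcm := IsoEmb (copy_isometric i).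

End translated_copies.

Section uniform_convergence.
Variable R : realType.

Lemma isoemb_eq (X Y : bcm R) (f g : isoemb X Y) : (forall x, f x = g x) -> f = g.
Proof.
case: f g => [f fP] [g gP] /= /funext fg; subst g; congr IsoEmb.
exact: Prop_irrelevance.
Qed.

Lemma compact_cvgP (X Y : bcm R) (f : nat -> isoemb X Y) (g : isoemb X Y) :
  {family compact, (fun n => f n : X -> Y) @ \oo --> (g : X -> Y)} <->
  forall K, compact K -> forall e : R, 0 < e ->
    \forall n \near \oo, forall x, K x -> mdist (g x) (f n x) < e.
Proof.
split=> [/fam_cvgP fg K cK e e0|fg].
  have := fg K cK; rewrite restricted_cvgE => h.
  apply: (h [set u | forall x, K x -> mdist (g x) (u x) < e]).
  apply/uniform_nbhs; exists [set yy | ball yy.1 e yy.2]; split.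
    by rewrite -entourage_ballE; exists e.
  by move=> u hu x Kx; have := hu x Kx; rewrite /= ballEmdist.
apply/fam_cvgP => K cK; rewrite restricted_cvgE => P /uniform_nbhs[E [entE EP]].
move: entE; rewrite -entourage_ballE => -[e e0 eE].
apply: filterS (fg K cK e e0) => n fgn; apply: EP => x Kx; apply: eE => /=.
by rewrite ballEmdist /=; exact: fgn.
Qed.

Lemma uniform_compact_cvg (X Y : bcm R) (f : nat -> isoemb X Y) (g : isoemb X Y) :
  (forall e : R, 0 < e -> \forall n \near \oo, forall x, mdist (g x) (f n x) < e) ->
  {family compact, (fun n => f n : X -> Y) @ \oo --> (g : X -> Y)}.
Proof.
by move=> fg; apply/compact_cvgP => K _ e e0; apply: filterS (fg e e0) => n h x _.
Qed.

End uniform_convergence.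

(** * Geometric rates, and Baire's theorem in the Cantor space *)

Section halves.
Variable R : realType.

Definition half_pow (n : nat) : R := 2^-1 ^+ n.

Lemma half_pow_gt0 n : 0 < half_pow n.
Proof. by rewrite exprn_gt0 // invr_gt0. Qed.

Lemma half_powS n : half_pow n.+1 = half_pow n / 2.
Proof. by rewrite /half_pow exprSr. Qed.

Lemma half_pow_cvg (e : R) : 0 < e -> \forall n \near \oo, half_pow n < e.
Proof.
move=> e0; have h : `|2^-1 : R| < 1 by rewrite ger0_norm; lra.
have /cvgrPdist_lt/(_ e e0) : (2^-1 : R) ^+ n @[n --> \oo] --> 0 by exact: cvg_expr.
by apply: filterS => n; rewrite sub0r normrN ger0_norm.
Qed.

Lemma half_pow_le m n : (m <= n)%N -> half_pow n <= half_pow m.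
Proof.
by move=> mn; apply: ler_wiXn2l => //; lra.
Qed.

Lemma half_pow_inv_unbounded t : exists k, t <= (half_pow k)^-1.
Proof.
have s1 : 0 < (`|t| + 1)^-1 by rewrite invr_gt0; have := normr_ge0 t; lra.
have [k _ hk] := half_pow_cvg s1; exists k.
have hk' : half_pow k < (`|t| + 1)^-1 := hk k (leqnn k).
have : `|t| + 1 <= (half_pow k)^-1.
  by rewrite -[leLHS]invrK lef_pV2 ?posrE ?half_pow_gt0 // ltW.
have := ler_norm t; lra.
Qed.

(** L is the supremum of the lower bounds s N - 2 * half_pow N, none of which exceeds any of the
    upper bounds s N + 2 * half_pow N. *)
Lemma summable_limit (s : nat -> R) :
  (forall M N, (N <= M)%N -> `|s M - s N| <= 2 * half_pow N) ->
  exists L, forall N, `|L - s N| <= 2 * half_pow N.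
Proof.
move=> sc; pose A := range (fun N => s N - 2 * half_pow N).
have A0 : A !=set0 by exists (s 0%N - 2 * half_pow 0); exists 0%N.
have up N : ubound A (s N + 2 * half_pow N).
  move=> _ [M _ <-]; have pM := half_pow_gt0 M; have pN := half_pow_gt0 N.
  have [MN|NM] := leqP M N.
    by have := sc _ _ MN; rewrite ler_norml; lra.
  by have := sc _ _ (ltnW NM); rewrite ler_norml; lra.
exists (sup A) => N; rewrite ler_norml; apply/andP; split.
  have : s N - 2 * half_pow N <= sup A.
    by apply: ub_le_sup; [exists (s 0%N + 2 * half_pow 0); exact: up|exists N].
  lra.
have : sup A <= s N + 2 * half_pow N by apply: ge_sup => //; exact: up.
lra.
Qed.

End halves.
Arguments half_pow {R} n.

(** Otherwise every cylinder contains, for each k, a smaller cylinder disjoint from the closed set C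
    k. Nested choices shrink to a point outside all of them. *)
Lemma cantor_baire (C : nat -> (nat -> bool) -> Prop) :
  (forall k p, (forall N, exists2 q, forall n, (n < N)%N -> q n = p n & C k q) ->
     C k p) ->
  (forall p, exists k, C k p) ->
  exists k p N, forall q, (forall n, (n < N)%N -> q n = p n) -> C k q.
Proof.
move=> Cclosed Ccover; apply: contrapT => no.
have step (k : nat) (s : (nat -> bool) * nat) : exists t : (nat -> bool) * nat,
    [/\ (s.2 < t.2)%N, forall n, (n < s.2)%N -> t.1 n = s.1 n &
     forall q, (forall n, (n < t.2)%N -> q n = t.1 n) -> ~ C k q].
  have [q qs nC] : exists2 q, forall n, (n < s.2)%N -> q n = s.1 n & ~ C k q.
    apply: contrapT => h; apply: no; exists k, s.1, s.2 => q qs.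
    by apply: contrapT => nC; apply: h; exists q.
  have [N NC] : exists N, forall r, (forall n, (n < N)%N -> r n = q n) -> ~ C k r.
    apply: contrapT => h; apply/nC/Cclosed => N.
    apply: contrapT => h'; apply: h; exists N => r rq Cr.
    by apply: h'; exists r.
  exists (q, maxn N s.2.+1); split=> //=; first by rewrite leq_max ltnSn orbT.
  by move=> r rq; apply: NC => n nN; apply: rq; rewrite leq_max nN.
have /choice[next nextP] : forall ks : nat * ((nat -> bool) * nat), exists t,
    [/\ (ks.2.2 < t.2)%N, forall n, (n < ks.2.2)%N -> t.1 n = ks.2.1 n &
     forall q, (forall n, (n < t.2)%N -> q n = t.1 n) -> ~ C ks.1 q].
  by move=> [k s]; exact: step.
pose seq := fix seq k := if k is j.+1 then next (j, seq j) else (fun=> false, 0%N).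
have len k : (k <= (seq k).2)%N.
  elim: k => // k IH /=; have [h _ _] := nextP (k, seq k).
  exact: leq_ltn_trans IH h.
have agree j k n : (j <= k)%N -> (n < (seq j).2)%N -> (seq k).1 n = (seq j).1 n.
  move=> jk nj; elim: k jk => [|k IH]; first by rewrite leqn0 => /eqP->.
  rewrite leq_eqVlt => /orP[/eqP<-//|]; rewrite ltnS => jk.
  have [_ h _] := nextP (k, seq k); rewrite /= h /= ?IH //.
  apply: leq_trans nj _; elim: k jk {IH h} => [|k IH].
    by rewrite leqn0 => /eqP->.
  rewrite leq_eqVlt => /orP[/eqP<-//|]; rewrite ltnS => /IH jk.
  by apply: leq_trans jk _; have [/ltnW] := nextP (k, seq k).
(* The prefix of stage n + 1 has length at least n + 1, so coordinate n is settled there. *)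
have [k Ck] := Ccover (fun n => (seq n.+1).1 n).
have [_ _ h] := nextP (k, seq k); apply: h Ck => n.
rewrite -[next _]/(seq k.+1) => nk.
have [nk'|kn] := leqP n.+1 k.+1.
  by apply/esym; apply: agree => //; exact: len.
by apply: agree => //; exact: ltnW.
Qed.

(** * Joint continuity of the action of isometric embeddings *)

Section cantor_translations.
Variables (R : realType) (Y : bcm R) (y0 : Y) (rho : nat -> Y).
Hypothesis rho_near : forall n, mdist y0 (rho n) <= half_pow n.

(** This is the Kuratowski image of [rho n]. As that of y0 is 0, it is also the vector from y0 to
    [rho n]. *)
Definition displacement n (x : Y) : R := mdist (rho n) x - mdist y0 x.

Lemma displacement_le n x : `|displacement n x| <= half_pow n.
Proof.
apply: le_trans (rho_near n); rewrite metric_sym.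
have := kuratowski_le y0 (rho n) y0 x.
by rewrite /kuratowski subrr subr0.
Qed.

Definition shift_sum (p : nat -> bool) (x : Y) N :=
  \sum_(n < N) (p n)%:R * displacement n x.

Lemma shift_sum_cauchy p x M N : (N <= M)%N ->
  `|shift_sum p x M - shift_sum p x N| <= 2 * half_pow N.
Proof.
(* The subtracted term lets the geometric estimate go through by induction on M. *)
move=> NM; suff : `|shift_sum p x M - shift_sum p x N| <=
    2 * half_pow N - 2 * half_pow M by have := half_pow_gt0 R M; lra.
elim: M NM => [|M IH]; first by rewrite leqn0 => /eqP->; rewrite !subrr normr0.
rewrite leq_eqVlt => /predU1P[->|]; first by rewrite !subrr normr0.
rewrite ltnS => /IH {}IH.
have -> : shift_sum p x M.+1 = shift_sum p x M + (p M)%:R * displacement M x.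
  by rewrite /shift_sum big_ord_recr.
have pd : `|(p M)%:R * displacement M x| <= half_pow M.
  by case: (p M); rewrite ?mul1r ?mul0r ?normr0 ?displacement_le // ltW ?half_pow_gt0.
rewrite addrAC; apply: le_trans (ler_normD _ _) _.
by rewrite half_powS; lra.
Qed.

Lemma shift_subproof p x :
  exists L, forall N, `|L - shift_sum p x N| <= 2 * half_pow N.
Proof. by apply: summable_limit => M N; exact: shift_sum_cauchy. Qed.

Definition shift (p : nat -> bool) (x : Y) : R := sval (cid (shift_subproof p x)).

Lemma shiftP p x N : `|shift p x - shift_sum p x N| <= 2 * half_pow N.
Proof. exact: (svalP (cid (shift_subproof p x)) N). Qed.

Lemma eq_shift_sum p q N x : (forall n, (n < N)%N -> q n = p n) ->
  shift_sum q x N = shift_sum p x N.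
Proof. by move=> qp; apply: eq_bigr => i _; rewrite qp. Qed.

Lemma shift_near p q N x : (forall n, (n < N)%N -> q n = p n) ->
  `|shift p x - shift q x| <= 4 * half_pow N.
Proof.
move=> /(eq_shift_sum x) qp; have := shiftP p x N; have := shiftP q x N.
by rewrite qp !ler_norml; lra.
Qed.

Lemma shift_le p x : `|shift p x| <= 2.
Proof.
have := shiftP p x 0; rewrite /shift_sum big_ord0 subr0 /half_pow expr0 mulr1.
exact.
Qed.

(** The coordinate is set to true; the effect on [shift] is computed only where it was false. *)
Definition flip (p : nat -> bool) n k := p k || (k == n).

Lemma shift_flip p n x : p n = false ->
  shift (flip p n) x = shift p x + displacement n x.
Proof.
move=> pn; have H M : (n < M)%N ->
    shift_sum (flip p n) x M = shift_sum p x M + displacement n x.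
  move=> nM; rewrite /shift_sum (bigD1 (Ordinal nM)) //=.
  rewrite [in RHS](bigD1 (Ordinal nM)) //= pn /flip eqxx orbT mul1r mul0r add0r addrC.
  congr (_ + _); apply: eq_bigr => i /negP ni.
  by case: eqP => [E|_]; [case: ni; apply/eqP/val_inj|rewrite orbF].
apply/eqP; rewrite -subr_eq0 -normr_le0; apply/ler_addgt0Pl => e e0.
have [N _ hN] := half_pow_cvg (divr_gt0 e0 (ltr0n R 4) : 0 < e / 4).
pose M := maxn N n.+1.
have hM : half_pow M < e / 4 by apply: hN; rewrite /= leq_maxl.
have := shiftP (flip p n) x M; have := shiftP p x M.
rewrite H ?leq_maxr // !ler_norml; lra.
Qed.

Lemma cantor_prefix (p : cantor_space) N :
  \forall q \near p, forall n, (n < N)%N -> q n = p n.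
Proof.
elim: N => [|N IH]; first by near=> q => n.
have hN : \forall q \near p, q N = p N.
  have := @proj_continuous nat (fun=> bool) N p [set p N].
  by apply; rewrite /= nbhs_principalE; exact/principal_filterP.
near=> q => n; rewrite ltnS leq_eqVlt => /predU1P[->|nN]; first by near: q.
have h : forall n, (n < N)%N -> q n = p n by near: q.
exact: h.
Unshelve. all: by end_near. Qed.

Definition shift1 : cantor_space -> Y -> R := shift.
Definition shift2 (pq : cantor_space * cantor_space) : Y -> R :=
  shift pq.1 \- shift pq.2.

Lemma shift1_le p x : `|shift1 p x| <= 2. Proof. exact: shift_le. Qed.

Lemma shift2_le pq x : `|shift2 pq x| <= 4.
Proof.
have := shift_le pq.1 x; have := shift_le pq.2 x.
by rewrite /shift2 /= !ler_norml; lra.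
Qed.

Lemma shift1_continuous (p : cantor_space) e : 0 < e ->
  \forall q \near p, forall x, `|shift1 p x - shift1 q x| <= e.
Proof.
move=> e0; have [N _ hN] := half_pow_cvg (divr_gt0 e0 (ltr0n R 4) : 0 < e / 4).
have {}hN : half_pow N < e / 4 by exact: (hN N (leqnn N)).
near=> q => x; apply: le_trans (shift_near (N := N) _ _) _; last by lra.
by near: q; exact: cantor_prefix.
Unshelve. all: by end_near. Qed.

Lemma shift2_continuous (pq : cantor_space * cantor_space) e : 0 < e ->
  \forall rs \near pq, forall x, `|shift2 pq x - shift2 rs x| <= e.
Proof.
case: pq => p q e0; have e2 : 0 < e / 2 by lra.
exists ([set r | forall x, `|shift1 p x - shift1 r x| <= e / 2],
        [set r | forall x, `|shift1 q x - shift1 r x| <= e / 2]).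
  by split; exact: shift1_continuous.
move=> [r s] /= [pr qs] x; have := pr x; have := qs x.
by rewrite /shift2 /shift1 /= !ler_norml; lra.
Qed.

Lemma cantor2_compact : compact [set: cantor_space * cantor_space].
Proof. by rewrite -setXTT; apply: compact_setX; exact: cantor_space_compact. Qed.

Definition zeros : cantor_space := fun=> false.

(* Y + P and Y + P - P, for the compact set P of the sums of subfamilies of
   the displacements of rho n from y0. *)
Definition sum_space : bcm R := copies_bcm y0 shift1_le cantor_space_compact
  (inhabits zeros) shift1_continuous.
Definition diff_space : bcm R := copies_bcm y0 shift2_le cantor2_compact
  (inhabits (zeros, zeros)) shift2_continuous.

Definition sum_emb (p : cantor_space) : isoemb Y sum_space :=
  copy_emb y0 shift1_le cantor_space_compact (inhabits zeros) shift1_continuous p.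
Definition diff_emb (p q : cantor_space) : isoemb Y diff_space :=
  copy_emb y0 shift2_le cantor2_compact (inhabits (zeros, zeros))
    shift2_continuous (p, q).

Lemma unshift_subproof (q : cantor_space) (z : sum_space) :
  exists y pq, sval z \- shift q = kuratowski y0 y \+ shift2 pq.
Proof.
have [y [p ->]] := svalP z; exists y, (p, q); apply/funext => x.
by rewrite /shift2 /shift1 /= addrA.
Qed.

(** Translation by - shift q. Writing [diff_emb p q] as this map after [sum_emb p] separates the two
    parameters, so that embedding-continuity applies to each in turn. *)
Definition unshift_point (q : cantor_space) (z : sum_space) : diff_space :=
  exist _ (sval z \- shift q) (unshift_subproof q z).

Lemma unshift_isometric q (z w : sum_space) :
  mdist (unshift_point q z) (unshift_point q w) = mdist z w.
Proof.
rewrite [LHS]copies_mdistE [RHS]copies_mdistE /=; congr sup.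
apply/seteqP; split=> _ [x _ <-]; exists x => //=; congr `| _ |; lra.
Qed.

Definition unshift q : isoemb sum_space diff_space := IsoEmb (unshift_isometric q).

Lemma unshift_sum_emb p q : iso_comp (unshift q) (sum_emb p) = diff_emb p q.
Proof.
apply: isoemb_eq => y; apply: eq_sig_hprop => /= [*|]; first exact: Prop_irrelevance.
by apply/funext => x; rewrite /shift2 /shift1 /= addrA.
Qed.

Lemma diff_emb_eq p q p' q' : (forall x, shift2 (p, q) x = shift2 (p', q') x) ->
  diff_emb p q = diff_emb p' q'.
Proof.
move=> H; apply: isoemb_eq => y; apply: eq_sig_hprop => /= [*|].
  exact: Prop_irrelevance.
by apply/funext => x /=; rewrite H.
Qed.

Lemma diff_emb_diag p : diff_emb p p = diff_emb zeros zeros.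
Proof. by apply: diff_emb_eq => x; rewrite /shift2 /= !subrr. Qed.

(** Both sides translate Y by minus the displacement n. Hence the convergence shown at [zeros] can
    be used at the generic p that Baire's theorem supplies. *)
Lemma diff_emb_flip p n : p n = false ->
  diff_emb p (flip p n) = diff_emb zeros (flip zeros n).
Proof.
move=> pn; apply: diff_emb_eq => x; rewrite /shift2 /= !shift_flip //.
lra.
Qed.

Lemma diff_emb_flip_root n :
  diff_emb zeros (flip zeros n) (rho n) = diff_emb zeros zeros y0.
Proof.
apply: eq_sig_hprop => /= [*|]; first exact: Prop_irrelevance.
apply/funext => x; rewrite /shift2 /= shift_flip // /kuratowski /displacement; lra.
Qed.

Lemma diff_emb_flip_dist n y y' :
  mdist (diff_emb zeros zeros y) (diff_emb zeros (flip zeros n) y') <=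
  mdist y y' + half_pow n.
Proof.
rewrite [leLHS]copies_mdistE; apply: (supdist_le y0) => x /=; rewrite /shift2 /= shift_flip //.
have := kuratowski_le y0 y y' x; have := displacement_le n x.
by rewrite !ler_norml => /andP[? ?] /andP[? ?]; apply/andP; split; lra.
Qed.

Lemma sum_emb_cvg (p : cantor_space) (q : nat -> cantor_space) :
  (forall N n, (n < N)%N -> q N n = p n) ->
  {family compact, (fun N => sum_emb (q N) : Y -> sum_space) @ \oo -->
     (sum_emb p : Y -> sum_space)}.
Proof.
move=> qp; apply: uniform_compact_cvg => e e0.
have e4 : 0 < e / 4 by lra.
near=> N => y; rewrite [ltLHS]copies_mdistE.
apply: (@le_lt_trans _ _ (4 * half_pow N)).
  apply: (supdist_le y0) => x /=.
  have := shift_near x (qp N); rewrite /shift1.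
  by rewrite !ler_norml => /andP[? ?]; apply/andP; split; lra.
have : half_pow N < e / 4 by near: N; exact: half_pow_cvg.
lra.
Unshelve. all: by end_near. Qed.

Lemma unshift_cvg (p : cantor_space) (q : nat -> cantor_space) :
  (forall N n, (n < N)%N -> q N n = p n) ->
  {family compact, (fun N => unshift (q N) : sum_space -> diff_space) @ \oo -->
     (unshift p : sum_space -> diff_space)}.
Proof.
move=> qp; apply: uniform_compact_cvg => e e0.
have e4 : 0 < e / 4 by lra.
near=> N => y; rewrite [ltLHS]copies_mdistE.
apply: (@le_lt_trans _ _ (4 * half_pow N)).
  apply: (supdist_le y0) => x /=.
  have := shift_near x (qp N).
  by rewrite !ler_norml => /andP[? ?]; apply/andP; split; lra.
have : half_pow N < e / 4 by near: N; exact: half_pow_cvg.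
lra.
Unshelve. all: by end_near. Qed.

End cantor_translations.

Section joint_continuity.
Variables (R : realType) (tau : structure R).
Hypothesis tau_cts : embedding_continuous tau.
Variable dd : forall X : bcm R, X -> tau X -> tau X -> R.
Hypothesis dd_rooted : is_space_rooted_metrization dd.

Lemma st_map_comp_app (X Y Z : bcm R) (g : isoemb Y Z) (f : isoemb X Y) a :
  st_map tau (iso_comp g f) a = st_map tau g (st_map tau f a).
Proof. by rewrite (st_map_comp (st_laws tau)). Qed.

Lemma embedding_cvg_dist (X Y : bcm R) (f : nat -> isoemb X Y) (g : isoemb X Y)
    (d : tau Y -> tau Y -> R) a e : metrizes d -> 0 < e ->
  {family compact, (fun n => f n : X -> Y) @ \oo --> (g : X -> Y)} ->
  \forall n \near \oo, d (st_map tau g a) (st_map tau (f n) a) < e.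
Proof. by move=> md e0 /tau_cts/(_ a)/(metrizes_cvg _ _ _ md); apply. Qed.

Section core.
Variables (X Y : bcm R) (f : nat -> isoemb X Y) (g : isoemb X Y) (x0 : X).
Hypothesis fg : {family compact, (fun n => f n : X -> Y) @ \oo --> (g : X -> Y)}.
Hypothesis root_near : forall n, mdist (g x0) (f n x0) <= half_pow n.
Variables (a : nat -> tau X) (a0 : tau X).
Hypothesis a_cvg : a n @[n --> \oo] --> a0.

Let b n := st_map tau (f n) (a n).
Let b0 := st_map tau g a0.
Let ie := sum_emb root_near.
Let je := diff_emb root_near.
Let he := unshift root_near.
Let dZ := dd (je zeros zeros (g x0)).
Let b1 := st_map tau (je zeros zeros) b0.

(* The translations by -v_n send the roots f n x0 to the fixed root, so
   that the metric at this root is an isometry invariant of them. *)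
Lemma flip_cvg e : 0 < e ->
  \forall n \near \oo, dZ b1 (st_map tau (je zeros (flip zeros n)) (b n)) < e.
Proof.
move=> e0; have [ddm ddi] := dd_rooted; have e2 : 0 < e / 2 by lra.
have [[_ _ _ dtri] _] := ddm _ (je zeros zeros (g x0)).
pose t n := iso_comp (je zeros (flip zeros n)) (f n).
have tE n c : st_map tau (je zeros (flip zeros n)) (st_map tau (f n) c) =
  st_map tau (t n) c by rewrite st_map_comp_app.
have root n : t n x0 = je zeros zeros (g x0) by exact: diff_emb_flip_root.
have tcvg : {family compact, (fun n => t n : X -> _) @ \oo -->
    (iso_comp (je zeros zeros) g : X -> _)}.
  apply/compact_cvgP => K cK q q0; have q2 : 0 < q / 2 by lra.
  have /compact_cvgP/(_ K cK _ q2) fgq := fg.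
  near=> n => x Kx.
  apply: (le_lt_trans (diff_emb_flip_dist root_near n (g x) (f n x))).
  have h : forall x, K x -> mdist (g x) (f n x) < q / 2 by near: n.
  have := h x Kx.
  have : half_pow n < q / 2 by near: n; exact: half_pow_cvg.
  lra.
have h1 := embedding_cvg_dist a0 (ddm _ (je zeros zeros (g x0))) e2 tcvg.
have /(metrizes_cvg _ _ _ (ddm X x0))/(_ _ e2) h2 := a_cvg.
near=> n; rewrite /b tE.
apply: le_lt_trans (dtri _ (st_map tau (t n) a0) _) _.
have h3 : dZ (st_map tau (t n) a0) (st_map tau (t n) (a n)) < e / 2.
  by rewrite /dZ (ddi _ _ _ _ _ (root n)); near: n.
have : dZ b1 (st_map tau (t n) a0) < e / 2.
  by rewrite /b1 /b0 -st_map_comp_app; near: n.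
rewrite /dZ in h3 *; lra.
Unshelve. all: by end_near. Qed.

(** Refuting a sequence that stays e-far at every n is enough, as [joint_continuity] extracts such a
    sequence from any failure. *)
Lemma joint_continuity_core (d0 : tau Y -> tau Y -> R) e :
  metrizes d0 -> 0 < e -> ~ (forall n, e <= d0 b0 (b n)).
Proof.
move=> md0 e0 far; have [ddm ddi] := dd_rooted.
have [D mD] := st_metrizable (st_laws tau) (sum_space root_near).
have [[D0 Dxx DC Dtri] Dn] := mD.
have mZ : metrizes dZ by exact: ddm.
have [[Z0 Zxx ZC Ztri] Zn] := mZ.
pose I p := st_map tau (ie p); pose H q := st_map tau (he q).
have HI p n : p n = false ->
    H (flip p n) (I p (b n)) = st_map tau (je zeros (flip zeros n)) (b n).
  move=> pn; rewrite /H /I -st_map_comp_app /he /ie unshift_sum_emb.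
  by rewrite diff_emb_flip.
have HI0 p : H p (I p b0) = b1.
  by rewrite /H /I -st_map_comp_app /he /ie unshift_sum_emb diff_emb_diag.
have Icvg (p : cantor_space) (q : nat -> cantor_space) c r : 0 < r ->
    (forall N n, (n < N)%N -> q N n = p n) ->
    \forall N \near \oo, D (I p c) (I (q N) c) < r.
  by move=> r0 qp; apply: embedding_cvg_dist => //; exact: sum_emb_cvg.
have Hcvg (p : cantor_space) (q : nat -> cantor_space) c r : 0 < r ->
    (forall N n, (n < N)%N -> q N n = p n) ->
    \forall N \near \oo, dZ (H p c) (H (q N) c) < r.
  by move=> r0 qp; apply: embedding_cvg_dist => //; exact: unshift_cvg.
(* By Baire's theorem, E and A hold with the same m and k on a cylinder. On a
   point p of it that vanishes at n, E keeps I p (b n) away from I p b0; but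
   flip p n is in the cylinder and close to p, so that A and flip_cvg bring
   I p (b n) close to I (flip p n) b0, hence to I p b0. *)
pose E (m : nat) p := forall n, half_pow m <= D (I p b0) (I p (b n)).
pose A (m k : nat) q := forall c, (half_pow m / 2 < D (I q b0) c) ->
  half_pow k <= dZ b1 (H q c).
(* Baire's theorem takes a single index, so (m, k) is coded by a number; numbers that code no pair
   give the empty set. *)
pose C (j : nat) p := if @unpickle (nat * nat)%type j is Some mk then
  E mk.1 p /\ A mk.1 mk.2 p else False.
have small r : 0 < r -> exists k : nat, half_pow k <= r :> R.
  move=> r0; have [k _ hk] := half_pow_cvg r0.
  by exists k; apply: ltW; exact: (hk k (leqnn k)).
have Ccover p : exists j, C j p.
  have [r r0 rP] : exists2 r, 0 < r & forall c, D (I p b0) (I p c) < r -> d0 b0 c < e.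
    have [_ h] := embedding_metrizes (st_embedding (st_laws tau) (ie p)) mD.
    by have /h := metrizes_nbhs b0 md0 e0.
  have [m mr] := small r r0.
  have m2 : 0 < half_pow m / 2 :> R by have := half_pow_gt0 R m; lra.
  have [s s0 sP] : exists2 s, 0 < s & forall c, dZ (H p (I p b0)) (H p c) < s ->
      D (I p b0) c < half_pow m / 2.
    have [_ h] := embedding_metrizes (st_embedding (st_laws tau) (he p)) mZ.
    by have /h := metrizes_nbhs (I p b0) mD m2.
  have [k ks] := small s s0.
  exists (pickle (m, k)); rewrite /C pickleK /=; split.
    move=> n; apply: le_trans mr _; rewrite leNgt; apply/negP => /rP.
    by rewrite ltNge far.
  move=> c mc; apply: le_trans ks _; rewrite leNgt; apply/negP => h.
  by have := sP c; rewrite HI0 => /(_ h); lra.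
have Cclosed j p : (forall N, exists2 q, forall n, (n < N)%N -> q n = p n & C j q) ->
    C j p.
  move=> h; have /choice[q qP] : forall N, exists q,
      (forall n, (n < N)%N -> q n = p n) /\ C j q.
    by move=> N; have [q ? ?] := h N; exists q.
  have {}h N n : (n < N)%N -> q N n = p n by move=> nN; exact: (qP N).1.
  have qC N : C j (q N) := (qP N).2.
  rewrite /C in qC *; case E1 : (unpickle j) qC => [[m k]|] qC; last exact: qC 0%N.
  split=> [n|c mc]; apply/ler_addgt0Pl => r r0.
    have r2 : 0 < r / 2 by lra.
    have [M _ hM] := filterI (Icvg p q b0 _ r2 h) (Icvg p q (b n) _ r2 h).
    have [h1 h2] := hM M (leqnn M); have [/(_ n) h3 _] := qC M.
    rewrite /= in h1 h2 h3.
    have := Dtri (I (q M) b0) (I p b0) (I (q M) (b n)).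
    have := Dtri (I p b0) (I p (b n)) (I (q M) (b n)).
    rewrite (DC (I (q M) b0) (I p b0)); lra.
  (* The hypothesis in [A] is strict, so it passes from p to q M for large M. This makes the
     condition closed. *)
  have gap : 0 < D (I p b0) c - half_pow m / 2 by rewrite subr_gt0.
  have [M _ hM] := filterI (Icvg p q b0 _ gap h) (Hcvg p q c _ r0 h).
  have [h1 h2] := hM M (leqnn M); have [_ /(_ c) h3] := qC M.
  rewrite /= in h1 h2 h3.
  have h4 : half_pow m / 2 < D (I (q M) b0) c.
    by have := Dtri (I p b0) (I (q M) b0) c; lra.
  have := h3 h4; have := Ztri b1 (H p c) (H (q M) c); lra.
have [j [p0 [N cyl]]] := cantor_baire Cclosed Ccover.
(* Beyond the prefix p vanishes, so for n >= N setting coordinate n changes p and stays in the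
   cylinder. *)
pose p : cantor_space := fun n => if (n < N)%N then p0 n else false.
have pcyl q : (forall n, (n < N)%N -> q n = p n) -> C j q.
  by move=> qp; apply: cyl => n nN; rewrite qp // /p nN.
rewrite /C in pcyl; case E1 : (unpickle j) pcyl => [[m k]|] pcyl; last first.
  exact: (pcyl p).
have [Ep _] := pcyl p (fun _ _ => erefl); rewrite /= in Ep.
have m2 : 0 < half_pow m / 2 :> R by have := half_pow_gt0 R m; lra.
have k0 : 0 < half_pow k :> R by exact: half_pow_gt0.
have flip_lt n i : (i < n)%N -> flip p n i = p i.
  by move=> ni; rewrite /flip (ltn_eqF ni) orbF.
have [M _ hM] := filterI (flip_cvg k0) (Icvg p (flip p) b0 _ m2 flip_lt).
pose n := maxn M N.
have [h1 h2] := hM n (leq_maxl M N); rewrite /= in h1 h2.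
have pn : p n = false by rewrite /p ltnNge leq_maxr.
have [_ /(_ (I p (b n)))] := pcyl (flip p n)
  (fun i (iN : (i < N)%N) => flip_lt n i (leq_trans iN (leq_maxr M N))).
rewrite /= HI // => h3.
have := Ep n; have := Dtri (I p b0) (I (flip p n) b0) (I p (b n)).
have : D (I (flip p n) b0) (I p (b n)) <= half_pow m / 2.
  rewrite leNgt; apply/negP => /h3; lra.
lra.
Qed.

End core.

(** If this fails, there are indices n_k >= k and points a_k within half_pow k of a0 that violate
    the bound, with roots within half_pow k of their limit. This extraction makes the displacements
    summable. *)
Lemma joint_continuity (X Y : bcm R) (f : nat -> isoemb X Y) (g : isoemb X Y)
    (d : tau Y -> tau Y -> R) a0 e : metrizes d -> 0 < e ->
  {family compact, (fun n => f n : X -> Y) @ \oo --> (g : X -> Y)} ->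
  exists2 A, nbhs a0 A & \forall n \near \oo, forall a, A a ->
    d (st_map tau g a0) (st_map tau (f n) a) < e.
Proof.
move=> md e0 fg; apply: contrapT => no.
have [dX mdX] := st_metrizable (st_laws tau) X.
have [x0] := bcm_nonempty X.
have /compact_cvgP/(_ [set x0] (@compact_set1 _ x0)) fgx := fg.
have /choice[na naP] : forall k, exists na : nat * tau X,
    [/\ (k <= na.1)%N, mdist (g x0) (f na.1 x0) <= half_pow k,
        dX a0 na.2 < half_pow k & e <= d (st_map tau g a0) (st_map tau (f na.1) na.2)].
  move=> k; have [N _ hN] := fgx _ (half_pow_gt0 R k).
  apply: contrapT => h; apply: no; exists [set a | dX a0 a < half_pow k].
    by apply: metrizes_nbhs => //; exact: half_pow_gt0.
  exists (maxn k N) => // n kNn a ak.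
  have /andP[kn Nn] : ((k <= n) && (N <= n))%N by rewrite -geq_max.
  rewrite ltNge; apply/negP => far; apply: h; exists (n, a); split => //.
  by apply: ltW; apply: hN.
have fna : {family compact, (fun k => f (na k).1 : X -> Y) @ \oo --> (g : X -> Y)}.
  apply/compact_cvgP => K cK q q0.
  have /compact_cvgP/(_ K cK q q0)[N _ hN] := fg.
  exists N => // k /= Nk; apply: hN => /=; apply: leq_trans Nk _.
  by have [] := naP k.
have root k : mdist (g x0) (f (na k).1 x0) <= half_pow k by have [] := naP k.
have acvg : (na k).2 @[k --> \oo] --> a0.
  apply/(metrizes_cvg _ _ _ mdX) => q q0.
  apply: filterS (half_pow_cvg q0) => k; apply: lt_trans.
  by have [] := naP k.
apply: (joint_continuity_core fna root acvg md e0) => k.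
by have [] := naP k.
Qed.

End joint_continuity.

(** * Continuity of the structure of cadlag functions *)

Section cadlag_constructions.
Variables (R : realType) (T : \bar R).
Hypothesis T_ge0 : (0 <= T)%E.

Lemma clampr_bounds x s : 0 < x -> s < x ->
  0 <= clampr T s /\ clampr T s < x.
Proof.
move=> x0 sx; have [h1 _] := clampr_horizon T_ge0 s; split=> //.
apply: le_lt_trans (clampr_le T_ge0 s) _.
by case: (leP 0 s).
Qed.

Lemma jd_le_id (S : topologicalType) (d : S -> S -> R) (F G : cadlag_fun T S) e :
  0 < e -> (forall s, 0 <= s -> s < e^-1 + 1 ->
    d (ext T_ge0 F (clampr T s)) (ext T_ge0 G (clampr T s)) <= e) ->
  jd T_ge0 d F G <= e.
Proof.
move=> e0 FG; apply: jdist_le => //; exists id; first exact: tchange_id (ltW e0).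
have ei : 0 < e^-1 by rewrite invr_gt0.
move=> s win; have {win}se : s <= e^-1 by case: win.
have [s0|s0] := leP 0 s.
  by rewrite -(ext_clampr T_ge0 F s) -(ext_clampr T_ge0 G s); apply: FG => //; lra.
rewrite (ext_neg T_ge0 F (ltW s0)) (ext_neg T_ge0 G (ltW s0)).
by rewrite -(ext_clampr T_ge0 F 0) -(ext_clampr T_ge0 G 0); apply: FG => //; lra.
Qed.

(** The range of h need not be closed, so the left limits must be assumed to lie in it along with
    the values. *)
Lemma cadlag_lift (S S' : topologicalType) (h : S -> S') (F : cadlag_fun T S') :
  topological_embedding h -> (forall t, range h (ext T_ge0 F t)) ->
  (forall t l, left_limit (ext T_ge0 F) t l -> range h l) ->
  exists G : cadlag_fun T S, forall t, h (G t) = F t.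
Proof.
move=> eh Fh lh; have /choice[g gE] : forall t, exists x, h x = F t.
  by move=> t; have [x _ xE] := Fh (\val t); exists x; rewrite xE ext_val.
have hg x : h (ext T_ge0 g x) = ext T_ge0 F x by exact: gE.
have cg : cadlag_line (ext T_ge0 g).
  move=> t; have [Ft [l Fl]] := cadlag_fun_ext T_ge0 F t; split.
    move=> A /(embedding_lift eh)[B]; rewrite hg => /Ft[r r0 rB] BA.
    by exists r => // s ts st; apply: BA; rewrite hg; apply: rB.
  have [l' _ l'E] := lh t l Fl; exists l' => A /(embedding_lift eh)[B].
  rewrite l'E => /Fl[r r0 rB] BA.
  by exists r => // s ts st; apply: BA; rewrite hg; apply: rB.
exists (cadlag_restrict T cg) => t.
by rewrite /= /restr hg ext_val.
Qed.

Lemma cadlag_cst (S : topologicalType) (x : S) : cadlag_line (fun _ : R => x).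
Proof.
move=> t; split; first by move=> A /nbhs_singleton; exists 1.
by exists x => A /nbhs_singleton; exists 1.
Qed.

Lemma cadlag_paste (S : topologicalType) (f g : R -> S) y :
  cadlag_line f -> cadlag_line g ->
  cadlag_line (fun s => if s < y then f s else g s).
Proof.
move=> cf cg t; have [ft [lf fl]] := cf t; have [gt [lg gl]] := cg t; split.
  rewrite /right_cts; have [ty A|yt A] := ltP t y.
    move=> /ft[r r0 rA]; exists (Num.min r (y - t)).
      by rewrite lt_min r0 subr_gt0.
    have [h1 h2] : Num.min r (y - t) <= r /\ Num.min r (y - t) <= y - t.
      by rewrite !ge_min !lexx orbT.
    by move=> s ts st; rewrite ifT; [apply: rA => //; lra|lra].
  move=> /gt[r r0 rA]; exists r => // s ts st.
  by rewrite ltNge (le_trans yt ts) /=; exact: rA.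
have [ty|yt] := leP t y.
  exists lf => A /fl[r r0 rA]; exists r => // s ts st.
  by rewrite ifT; [exact: rA|exact: lt_le_trans ty].
exists lg => A /gl[r r0 rA]; exists (Num.min r (t - y)).
  by rewrite lt_min r0 subr_gt0.
have [h1 h2] : Num.min r (t - y) <= r /\ Num.min r (t - y) <= t - y.
  by rewrite !ge_min !lexx orbT.
by move=> s ts st; rewrite ltNge ifF; [apply: rA => //; lra|apply/negbF; lra].
Qed.

End cadlag_constructions.

Section continuous_structures.
Variables (R : realType) (T : \bar R).
Hypothesis T_ge0 : (0 <= T)%E.
Variable tau : structure R.
Local Notation D := (tau_D T tau).
Local Notation ext := (ext T_ge0).

(** Joint continuity at x0 makes the convergence uniform over a piece of F that stays near x0, and
    [cadlag_induction] assembles finitely many pieces. *)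
Lemma tau_D_embedding_continuous (dd : forall X : bcm R, X -> tau X -> tau X -> R) :
  embedding_continuous tau -> is_space_rooted_metrization dd ->
  embedding_continuous D.
Proof.
move=> tc ddr X Y f g fg F.
have [d md] := st_metrizable (st_laws tau) Y.
have [[d0 dxx dC dtri] dn] := md.
apply/(metrizes_cvg _ _ _ (metrizes_jd T_ge0 md)) => e e0.
have e2 : 0 < e / 2 by lra.
have e4 : 0 < e / 4 by lra.
suff H : forall x, \forall n \near \oo, forall s, 0 <= s -> s < x ->
    d (st_map tau g (ext F s)) (st_map tau (f n) (ext F s)) <= e / 2.
  have i0 : 0 < (e / 2)^-1 by rewrite invr_gt0.
  apply: filterS (H ((e / 2)^-1 + 1)) => n hn.
  apply: (@le_lt_trans _ _ (e / 2)); last by lra.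
  apply: jd_le_id => // s s0 sx.
  have [|h1 h2] := @clampr_bounds _ T T_ge0 ((e / 2)^-1 + 1) s _ sx; first by lra.
  exact: hn.
apply: (cadlag_induction (cadlag_fun_ext T_ge0 F)) => [x x0|x0].
  by near=> n => s s0 sx; lra.
have [A x0A hA] := joint_continuity tc ddr x0 md e4 fg.
have gc : nbhs x0 [set a | d (st_map tau g x0) (st_map tau g a) < e / 4].
  exact: (@st_map_continuous _ tau _ _ g x0 _ (metrizes_nbhs _ md e4)).
exists (A `&` [set a | d (st_map tau g x0) (st_map tau g a) < e / 4]).
  exact: filterI.
move=> y y' y0 yy' fA Py; near=> n => s s0 sy'.
have h1 : forall s, 0 <= s -> s < y ->
  d (st_map tau g (ext F s)) (st_map tau (f n) (ext F s)) <= e / 2 by near: n.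
have h2 : forall a, A a -> d (st_map tau g x0) (st_map tau (f n) a) < e / 4.
  by near: n.
have [sy|ys] := ltP s y; first exact: h1.
have [As /= gs] := fA s ys sy'.
have := h2 _ As; have := dtri (st_map tau g (ext F s)) (st_map tau g x0)
  (st_map tau (f n) (ext F s)).
rewrite (dC (st_map tau g (ext F s)) (st_map tau g x0)); lra.
Unshelve. all: by end_near. Qed.

(** A constant sequence of spaces shows that the image of an embedding is closed. *)
Lemma upper_semicontinuous_closed (X Y : bcm R) (iota : isoemb X Y)
    (c : nat -> tau X) (b : tau Y) : upper_semicontinuous tau ->
  st_map tau iota (c n) @[n --> \oo] --> b -> range (st_map tau iota) b.
Proof.
move=> usc; apply: (usc (fun=> X) X Y (fun=> iota) iota).
exact: cvg_cst.
Qed.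

Lemma tau_D_upper_semicontinuous :
  upper_semicontinuous tau -> upper_semicontinuous D.
Proof.
move=> usc X Xinf Y iota iotainf Xcvg a b ab.
have [d md] := st_metrizable (st_laws tau) Y.
have [[d0 dxx dC dtri] dn] := md.
have mj := metrizes_jd T_ge0 md.
have {ab}ab := (metrizes_cvg _ _ _ mj).1 ab.
have bX t : range (st_map tau iotainf) (ext b t).
  (* The term [half_pow n] makes e n strictly larger than the distance, so that a time change with
     constant e n exists. *)
  pose e n := jd T_ge0 d b (st_map D (iota n) (a n)) + half_pow n.
  have e0 n : 0 < e n.
    by have := jdist_ge0 T d (ext b) (ext (st_map D (iota n) (a n)));
      have := half_pow_gt0 R n; rewrite /e /jd; lra.
  have cex : forall n, exists c : tau (X n), e n <= 2^-1 ->
      t <= (e n)^-1 -> d (ext b t) (st_map tau (iota n) c) <= e n.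
    move=> n; have [e2|e2] := leP (e n) 2^-1; last by exists (ext (a n) t).
    have [l tl bl] : jnear T d (e n) (ext b) (ext (st_map D (iota n) (a n))).
      apply: jdist_lt => //; rewrite -/(jd T_ge0 d b _) /e.
      by have := half_pow_gt0 R n; lra.
    by exists (ext (a n) (l t)) => _ te; apply: (bl t); left.
  pose c n := sval (cid (cex n)).
  have cP n : e n <= 2^-1 -> t <= (e n)^-1 ->
    d (ext b t) (st_map tau (iota n) (c n)) <= e n := svalP (cid (cex n)).
  apply: (usc X Xinf Y iota iotainf Xcvg c).
  apply/(metrizes_cvg _ _ _ md) => r r0.
  pose q := Num.min (r / 2) (Num.min 2^-1 (`|t| + 1)^-1).
  have t1 : 0 < (`|t| + 1)^-1 by rewrite invr_gt0; have := normr_ge0 t; lra.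
  have q0 : 0 < q by rewrite !lt_min t1 andbT; apply/andP; split; lra.
  have [q1 q2 q3] : [/\ q <= r / 2, q <= 2^-1 & q <= (`|t| + 1)^-1].
    by split; rewrite !ge_min lexx ?orbT.
  have qq : 0 < q / 2 by lra.
  near=> n.
  have h1 : jd T_ge0 d b (st_map D (iota n) (a n)) < q / 2.
    by near: n; exact: ab.
  have h2 : half_pow n < q / 2 by near: n; exact: half_pow_cvg.
  have en : e n <= q by rewrite /e; lra.
  apply: (@le_lt_trans _ _ (e n)); last by lra.
  apply: cP; first by lra.
  have : (`|t| + 1) <= (e n)^-1.
    rewrite -[leLHS]invrK lef_pV2 ?posrE //; lra.
  have := ler_norm t; lra.
have bl t l : left_limit (ext b) t l -> range (st_map tau iotainf) l.
  move=> tl; have /choice[c cP] : forall n, exists c,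
      d l (st_map tau iotainf c) < half_pow n.
    move=> n; have [r r0 rl] := tl _ (metrizes_nbhs l md (half_pow_gt0 R n)).
    have [c _ cE] := bX (t - r / 2); exists c; rewrite cE.
    by apply: (rl (t - r / 2)); lra.
  apply: (@upper_semicontinuous_closed _ _ _ c) => //.
  apply/(metrizes_cvg _ _ _ md) => r r0.
  by apply: filterS (half_pow_cvg r0) => n; apply: lt_trans.
have [G GE] := cadlag_lift (st_embedding (st_laws tau) iotainf) bX bl.
by exists G => //; apply: cadlag_fun_eq; apply/funext => t; exact: GE.
Unshelve. all: by end_near. Qed.

Lemma strictly_increasing_choice (Q : nat -> nat -> Prop) :
  (forall k, \forall n \near \oo, Q k n) ->
  exists phi : nat -> nat, {homo phi : m n / (m < n)%N} /\ forall k, Q k (phi k).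
Proof.
move=> H; have /choice[N NQ] : forall k, exists N, forall n, (N <= n)%N -> Q k n.
  by move=> k; have [N _ hN] := H k; exists N => n; exact: hN.
pose phi := fix phi k := if k is j.+1 then maxn (phi j).+1 (N k) else N 0%N.
exists phi; split; last first.
  by case=> [|k]; apply: NQ => //=; exact: leq_maxr.
by apply: homo_ltn => [|k]; [exact: ltn_trans|rewrite /= leq_maxl].
Qed.

(** The definition yields approximations along a subsequence only. Applied to the indices that admit
    none, it shows that they are not infinitely many. A path needs this, as several of its values
    are approximated at the same n. *)
Lemma lower_semicontinuous_near (X : nat -> bcm R) (Xinf Y : bcm R)
    (iota : forall n, isoemb (X n) Y) (iotainf : isoemb Xinf Y)
    (d : tau Y -> tau Y -> R) a e : Defs.lower_semicontinuous tau ->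
  iso_image (iota n) @[n --> \oo] --> iso_image iotainf ->
  metrizes d -> 0 < e ->
  \forall n \near \oo, exists c : tau (X n),
    d (st_map tau iotainf a) (st_map tau (iota n) c) < e.
Proof.
move=> lsc Xcvg md e0; apply: contrapT => no.
have /choice[phi phiP] : forall k, exists n, (k <= n)%N /\ ~ (exists c : tau (X n),
    d (st_map tau iotainf a) (st_map tau (iota n) c) < e).
  move=> k; apply: contrapT => h; apply: no; exists k => // n kn.
  by apply: contrapT => nc; apply: h; exists n.
have phi_oo : phi k @[k --> \oo] --> \oo.
  move=> A [N _ NA]; exists N => // k /= Nk; apply: NA => /=.
  by apply: leq_trans Nk _; have [] := phiP k.
have [psi [b [_ bcvg]]] := lsc (fun k => X (phi k)) Xinf Y (fun k => iota (phi k))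
  iotainf (cvg_comp _ _ phi_oo Xcvg) a.
have [k _ hk] := (metrizes_cvg _ _ _ md).1 bcvg e e0.
have [_] := phiP (psi k); apply; exists (b k).
exact: (hk k (leqnn k)).
Qed.

(** The approximating paths are built piece by piece: where F stays near x0, a constant path at an
    approximation of x0 is pasted on. *)
Lemma tau_D_lower_semicontinuous :
  Defs.lower_semicontinuous tau -> Defs.lower_semicontinuous D.
Proof.
move=> lsc X Xinf Y iota iotainf Xcvg F.
have [d md] := st_metrizable (st_laws tau) Y.
have [[d0 dxx dC dtri] dn] := md.
have mj := metrizes_jd T_ge0 md.
suff H : forall k, \forall n \near \oo, exists G : D (X n),
    jd T_ge0 d (st_map D iotainf F) (st_map D (iota n) G) <= half_pow k.
  have [phi [phi_mono phiP]] := strictly_increasing_choice H.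
  exists phi, (fun k => sval (cid (phiP k))); split=> //.
  apply/(metrizes_cvg _ _ _ mj) => e e0.
  apply: filterS (half_pow_cvg e0) => k; apply: le_lt_trans.
  exact: (svalP (cid (phiP k))).
move=> k; have e0 := half_pow_gt0 R k; set e := half_pow k in e0 *.
have e2 : 0 < e / 2 by lra.
have main : forall x, \forall n \near \oo, exists2 g : R -> tau (X n), cadlag_line g &
    forall s, 0 <= s -> s < x ->
      d (st_map tau iotainf (ext F s)) (st_map tau (iota n) (g s)) <= e.
  apply: (cadlag_induction (cadlag_fun_ext T_ge0 F)) => [x x0|x0].
    have := lower_semicontinuous_near (ext F 0) lsc Xcvg md e0.
    apply: filterS => n [c _]; exists (fun=> c); first exact: cadlag_cst.
    by move=> s s0 sx; lra.
  exists [set x | d (st_map tau iotainf x0) (st_map tau iotainf x) < e / 2].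
    exact: (@st_map_continuous _ tau _ _ iotainf x0 _ (metrizes_nbhs _ md e2)).
  move=> y y' y0 yy' fA Py.
  near=> n.
  have [c hc] : exists c : tau (X n),
      d (st_map tau iotainf x0) (st_map tau (iota n) c) < e / 2.
    by near: n; exact: lower_semicontinuous_near.
  have [g cg hg] : exists2 g : R -> tau (X n), cadlag_line g &
    forall s, 0 <= s -> s < y ->
      d (st_map tau iotainf (ext F s)) (st_map tau (iota n) (g s)) <= e.
    by near: n.
  exists (fun s => if s < y then g s else c).
    by apply: cadlag_paste => //; exact: cadlag_cst.
  move=> s s0 sy'; have [sy|ys] := ltP s y; first exact: hg.
  have /= := fA s ys sy'; have := dtri (st_map tau iotainf (ext F s))
    (st_map tau iotainf x0) (st_map tau (iota n) c).
  rewrite (dC (st_map tau iotainf (ext F s)) (st_map tau iotainf x0)); lra.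
apply: filterS (main (e^-1 + 1)) => n [g cg hg].
exists (cadlag_restrict T cg); apply: jd_le_id => // s s0 sx.
have i0 : 0 < e^-1 by rewrite invr_gt0.
have [|h1 h2] := @clampr_bounds _ T T_ge0 (e^-1 + 1) s _ sx; first by lra.
have E : ext (cadlag_restrict T cg) (clampr T s) = g (clampr T s).
  by rewrite ext_restr clampr_id //; exact: clampr_horizon.
suff : d (st_map tau iotainf (ext F (clampr T s)))
  (st_map tau (iota n) (ext (cadlag_restrict T cg) (clampr T s))) <= e by [].
by rewrite E; exact: hg.
Unshelve. all: by end_near. Qed.

End continuous_structures.

(** * Completeness *)

Section uniform_limits.
Variables (R : realType) (S : topologicalType) (d : S -> S -> R).
Hypotheses (md : metrizes d) (dcomplete : complete_metric d).

Lemma cadlag_tchange (T : \bar R) e l (f : R -> S) : tchange T e l -> cadlag_line f ->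
  cadlag_line (f \o l).
Proof.
move=> tl cf t; have [m [tm lm ml]] := tchange_inv tl; have [l1 _ _] := tl.
have ep := expR_gt0 e.
have [ft [y fy]] := cf (l t); split.
  move=> A /ft[r r0 rA]; exists (r / expR e); first by rewrite divr_gt0.
  move=> s ts st; apply: rA; first by rewrite (tchange_le_mono _ _ tl).
  have := l1 _ _ ts; have : s - t < r / expR e by lra.
  by rewrite ltr_pdivlMr // mulrC; lra.
exists y => A /fy[r r0 rA]; exists (r / expR e); first by rewrite divr_gt0.
move=> s ts st; apply: rA; last by rewrite (tchange_lt_mono _ _ tl).
have := l1 _ _ (ltW st); have : t - s < r / expR e by lra.
by rewrite ltr_pdivlMr // mulrC; lra.
Qed.

(** Right-continuity is the usual three-term estimate. Left limits require completeness: the values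
    at t - half_pow n form a Cauchy sequence. *)
Lemma cadlag_uniform_limit (f : R -> S) :
  (forall x e, 0 < e -> exists2 g, cadlag_line g &
     forall s, s < x -> d (g s) (f s) <= e) -> cadlag_line f.
Proof.
have [[d0 dxx dC dtri] dn] := md.
move=> fg t; split.
  move=> A /dn[e e0 eA]; have e3 : 0 < e / 3 by lra.
  have [g cg gf] := fg (t + 1) _ e3.
  have [r r0 rg] := (cg t).1 _ (metrizes_nbhs (g t) md e3).
  exists (Num.min r 1); first by rewrite lt_min r0 ltr01.
  have [h1 h2] : Num.min r 1 <= r /\ Num.min r 1 <= 1 by rewrite !ge_min !lexx orbT.
  move=> s ts st; apply: eA => /=.
  have /= gts : d (g t) (g s) < e / 3 by apply: rg => //; lra.
  have g1 : d (g t) (f t) <= e / 3 by apply: gf; lra.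
  have g2 : d (g s) (f s) <= e / 3 by apply: gf; lra.
  have := dtri (f t) (g t) (f s); have := dtri (g t) (g s) (f s).
  rewrite (dC (f t) (g t)); lra.
have osc e : 0 < e -> exists2 r, 0 < r & forall s s', t - r < s -> s < t ->
    t - r < s' -> s' < t -> d (f s) (f s') < e.
  move=> e0; have e4 : 0 < e / 5 by lra.
  have [g cg gf] := fg t _ e4; have [l gl] := (cg t).2.
  have [r r0 rg] := gl _ (metrizes_nbhs l md e4).
  exists r => // s s' s1 s2 s'1 s'2.
  have /= h1 : d l (g s) < e / 5 by exact: rg.
  have /= h2 : d l (g s') < e / 5 by exact: rg.
  have g1 := gf s s2; have g2 := gf s' s'2.
  have := dtri (f s) (g s) (f s'); have := dtri (g s) (g s') (f s').
  have := dtri (g s) l (g s'); rewrite (dC (f s) (g s)) (dC (g s) l); lra.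
have [|l lP] := dcomplete (u := fun n => f (t - half_pow n)).
  move=> e e0; have [r r0 rf] := osc e e0.
  have [N _ hN] := half_pow_cvg r0; exists N => m n Nm Nn.
  have h1 : half_pow m < r := hN m Nm; have h2 : half_pow n < r := hN n Nn.
  have := half_pow_gt0 R m; have := half_pow_gt0 R n.
  by move=> *; apply: rf; lra.
exists l => A /dn[e e0 eA]; have e2 : 0 < e / 2 by lra.
have [r r0 rf] := osc _ e2.
have [N _ hN] := filterI (half_pow_cvg r0) (lP _ e2).
have [/= h1 h2] := hN N (leqnn N); have p := half_pow_gt0 R N.
exists r => // s s1 s2; apply: eA => /=.
have h3 : d (f s) (f (t - half_pow N)) < e / 2 by apply: rf; lra.
have := dtri l (f (t - half_pow N)) (f s).
by rewrite (dC l (f (t - half_pow N))) (dC (f (t - half_pow N)) (f s)); lra.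
Qed.

End uniform_limits.

Lemma geometric_cvg (R : realType) (a : nat -> R) (c : R) : 0 <= c ->
  (forall i, `|a i.+1 - a i| <= c * half_pow i) ->
  exists L : R, a i @[i --> \oo] --> L.
Proof.
move=> c0 ac; pose b i := a i / (c + 1).
have c1 : 0 < c + 1 by lra.
have [|L LP] := @summable_limit R b.
  move=> M N NM; suff : `|b M - b N| <= 2 * half_pow N - 2 * half_pow M.
    by have := half_pow_gt0 R M; lra.
  elim: M NM => [|M IH]; first by rewrite leqn0 => /eqP->; rewrite !subrr normr0.
  rewrite leq_eqVlt => /predU1P[->|]; first by rewrite !subrr normr0.
  rewrite ltnS => /IH {}IH.
  have step : `|b M.+1 - b M| <= half_pow M.
    rewrite /b -mulrBl normrM normfV (gtr0_norm c1) ler_pdivrMr //.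
    apply: le_trans (ac M) _; rewrite mulrC ler_pM2l ?half_pow_gt0 //; lra.
  have := ler_normD (b M.+1 - b M) (b M - b N).
  by rewrite addrA subrK half_powS; lra.
exists (L * (c + 1)); apply/cvgrPdist_lt => e e0.
have q0 : 0 < e / (c + 1) / 2 by rewrite !divr_gt0.
apply: filterS (half_pow_cvg q0) => n hn.
have -> : a n = b n * (c + 1) by rewrite /b divfK // gt_eqF.
rewrite -mulrBl normrM (gtr0_norm c1) -ltr_pdivlMr //.
by apply: le_lt_trans (LP n) _; lra.
Qed.

Section completeness.
Variables (R : realType) (T : \bar R).
Hypothesis T_ge0 : (0 <= T)%E.
Variables (S : topologicalType) (d : S -> S -> R).
Hypotheses (md : metrizes d) (dcomplete : complete_metric d).
Local Notation ext := (ext T_ge0).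

Section rapid_sequence.
Variables (f : nat -> cadlag_fun T S) (l : nat -> R -> R).
Hypothesis tl : forall k, tchange T (half_pow k.+2) (l k).
Hypothesis fl : forall k s, s <= (half_pow k.+2)^-1 ->
  d (ext (f k) s) (ext (f k.+1) (l k s)) <= half_pow k.+2.

(** This carries times of f k to times of f (k + i). Everything below is followed in the time of f
    0. *)
Fixpoint chain k i : R -> R := if i is j.+1 then l (k + j) \o chain k j else id.

(** The constants half_pow (j + 2), for j from k to k + i - 1, telescope. *)
Lemma chain_tchange k i : tchange T (half_pow k.+1 - half_pow (k + i).+1) (chain k i).
Proof.
elim: i => [|i IH]; first by rewrite addn0 subrr; exact: tchange_id.
apply: tchange_le (tchange_comp IH (tl (k + i))).
by rewrite addnS (half_powS R (k + i).+1); lra.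
Qed.

Lemma chain_tchange1 k i : tchange T (half_pow k.+1) (chain k i).
Proof.
by apply: tchange_le (chain_tchange k i); have := half_pow_gt0 R (k + i).+1; lra.
Qed.

Lemma half_pow1 : half_pow 1 = 2^-1 :> R. Proof. by rewrite /half_pow expr1. Qed.

Lemma half_pow_le_half k : half_pow k.+1 <= 2^-1 :> R.
Proof. by rewrite -half_pow1; exact: half_pow_le. Qed.

Lemma tchange_half_le e m x : tchange T e m -> 0 <= e -> e <= 2^-1 -> 0 <= x ->
  m x <= 2 * x /\ x <= 2 * m x.
Proof.
move=> tm e0 e2 x0; have [h0 h1 h2] := tchange_pos tm x0.
have := expR_le_1D2 e0 e2; nra.
Qed.

Lemma chain_cat k i s : chain 0 (k + i) s = chain k i (chain 0 k s).
Proof. by elim: i => [|i IH]; rewrite ?addn0 // addnS /= IH. Qed.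

Lemma chain_cvg s : exists L : R, chain 0 i s @[i --> \oo] --> L.
Proof.
have [s0|s0] := leP s 0.
  exists s; have E i : chain 0 i s = s.
    by have [_ _ ->] := chain_tchange1 0 i => //; left.
  by under eq_fun do rewrite E; exact: cvg_cst.
apply: (@geometric_cvg _ _ s (ltW s0)) => i /=; rewrite add0n.
have [|||h1 h2] := tchange_half_le (chain_tchange1 0 i) (x := s).
- exact: ltW (half_pow_gt0 _ _).
- exact: half_pow_le_half.
- exact: ltW.
have c0 : 0 <= chain 0 i s by have [] := tchange_pos (chain_tchange1 0 i) (ltW s0).
apply: le_trans (tchange_dist (tl i) _ _ c0) _.
- exact: ltW (half_pow_gt0 _ _).
- exact: half_pow_le_half.
by rewrite !half_powS; have := half_pow_gt0 R i; nra.
Qed.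

Definition limit_change s := sval (cid (chain_cvg s)).

Lemma limit_changeP s : chain 0 i s @[i --> \oo] --> limit_change s.
Proof. exact: svalP (cid (chain_cvg s)). Qed.

Lemma limit_change_tchange : tchange T 2^-1 limit_change.
Proof.
apply: (@tchange_lim _ _ _ (chain 0)); last exact: limit_changeP.
by near=> n; rewrite -half_pow1; exact: chain_tchange1.
Unshelve. all: by end_near. Qed.

(** This change from the time of f k to that of the limit is the limit of [chain k i], whose
    constants are at most half_pow k.+1 for all i. *)
Lemma rest_tchange k m : cancel m (chain 0 k) -> tchange T (half_pow k.+1) (limit_change \o m).
Proof.
move=> mK; apply: (@tchange_lim _ _ _ (chain k)).
  by near=> n; exact: chain_tchange1.
move=> x; have h := @limit_changeP (m x).
have E i : chain k i x = chain 0 (i + k) (m x) by rewrite addnC chain_cat mK.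
under eq_fun do rewrite E.
by move: h; rewrite -(cvg_shiftn k).
Unshelve. all: by end_near. Qed.

(** From step k on, the orbit of s stays where [fl] compares consecutive paths. *)
Definition window k s := forall j, (k <= j)%N -> chain 0 j s <= (half_pow j.+2)^-1.

Lemma window_intro k s : s <= (half_pow k)^-1 -> window k s.
Proof.
move=> sk j kj; have [s0|s0] := leP s 0.
  have [_ _ ->] := chain_tchange1 0 j; last by left.
  by apply: (le_trans s0); rewrite invr_ge0 ltW // half_pow_gt0.
have [|||h1 h2] := tchange_half_le (chain_tchange1 0 j) (x := s).
- exact: ltW (half_pow_gt0 _ _).
- exact: half_pow_le_half.
- exact: ltW.
apply: le_trans h1 _; rewrite !half_powS !invfM !invrK.
have : (half_pow k)^-1 <= (half_pow j)^-1 :> R.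
  by rewrite lef_pV2 ?posrE ?half_pow_gt0 //; exact: half_pow_le.
have : 0 <= (half_pow j)^-1 :> R by rewrite invr_ge0 ltW // half_pow_gt0.
lra.
Qed.

Lemma window_exists s : exists k, window k s.
Proof.
by have [k sk] := half_pow_inv_unbounded s; exists k; exact: window_intro.
Qed.

Lemma chain_values k j s : window k s -> (k <= j)%N ->
  d (ext (f k) (chain 0 k s)) (ext (f j) (chain 0 j s)) <= half_pow k.+1 - half_pow j.+1.
Proof.
have [[d0 dxx dC dtri] dn] := md => w.
elim: j => [|j IH]; first by rewrite leqn0 => /eqP->; rewrite subrr (dxx _ _).2.
rewrite leq_eqVlt => /predU1P[->|]; first by rewrite subrr (dxx _ _).2.
rewrite ltnS => kj; have := IH kj; have := fl (w j kj); rewrite /= add0n.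
have := dtri (ext (f k) (chain 0 k s)) (ext (f j) (chain 0 j s))
  (ext (f j.+1) (l j (chain 0 j s))).
rewrite (half_powS R j.+1); lra.
Qed.

Lemma limit_value_ex s : exists y, forall k, window k s ->
  d (ext (f k) (chain 0 k s)) y <= half_pow k.+1.
Proof.
have [[d0 dxx dC dtri] dn] := md; have [K wK] := window_exists s.
have [|y yP] := dcomplete (u := fun k => ext (f k) (chain 0 k s)).
  move=> e e0; have e2 : 0 < e / 2 by lra.
  have [N _ hN] := half_pow_cvg e2; pose M := maxn K N.
  have wM : window M s by move=> j Mj; apply: wK; apply: leq_trans Mj; exact: leq_maxl.
  have hM : half_pow M < e / 2 by apply: (hN M); exact: leq_maxr.
  exists M => m n Mm Mn.
  have := chain_values wM Mm; have := chain_values wM Mn.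
  have := dtri (ext (f m) (chain 0 m s)) (ext (f M) (chain 0 M s)) (ext (f n) (chain 0 n s)).
  rewrite (dC (ext (f m) _) (ext (f M) _)).
  have := half_pow_gt0 R m.+1; have := half_pow_gt0 R n.+1.
  by have := half_powS R M; have := half_pow_gt0 R M; lra.
exists y => k wk; apply/ler_addgt0Pl => e e0.
have [N _ hN] := yP e e0; pose M := maxn k N.
have h1 : d (ext (f M) (chain 0 M s)) y < e by apply: (hN M); exact: leq_maxr.
have := chain_values wk (leq_maxl k N); rewrite -/M.
have := dtri (ext (f k) (chain 0 k s)) (ext (f M) (chain 0 M s)) y.
have := half_pow_gt0 R M.+1; lra.
Qed.

(** In the time of f 0 the paths converge pointwise to v. The limit is v read through the inverse J
    of [limit_change], and is cadlag as a limit of reparametrized f k that is uniform on each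
    half-line bounded above. *)
Lemma rapid_limit : exists F : cadlag_fun T S,
  forall k, jd T_ge0 d (f k) F <= half_pow k.
Proof.
have /choice[v vP] := limit_value_ex.
have [J [tJ LJ JL]] := tchange_inv limit_change_tchange.
have h12 : 0 <= 2^-1 :> R by lra.
have cF : cadlag_line (v \o J).
  apply: (cadlag_uniform_limit md dcomplete) => x e e0.
  have x1 : 0 < (2 * `|x| + 1)^-1 by rewrite invr_gt0; have := normr_ge0 x; lra.
  have [k _ hk] := filterI (half_pow_cvg e0) (half_pow_cvg x1).
  have [/= k1 k2] := hk k (leqnn k).
  exists ((ext (f k) \o chain 0 k) \o J).
    apply: cadlag_tchange tJ _; apply: cadlag_tchange (chain_tchange1 0 k) _.
    exact: cadlag_fun_ext.
  move=> s sx /=.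
  have k3 : half_pow k.+1 <= half_pow k :> R by apply: half_pow_le.
  apply: (@le_trans _ _ (half_pow k.+1)); last by lra.
  apply: vP; apply: window_intro.
  apply: (@le_trans _ _ (2 * `|x| + 1)).
    have [s0|s0] := leP s 0.
      by have [_ _ ->] := tJ; [have := normr_ge0 x; lra|left].
    have [h1 _] := tchange_half_le tJ h12 (lexx _) (ltW s0).
    by have := ler_norm x; lra.
  by rewrite -[leLHS]invrK lef_pV2 ?posrE ?half_pow_gt0 // ltW.
exists (cadlag_restrict T cF) => k; have p := half_pow_gt0 R k.
apply: jdist_le => //.
have [m [tm cm mc]] := tchange_inv (chain_tchange1 0 k).
have tN := rest_tchange mc.
exists (limit_change \o m); first by apply: tchange_le tN; exact: half_pow_le.
move=> x win; rewrite ext_restr /= -(ext_clampr T_ge0 (f k)).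
have -> : clampr T (limit_change (m x)) = limit_change (m (clampr T x)).
  exact: (clampr_tchange T_ge0 _ tN).
set x' := clampr T x; rewrite LJ -{1}(mc x').
have [x'0 _] : horizon T x' by exact: clampr_horizon.
have k3 : half_pow k.+1 <= half_pow k :> R by apply: half_pow_le.
apply: (@le_trans _ _ (half_pow k.+1)); last by [].
(* Here x' may be as large as 2 / half_pow k, too large for [window_intro] after pulling back by m.
   The orbit is followed from step k instead: it at most doubles x', which stays below 4 / half_pow
   j. *)
apply: vP => j kj.
rewrite -(subnKC kj) chain_cat mc.
have hp : 0 <= half_pow k.+1 :> R by exact: ltW (half_pow_gt0 _ _).
have [h1 _] := tchange_half_le (chain_tchange1 k (j - k)) hp (half_pow_le_half k) x'0.
apply: le_trans h1 _; rewrite subnKC // !half_powS !invfM !invrK.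
have i1 : (half_pow k)^-1 <= (half_pow j)^-1 :> R.
  by rewrite lef_pV2 ?posrE ?half_pow_gt0 //; exact: half_pow_le.
have i0 : 0 < (half_pow k)^-1 :> R by rewrite invr_gt0 half_pow_gt0.
have x'le : x' <= 2 * (half_pow k)^-1; last by lra.
case: win => [xk|Nxk].
  apply: le_trans (clampr_le T_ge0 x) _.
  by rewrite ge_max; apply/andP; split; lra.
have [_ h2] := tchange_half_le tN hp (half_pow_le_half k) x'0.
apply: le_trans h2 _; rewrite ler_pM2l // -(clampr_tchange T_ge0 _ tN).
apply: le_trans (clampr_le T_ge0 _) _.
by rewrite ge_max; apply/andP; split => //; lra.
Qed.

End rapid_sequence.

Lemma jd_complete : complete_metric (T := cadlag_fun T S) (jd T_ge0 d).
Proof.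
move=> u cu; have [_ _ jC jtri] := jd_is_metric T_ge0 md.
have [|phi [phi_mono phiP]] := @strictly_increasing_choice
    (fun k n => forall m, (n <= m)%N -> jd T_ge0 d (u n) (u m) < half_pow k.+2).
  move=> k; have [N NP] := cu _ (half_pow_gt0 R k.+2).
  by exists N => // n /= Nn m nm; apply: NP => //; exact: leq_trans nm.
have /choice[l lP] : forall k, exists l, tchange T (half_pow k.+2) l /\ forall s,
    s <= (half_pow k.+2)^-1 \/ l s <= (half_pow k.+2)^-1 ->
    d (ext (u (phi k)) s) (ext (u (phi k.+1)) (l s)) <= half_pow k.+2.
  move=> k; have := phiP k (phi k.+1) (ltnW (phi_mono _ _ (ltnSn k))).
  by move=> /jdist_lt/(_ (half_pow_le_half _))[l tl fl]; exists l.
have [|k s sk|F FP] := @rapid_limit (fun k => u (phi k)) l.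
- by move=> k; have [] := lP k.
- by have [_ h] := lP k; apply: h; left.
exists F => e e0; have e2 : 0 < e / 2 by lra.
have [k _ hk] := half_pow_cvg e2.
have h1 : half_pow k < e / 2 := hk k (leqnn k).
exists (phi k) => // n /= kn.
have := jtri (u n) (u (phi k)) F; have := FP k; have := phiP k n kn.
rewrite (jC (u n) (u (phi k))).
have : half_pow k.+2 <= half_pow k :> R by apply: half_pow_le; rewrite -addn2 leq_addr.
lra.
Qed.

End completeness.

(** * Separability *)

Section separability.
Variables (R : realType) (T : \bar R).
Hypothesis T_ge0 : (0 <= T)%E.
Variables (S : topologicalType) (d : S -> S -> R) (md : metrizes d).
Local Notation ext := (ext T_ge0).

Section codes.
Variable v : nat -> S.

(* Breakpoints are coded by rationals, or by None for the right endpoint of the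
   horizon, which time changes cannot move. *)
Definition breakpoint (o : option rat) : R := if o is Some q then ratr q else fine T.

(** The head of the list is the last piece: its value is taken from its breakpoint on, whatever the
    tail says. *)
Fixpoint code_fun (i0 : nat) (c : seq (option rat * nat)) (s : R) : S :=
  if c is (o, i) :: c' then if s < breakpoint o then code_fun i0 c' s else v i
  else v i0.

Lemma code_fun_cadlag i0 c : cadlag_line (code_fun i0 c).
Proof.
elim: c => [|oi c IH] /=; first exact: cadlag_cst.
case: oi => o i.
by apply: cadlag_paste IH _; exact: cadlag_cst.
Qed.

(** Moving a time inside this one-sided interval does not change the value of the coded path. *)
Lemma code_fun_left i0 c x : exists2 w : R, 0 < w &
  forall s s', x - w <= s -> s < x -> x - w <= s' -> s' < x ->
    code_fun i0 c s = code_fun i0 c s'.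
Proof.
elim: c => [|oi c [w w0 IH]] /=; first by exists 1.
case: oi => o i.
have [xo|ox] := leP x (breakpoint o).
  exists w => // s s' s1 s2 s'1 s'2.
  by rewrite !(lt_le_trans _ xo) //; exact: IH.
exists (x - breakpoint o); first by lra.
move=> s s'; rewrite opprB addrC subrK => s1 _ s'1 _.
by rewrite !ltNge s1 s'1.
Qed.

Hypothesis v_dense : forall x e, 0 < e -> exists i, d x (v i) < e.

(** A tent sends l y to a rational slightly below it. Its half-width w fits into the horizon and
    into the interval left of l y where the coded path is constant, so the approximation before y is
    unaffected. *)
Lemma move_breakpoint e l y i0 c : tchange T e l -> 0 < y -> (y%:E < T)%E ->
  forall k, 0 < k -> k <= 2^-1 -> exists q : rat, exists2 m, tchange T (e + k) m &
    m y = ratr q /\ forall s, s < y -> code_fun i0 c (m s) = code_fun i0 c (l s).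
Proof.
move=> tl y0 yT k k0 k2.
have [z0 _ _] := tchange_pos tl (ltW y0).
have {}z0 : 0 < l y by rewrite -(tchange0 tl) (tchange_lt_mono _ _ tl).
have zT : ((l y)%:E < T)%E.
  rewrite ltNge; apply/negP => Tz.
  have : l (l y) = l y by have [_ _ ->] := tl => //; right.
  by move/(tchange_inj tl) => h; move: Tz; rewrite h leNgt yT.
have [w0 w00 lc] := code_fun_left i0 c (l y).
have [w [w1 ww0 wz wT]] : exists w : R, [/\ 0 < w, w <= w0, w <= l y &
    ((l y + w)%:E <= T)%E].
  have [u u0 uT] : exists2 u : R, 0 < u & ((l y + u)%:E <= T)%E.
    case: T zT => [t||] //; last by exists 1; rewrite ?leey.
    rewrite lte_fin => zt; exists (t - l y); first by lra.
    by rewrite lee_fin; lra.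
  exists (Num.min w0 (Num.min (l y) u)).
  have [h1 h2 h3] : [/\ Num.min w0 (Num.min (l y) u) <= w0,
      Num.min w0 (Num.min (l y) u) <= l y & Num.min w0 (Num.min (l y) u) <= u].
    by split; rewrite !ge_min lexx ?orbT.
  split=> //; first by rewrite !lt_min w00 z0.
  by apply: le_trans uT; rewrite lee_fin; lra.
have kw : 0 < k / 2 * w by rewrite mulr_gt0 //; lra.
have [|q] := @rat_in_itvoo R (l y - k / 2 * w) (l y); first by lra.
rewrite in_itv /= => /andP[q1 q2].
have qk : `|ratr q - l y| <= k / 2 * w by rewrite ltr0_norm; lra.
have [psi [psi_z psi_out psik psi_le]] := tent (l y) w1 qk.
have tpsi : tchange T k (fun x => x + psi x).
  apply: (tchange_perturb _ _ psik); [by lra|by nra|].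
  move=> x [x0|Tx]; apply: psi_out; first by rewrite ltr0_norm; lra.
  have h : l y + w <= x by rewrite -lee_fin; exact: le_trans Tx.
  by rewrite ger0_norm; lra.
have tm := tchange_comp tl tpsi.
exists q, ((fun x => x + psi x) \o l) => //; split; first by rewrite /= psi_z; lra.
move=> s sy /=.
have lsy : l s < l y by rewrite (tchange_lt_mono _ _ tl).
have [far|near] := leP w `|l s - l y|; first by rewrite psi_out // addr0.
have ls : l y - w <= l s by move: near; rewrite ltr0_norm; lra.
apply: lc => //; try lra.
  have h : (l y - w) + psi (l y - w) = l y - w.
    by rewrite psi_out ?addr0 // addrC addKr normrN ger0_norm // ltW.
  have := tchange_le_mono (l y - w) (l s) tpsi.
  by rewrite ls /= h; lra.
have := tchange_lt_mono (l s) (l y) tpsi; rewrite lsy /= psi_z; lra.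
Qed.

(** The time change is adjusted once per breakpoint. The strict bound e' < e leaves room for each
    further adjustment. *)
Lemma code_fun_approx (f : R -> S) e : cadlag_line f -> 0 < e ->
  forall x, exists e' l i0 c, [/\ 0 <= e', e' < e, tchange T e' l &
    forall s, 0 <= s -> (s%:E <= T)%E -> s < x -> d (f s) (code_fun i0 c (l s)) < e].
Proof.
have [[d0 dxx dC dtri] dn] := md.
move=> cf e0; apply: (cadlag_induction cf) => [x x0|x0].
  exists 0, id, 0%N, [::]; split=> //; first exact: tchange_id.
  by move=> s s0 _ sx; lra.
have e2 : 0 < e / 2 by lra.
exists [set x | d x0 x < e / 2]; first exact: metrizes_nbhs.
have [i x0i] := v_dense x0 e2.
move=> y y' y0 yy' fA [e' [l [i0 [c [e'0 e'e tl lc]]]]].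
have fi s : y <= s -> s < y' -> d (f s) (v i) < e.
  move=> ys sy'; have /= := fA s ys sy'; have := dtri (f s) x0 (v i).
  by rewrite (dC (f s) x0); lra.
have [y00|y00] := leP y 0.
  exists 0, id, i, [::]; split=> //; first exact: tchange_id.
  by move=> s s0 _ sy'; apply: fi => //; lra.
(* A breakpoint before T is moved to a rational, T itself is fixed and coded by [None], and after T
   there is nothing left to approximate. *)
have [yT|Ty|yT] := ltgtP y%:E T.
- have [k [k0 k2 ke]] : exists k, [/\ 0 < k, k <= 2^-1 & e' + k < e].
    exists (Num.min 2^-1 ((e - e') / 2)).
    have [h1 h2] : Num.min 2^-1 ((e - e') / 2) <= 2^-1 /\
        Num.min 2^-1 ((e - e') / 2) <= (e - e') / 2 by rewrite !ge_min !lexx orbT.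
    by split=> //; [rewrite lt_min; apply/andP; split; lra|lra].
  have [q [m tm [my mc]]] := move_breakpoint i0 c tl y00 yT k0 k2.
  exists (e' + k), m, i0, ((Some q, i) :: c); split=> //; first by lra.
  move=> s s0 sT sy' /=; rewrite -my (tchange_lt_mono _ _ tm).
  have [sy|ys] := ltP s y; first by rewrite mc //; exact: lc.
  exact: fi.
- exists e', l, i0, c; split=> // s s0 sT sy'; apply: lc => //.
  by rewrite -lte_fin; apply: le_lt_trans Ty.
exists e', l, i0, ((None, i) :: c); split=> // s s0 sT sy' /=.
have ly : l y = y by have [_ _ ->] := tl => //; right; rewrite yT.
rewrite -yT /= -{1}ly (tchange_lt_mono _ _ tl).
have [sy|ys] := ltP s y; first exact: lc.
exact: fi.
Qed.

Definition code_path (c : nat * seq (option rat * nat)) : cadlag_fun T S :=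
  cadlag_restrict T (code_fun_cadlag c.1 c.2).

Lemma code_path_dense (F : cadlag_fun T S) e : 0 < e -> e <= 2^-1 ->
  exists c, jd T_ge0 d F (code_path c) <= e.
Proof.
move=> e0 e2; have ei : 0 < e^-1 by rewrite invr_gt0.
have [e' [l [i0 [c [e'0 e'e tl lc]]]]] :=
  code_fun_approx (cadlag_fun_ext T_ge0 F) e0 (2 * e^-1 + 1).
exists (i0, c); apply: jdist_le => //; exists l; first exact: tchange_le (ltW e'e) tl.
move=> s win; rewrite ext_restr (clampr_tchange T_ge0 _ tl) -(ext_clampr T_ge0 F).
have [s0 sT] := clampr_horizon T_ge0 s.
apply: ltW; apply: lc => //.
case: win => [se|lse].
  apply: le_lt_trans (clampr_le T_ge0 s) _; rewrite gt_max; apply/andP; split; lra.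
have [|_ h] := tchange_half_le tl e'0 _ s0; first by lra.
apply: le_lt_trans h _; rewrite -(clampr_tchange T_ge0 _ tl).
have := clampr_le T_ge0 (l s); case: (leP 0 (l s)); lra.
Qed.

End codes.

Lemma cadlag_fun_separable : separable S -> separable (cadlag_fun T S).
Proof.
move=> [A /countable_injP[g gi] dA].
(* A path provides a point of S, the default value of the enumeration v. *)
have [[F0]|noF] := pselect (inhabited (cadlag_fun T S)); last first.
  by exists set0 => // U [F _]; case: noF.
pose x0 := ext F0 0.
have /choice[v vP] : forall n, exists y, forall x, A x -> g x = n -> y = x.
  move=> n; have [[x [Ax gx]]|no] := pselect (exists x, A x /\ g x = n).
    by exists x => x' Ax' gx'; apply: gi; rewrite ?inE // gx gx'.
  by exists x0 => x Ax gx; case: no; exists x.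
have v_dense x e : 0 < e -> exists i, d x (v i) < e.
  move=> e0; have := metrizes_nbhs x md e0; rewrite nbhsE => -[U [oU Ux] Ue].
  have [y [Uy Ay]] := dA U (ex_intro _ x Ux) oU.
  by exists (g y); rewrite (vP (g y) y Ay erefl); exact: Ue.
exists (range (code_path v)).
  by apply: card_le_trans (card_image_le _ _) _; exact: countableP.
move=> U [F UF] oU; have [_ jn] := metrizes_jd T_ge0 md.
have /jn[e e0 eU] : nbhs F U by exact: open_nbhs_nbhs.
pose e' := Num.min (e / 2) 2^-1.
have e'0 : 0 < e' by rewrite lt_min; apply/andP; split; lra.
have [h1 h2] : e' <= e / 2 /\ e' <= 2^-1 by rewrite !ge_min !lexx orbT.
have [c Fc] := code_path_dense v_dense F e'0 h2.
exists (code_path v c); split; last by exists c.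
by apply: eU => /=; lra.
Qed.

End separability.

(** * Stability and preserved roots *)

Section stability.
Variables (R : realType) (T : \bar R).
Hypothesis T_ge0 : (0 <= T)%E.
Local Notation ext := (ext T_ge0).

Lemma metrizes_mdist (M : metricType R) : metrizes (@mdist R M).
Proof.
split.
  split=> [x y|x y|x y|x y z]; first exact: mdist_ge0.
  - by split=> [/mdist_positivity|->]; last exact: mdistxx.
  - exact: metric_sym.
  - exact: metric_triangle.
move=> x A; rewrite -metricType_numDomainType.filter_from_mdist_nbhs.
by split=> -[e e0 eA]; exists e.
Qed.

Definition max_dist (S S' : Type) (d : S -> S -> R) (d' : S' -> S' -> R) u v :=
  Num.max (d u.1 v.1) (d' u.2 v.2).

Lemma metrizes_max_dist (S S' : topologicalType) (d : S -> S -> R)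
    (d' : S' -> S' -> R) : metrizes d -> metrizes d' ->
  metrizes (T := (S * S')%type) (max_dist d d').
Proof.
move=> md md'; have [[d0 dxx dC dtri] dn] := md.
have [[d'0 d'xx d'C d'tri] dn'] := md'; split.
  split=> [u v|[a x] [b y]|u v|u v w]; rewrite /max_dist /=.
  - by rewrite le_max d0.
  - split=> [ab|[-> ->]]; last by rewrite (dxx _ _).2 // (d'xx _ _).2 // maxxx.
    have [h1 h2] : d a b <= 0 /\ d' x y <= 0 by rewrite -!ab !le_max !lexx orbT.
    have ha : d a b = 0 by apply/eqP; rewrite eq_le h1 d0.
    have hx : d' x y = 0 by apply/eqP; rewrite eq_le h2 d'0.
    by rewrite ((dxx _ _).1 ha) ((d'xx _ _).1 hx).
  - by rewrite dC d'C.
  - rewrite ge_max; apply/andP; split.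
      apply: le_trans (dtri _ v.1 _) _.
      by apply: lerD; rewrite le_max lexx.
    apply: le_trans (d'tri _ v.2 _) _.
    by apply: lerD; rewrite le_max lexx orbT.
move=> [a x] A; split.
  move=> [[U V] /= [/dn[e e0 eU] /dn'[e' e'0 e'V]] UVA].
  exists (Num.min e e'); first by rewrite lt_min e0.
  move=> [b y]; rewrite /max_dist /= gt_max !lt_min => /andP[/andP[h1 _] /andP[_ h2]].
  by apply: UVA; split; [exact: eU|exact: e'V].
move=> [e e0 eA].
exists ([set b | d a b < e], [set y | d' x y < e]).
  by split; apply: metrizes_nbhs.
by move=> [b y] /= [h1 h2]; apply: eA; rewrite /max_dist /= gt_max h1.
Qed.

Variables (S : topologicalType) (M : metricType R).
Variable dE : (S * M)%type -> (S * M)%type -> R.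
Hypothesis mE : metrizes (T := (S * M)%type) dE.

(** An element-rooted metric lives on S * M, so a path and a root are combined into one path with
    constant second coordinate. *)
Definition rooted_path (u : cadlag_fun T S * M) (t : R) : S * M := (ext u.1 t, u.2).

Lemma rooted_path_cadlag u : cadlag_line (rooted_path u).
Proof.
case: u => F x t; have [Ft [l Fl]] := cadlag_fun_ext T_ge0 F t; split.
  move=> A [[U V] /= [/Ft[r r0 rU] /nbhs_singleton Vx] UVA].
  by exists r => // s ts st; apply: UVA; split; [exact: rU|].
exists (l, x) => A [[U V] /= [/Fl[r r0 rU] /nbhs_singleton Vx] UVA].
by exists r => // s ts st; apply: UVA; split; [exact: rU|].
Qed.

Lemma rooted_path_neg u s : s <= 0 -> rooted_path u s = rooted_path u 0.
Proof. by move=> s0; rewrite /rooted_path ext_neg. Qed.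

Definition rooted_dist u v := jdist T dE (rooted_path u) (rooted_path v).

(** The time 0 lies in every window, and there the second coordinates are compared. *)
Lemma jnear_max_dist (d : S -> S -> R) e u v : 0 < e ->
  jnear T (max_dist d (@mdist R M)) e (rooted_path u) (rooted_path v) <->
  jnear T d e (ext u.1) (ext v.1) /\ mdist u.2 v.2 <= e.
Proof.
move=> e0; split=> [[l tl uv]|[[l tl uv] xy]].
  split; first exists l => // s /uv; first by rewrite ge_max => /andP[].
  have := uv 0; rewrite ge_max => /(_ _)/andP[]//.
  by left; rewrite invr_ge0 ltW.
by exists l => // s /uv h; rewrite ge_max h.
Qed.

(** dE itself does not split into coordinates, but [jnear_metric] compares it with a maximum metric,
    for which the product topology is visible. *)
Lemma rooted_dist_metrizes (d : S -> S -> R) : metrizes d ->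
  metrizes (T := (cadlag_fun T S * M)%type) rooted_dist.
Proof.
move=> md; have mm := metrizes_max_dist md (metrizes_mdist M).
have mj := metrizes_jd T_ge0 md.
split.
  split=> [u v|[F x] [G y]|u v|u v w].
  - exact: jdist_ge0.
  - split=> [uv|->]; last exact: jdistxx mE.1 _.
    have E : rooted_path (F, x) = rooted_path (G, y).
      by apply: (jdist_eq0 mE _ _ uv) => t; exact: (rooted_path_cadlag _ t).1.
    have Et t : ext F t = ext G t /\ x = y.
      by have [] : rooted_path (F, x) t = rooted_path (G, y) t by rewrite E.
    congr pair; last exact: (Et 0).2.
    apply: cadlag_fun_eq; apply: (@ext_inj _ _ T_ge0); apply/funext => t.
    exact: (Et t).1.
  - exact: jdist_sym mE.1 _ _.
  - exact: jdist_triangle mE.1 _ _ _.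
have h2 : 0 < 2^-1 :> R by lra.
move=> [F x] A; split.
  move=> [[U V] /= [/mj.2[e1 e10 e1U] /(metrizes_mdist M).2[e2 e20 e2V]] UVA].
  pose e := Num.min (e1 / 2) (e2 / 2).
  have e0 : 0 < e by rewrite lt_min; apply/andP; split; lra.
  have [ee1 ee2] : e <= e1 / 2 /\ e <= e2 / 2 by rewrite !ge_min !lexx orbT.
  have [r r0 rP] := jnear_metric T mm mE (rooted_path_cadlag (F, x))
    (@rooted_path_neg (F, x)) e0.
  exists (Num.min r 2^-1); first by rewrite lt_min r0.
  move=> [G y] /=; rewrite lt_min => /andP[FGr FG2].
  have [r2|r2] := leP r 2^-1.
    have /rP/(jnear_max_dist d _ _ e0)[/= FG xy] := jdist_lt FGr r2.
    apply: UVA; split=> /=.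
      by apply: e1U => /=; apply: le_lt_trans (jdist_le e0 FG) _; lra.
    by apply: e2V => /=; lra.
  have /(jnear_le h2 (ltW r2))/rP/(jnear_max_dist d _ _ e0)[/= FG xy] := jdist_lt FG2 (lexx _).
  apply: UVA; split=> /=.
    by apply: e1U => /=; apply: le_lt_trans (jdist_le e0 FG) _; lra.
  by apply: e2V => /=; lra.
move=> [e e0 eA]; have e2 : 0 < e / 2 by lra.
have [r r0 rP] := jnear_metric T mE mm (rooted_path_cadlag (F, x))
  (@rooted_path_neg (F, x)) e2.
pose q := Num.min r 2^-1.
have q0 : 0 < q by rewrite lt_min r0.
have [qr q2] : q <= r /\ q <= 2^-1 by rewrite !ge_min !lexx orbT.
exists ([set G | jd T_ge0 d F G < q], [set y | mdist x y < r]).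
  by split; [exact: metrizes_nbhs|apply: metrizes_nbhs => //; exact: metrizes_mdist].
move=> [G y] /= [FG xy]; apply: eA; rewrite /= /rooted_dist.
apply: (@le_lt_trans _ _ (e / 2)); last by lra.
apply: jdist_le => //; apply: rP; apply/jnear_max_dist => //; split; last exact: ltW.
exact: (jnear_le q0 qr (jdist_lt FG q2)).
Qed.

End stability.

Lemma tau_D_stably_metrizable (R : realType) (T : \bar R) (sigma : structure R) :
  (0 <= T)%E -> stably_metrizable sigma -> stably_metrizable (tau_D T sigma).
Proof.
move=> T0 [d dE dS]; have [md di] := dE; have [Th [Th0 Thc Thz Ths]] := dS.
exists (fun X => rooted_dist T0 (d X)).
  split=> [X|X Y f F G x y].
    have [d' md'] := st_metrizable (st_laws sigma) X.
    exact: (rooted_dist_metrizes T0 (md X) md').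
  apply/eqP; rewrite eq_le; apply/andP; split; rewrite -[leRHS]addr0;
    apply: jdist_shift => // s t; rewrite addr0 /rooted_path /=.
    by rewrite -(di _ _ f).
  by rewrite -(di _ _ f).
exists Th; split=> // X Y M1 M2 f1 f2 g1 g2 e e0 dist F x G y.
apply: jdist_shift; first exact: Th0.
by move=> s t; rewrite /rooted_path /=; exact: Ths.
Qed.

(** * Open sets of paths and the transfer of Polishness *)

Section polishness.
Variables (R : realType) (T : \bar R).
Hypothesis T_ge0 : (0 <= T)%E.
Local Notation ext := (ext T_ge0).

(* The left limits are included so that this is an open condition on F. *)
Definition inside (S : topologicalType) (x : R) (O : set S) : set (cadlag_fun T S) :=
  [set F | forall t, t <= x -> O (ext F t) /\ forall l, left_limit (ext F) t l -> O l].

Lemma left_limit_unique (S : topologicalType) (d : S -> S -> R) (f : R -> S) t l l' :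
  metrizes d -> left_limit f t l -> left_limit f t l' -> l = l'.
Proof.
move=> md fl fl'; have [[d0 dxx dC dtri] dn] := md; apply/dxx/eqP.
rewrite eq_le d0 andbT; apply/ler_addgt0Pl => e e0; have e2 : 0 < e / 2 by lra.
have [r r0 rl] := fl _ (metrizes_nbhs l md e2).
have [r' r'0 rl'] := fl' _ (metrizes_nbhs l' md e2).
pose q := Num.min r r'; have q0 : 0 < q by rewrite lt_min r0.
have [qr qr'] : q <= r /\ q <= r' by rewrite !ge_min !lexx orbT.
have /= h1 : d l (f (t - q / 2)) < e / 2 by apply: rl; lra.
have /= h2 : d l' (f (t - q / 2)) < e / 2 by apply: rl'; lra.
have := dtri l (f (t - q / 2)) l'; rewrite (dC (f (t - q / 2)) l'); lra.
Qed.

Lemma left_limit_comp (S S' : topologicalType) (h : S -> S') (f : R -> S) t l :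
  continuous h -> left_limit f t l -> left_limit (h \o f) t (h l).
Proof. by move=> hc fl A /hc/fl. Qed.

(** The values of F up to time x and their left limits keep a uniform distance r from the complement
    of O, obtained by [real_induction]. The bound is extended to x + a, since a time change may
    bring in values from just after x. *)
Lemma inside_open (S : topologicalType) (d : S -> S -> R) x (O : set S) :
  metrizes d -> 0 <= x -> open O -> open (inside x O).
Proof.
move=> md x0 oO; have [[d0 dxx dC dtri] dn] := md.
have [_ jn] := metrizes_jd T_ge0 md.
rewrite openE => F FO; apply/jn.
have ball a : O a -> exists2 r, 0 < r & forall b c, d a b < r -> d b c < r -> O c.
  move=> Oa; have /dn[e e0 eO] : nbhs a O by exact: open_nbhs_nbhs.
  exists (e / 2); first by lra.
  by move=> b c ab bc; apply: eO => /=; have := dtri a b c; lra.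
have upto : forall z, exists2 r, 0 < r &
    forall s, 0 <= s -> s < z -> s <= x -> forall y, d (ext F s) y < r -> O y.
  apply: (@real_induction _ _ 0) => [z z0|z].
    by exists 1 => // s s0 sz; lra.
  have [zx|xz] := leP z x; last first.
    exists (z - x); first by lra.
    move=> y y' y1 y2 y3 [r r0 rO]; exists r => // s s0 sy' sx.
    by apply: rO => //; lra.
  have [Fz [l Fl]] := cadlag_fun_ext T_ge0 F z.
  have [/ball[r1 r10 r1O] Ol] := FO z zx.
  have [r2 r20 r2O] := ball l (Ol l Fl).
  have [a1 a10 a1P] := Fz _ (metrizes_nbhs _ md r10).
  have [a2 a20 a2P] := Fl _ (metrizes_nbhs _ md r20).
  exists (Num.min a1 a2); first by rewrite lt_min a10.
  have [h1 h2] : Num.min a1 a2 <= a1 /\ Num.min a1 a2 <= a2.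
    by rewrite !ge_min !lexx orbT.
  move=> y y' y1 y2 y3 [r r0 rO].
  exists (Num.min r (Num.min r1 r2)); first by rewrite !lt_min r0 r10.
  move=> s s0 sy' sx c; rewrite !lt_min => /and3P[cr cr1 cr2].
  have [sy|ys] := ltP s y; first exact: (rO s).
  have [sz|zs] := ltP s z.
    by apply: (r2O (ext F s)) => //; apply: (a2P s); lra.
  by apply: (r1O (ext F s)) => //; apply: (a1P s); lra.
have [r1 r10 r1O] := upto (x + 1).
have [r2 r20 r2O] := ball _ (FO x (lexx x)).1.
have [a a0 aP] := (cadlag_fun_ext T_ge0 F x).1 _ (metrizes_nbhs _ md r20).
have [r r0 rO] : exists2 r, 0 < r &
    forall s, s < x + a -> forall y, d (ext F s) y < r -> O y.
  exists (Num.min r1 r2); first by rewrite lt_min r10.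
  move=> s sx y; rewrite lt_min => /andP[y1 y2].
  have [s0|s0] := leP s 0.
    by apply: (r1O 0) => //; [lra|rewrite -(ext_neg T_ge0 F s0)].
  have [sx'|xs] := leP s x; first by apply: (r1O s) => //; lra.
  by apply: (r2O (ext F s)) => //; apply: (aP s) => //; lra.
(* (x + 1)^-1 puts the times up to x in the window, a / (4 * (x + 1)) gives (1 + 2 * q) * x < x + a,
   and r / 2 leaves room for passing to a left limit. *)
pose q := Num.min (Num.min (r / 2) 2^-1) (Num.min (x + 1)^-1 (a / (4 * (x + 1)))).
have xi : 0 < (x + 1)^-1 by rewrite invr_gt0; lra.
have ai : 0 < a / (4 * (x + 1)) by rewrite divr_gt0 //; lra.
have q0 : 0 < q by rewrite !lt_min xi ai /= andbT; apply/andP; split; lra.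
have [q1 q2 q3 q4] : [/\ q <= r / 2, q <= 2^-1, q <= (x + 1)^-1 &
    q <= a / (4 * (x + 1))].
  by split; rewrite !ge_min lexx ?orbT.
exists q => // G FG; have [l tl FGl] := jdist_lt FG q2.
have near t y : t <= x -> d (ext G t) y < r / 2 -> O y.
  move=> tx ty; have [s ls] := tchange_surj t tl.
  have sx : s < x + a.
    have [s0|s0] := leP s 0; first by lra.
    have [_ _ h] := tchange_pos tl (ltW s0).
    have := expR_le_1D2 (ltW q0) q2 => eq; rewrite ls in h.
    have t0 : 0 <= t by rewrite -ls; have [] := tchange_pos tl (ltW s0).
    have h4 : q * (4 * (x + 1)) <= a by rewrite -ler_pdivlMr //; lra.
    have : expR q * t <= (1 + 2 * q) * x by apply: ler_pM => //; exact: expR_ge0.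
    nra.
  apply: (rO s sx).
  have : d (ext F s) (ext G (l s)) <= q.
    apply: FGl; right; rewrite ls; apply: (le_trans tx).
    have : (x + 1)^-1^-1 <= q^-1 by rewrite lef_pV2 ?posrE.
    by rewrite invrK; lra.
  by rewrite ls; have := dtri (ext F s) (ext G t) y; lra.
move=> t tx; split.
  by apply: (near t) => //; rewrite (dxx _ _).2 //; lra.
have r2' : 0 < r / 2 by lra.
move=> y ty; have [b b0 bP] := ty _ (metrizes_nbhs y md r2').
apply: (near (t - b / 2)); first by lra.
by rewrite dC; apply: (bP (t - b / 2)); lra.
Qed.

Lemma inside_comp (S S' : topologicalType) (d : S' -> S' -> R) (h : S -> S') x
    (O : set S') (F : cadlag_fun T S) (G : cadlag_fun T S') :
  metrizes d -> continuous h -> (forall t, G t = h (F t)) ->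
  inside x O G <-> inside x (h @^-1` O) F.
Proof.
move=> md hc GF.
have E t : ext G t = h (ext F t) by exact: GF.
have EE : ext G = h \o ext F by apply/funext.
split=> H t tx.
  have [Ot Ol] := H t tx; split; first by rewrite /= -E.
  by move=> l Fl; apply: Ol; rewrite EE; exact: left_limit_comp.
have [Ot Ol] := H t tx; split; first by rewrite E.
move=> l Gl; have [_ [l' Fl']] := cadlag_fun_ext T_ge0 F t.
have <- : h l' = l; last exact: Ol.
by apply: (left_limit_unique md _ Gl); rewrite EE; exact: left_limit_comp.
Qed.

Lemma tau_D_polish (sigma : structure R) :
  polish_preserved_roots sigma -> polish_preserved_roots (tau_D T sigma).
Proof.
move=> [tau [eta [tauk [[eta_emb eta_nat] tauk_im [[ec usc lsc] sep [d dr dc]]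
  [tauk_open tauk_pull] eta_range]]]].
have eta_c X : continuous (eta X) by have [] := eta_emb X.
(* The index n codes a pair: the exponent of a time bound [x n], a power of 2, and an index of
   [tauk]. A number that codes no pair repeats the pair (0, 0). *)
pose O n (X : bcm R) (rho : X) : set (tau X) :=
  tauk (odflt (0%N, 0%N) (@unpickle (nat * nat)%type n)).2 X rho.
pose x n : R := (half_pow (odflt (0%N, 0%N) (@unpickle (nat * nat)%type n)).1)^-1.
have x0 n : 0 <= x n by rewrite invr_ge0 ltW // half_pow_gt0.
exists (Structure (tau_D_is_structure T_ge0 tau)),
  (fun X F => CadlagFun (cadlag_comp F (eta_c X))),
  (fun n (X : bcm R) (rho : X) => inside (x n) (O n X rho)).
have met X : exists dX : tau X -> tau X -> R, metrizes dX.
  exact: st_metrizable (st_laws tau) X.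
have pull n (X Y : bcm R) (rhoX : X) (rhoY : Y) (f : isoemb X Y) : f rhoX = rhoY ->
    st_map (tau_D T tau) f @^-1` inside (x n) (O n Y rhoY) = inside (x n) (O n X rhoX).
  move=> fr; have [dY mY] := met Y.
  have ic F : inside (x n) (O n Y rhoY) (st_map (tau_D T tau) f F) <->
      inside (x n) (st_map tau f @^-1` O n Y rhoY) F.
    exact: (inside_comp _ _ mY (@st_map_continuous _ tau _ _ f)).
  have -> : O n X rhoX = st_map tau f @^-1` O n Y rhoY.
    by rewrite /O (tauk_pull _ _ _ _ _ _ fr).
  by apply/seteqP; split=> F /ic.
split.
- split=> [X|X Y f].
    exact: (cadlag_embedding T_ge0 (met X) (eta_emb X)).
  apply/funext => F; apply: cadlag_fun_eq; apply/funext => t.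
  by have /(congr1 (fun h => h (F t))) := eta_nat X Y f.
- by move=> n X Y rhoX rhoY f fr _ [F FO <-]; rewrite -(pull n X Y _ _ f fr) in FO.
- split.
  + split.
    * exact: (tau_D_embedding_continuous T_ge0 ec dr).
    * exact: (tau_D_upper_semicontinuous T_ge0 usc).
    * exact: (tau_D_lower_semicontinuous T_ge0 lsc).
  + move=> X; have [dX mX] := met X.
    exact: (cadlag_fun_separable T_ge0 mX (sep X)).
  + exists (fun X rho => jd T_ge0 (d X rho)).
      split=> [X rho|X Y rhoX rhoY f fr F G].
        exact: (metrizes_jd T_ge0 (dr.1 X rho)).
      apply/eqP; rewrite eq_le; apply/andP; split; rewrite -[leRHS]addr0;
        apply: jdist_shift => // s t; rewrite addr0 -(dr.2 _ _ _ _ _ fr) //.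
    by move=> X rho; exact: (@jd_complete _ _ T_ge0 _ _ (dr.1 X rho) (dc X rho)).
- split=> [n X rho|n X Y rhoX rhoY f fr]; last exact: pull.
  have [dX mX] := met X; apply: (inside_open mX) => //; exact: tauk_open.
move=> X rho; have [dX mX] := met X; apply/seteqP; split=> [_ [F _ <-] n _|F FO].
  have ic : inside (x n) (O n X rho) (CadlagFun (cadlag_comp F (eta_c X))) <->
      inside (x n) (eta X @^-1` O n X rho) F.
    exact: (inside_comp _ _ mX (eta_c X)).
  apply/ic => t _.
  have H c : O n X rho (eta X c).
    have : (\bigcap_k tauk k X rho) (eta X c) by rewrite -eta_range; exists c.
    by apply.
  by split=> [|l _]; exact: H.
have inside_all t i : tauk i X rho (ext F t) /\
    forall l, left_limit (ext F) t l -> tauk i X rho l.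
  have [k tk] := half_pow_inv_unbounded t.
  by have := FO (pickle (k, i)) I t; rewrite /O /x pickleK /=; apply.
have [|t l tl|G GF] := @cadlag_lift _ _ T_ge0 _ _ _ F (eta_emb X).
- by move=> t; rewrite (eta_range X rho) => i _; exact: (inside_all t i).1.
- by rewrite (eta_range X rho) => i _; exact: (inside_all t i).2.
by exists G => //; apply: cadlag_fun_eq; apply/funext => t; exact: GF.
Qed.

End polishness.

Theorem theorem8p14 (R : realType) (sigma : structure R) (T : \bar R)
    (T_ge0 : (0 <= T)%E)
    (sigma_stable : stably_metrizable sigma)
    (sigma_polish : polish_preserved_roots sigma) :
  [/\ is_structure (tau_D T sigma),
      stably_metrizable (tau_D T sigma) &
      polish_preserved_roots (tau_D T sigma)].
Proof.
split; first exact: tau_D_is_structure.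
- exact: tau_D_stably_metrizable.
- exact: tau_D_polish.
Qed.
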